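(* Let $\mathbf e$ be a distinguished nilpotent pair in a classical simple Lie algebra $\mathfrak g$, with associated semisimple pair $\mathbf h$, and let $Z_+(\mathbf e)=\bigoplus_{p,q\ge 0}Z_{p,q}(\mathbf e)$ (sum over rational $p,q\ge0$). Then $\dim Z_+(\mathbf e)\ge \mathrm{rk}\,\mathfrak g$. Equality holds if and only if one of the following holds: (a) $\mathfrak g$ is of type A; (b) $\mathfrak g$ is of type B and the associated pair $(\Gamma^1,\Gamma^2)$ satisfies $\Gamma^2=\emptyset$; (c) $\mathfrak g$ is of type C and the associated pair $(\Gamma^1,\Gamma^2)$ satisfies $\Gamma^1=\emptyset$ or $\Gamma^2=\emptyset$; (d) $\mathfrak g$ is of type D and the associated triple $(\Gamma^1,\Gamma^2,\Gamma^3)$ is such that either $\Gamma^2=\Gamma^3=\emptyset$, or $\Gamma^1=\emptyset$ and one of the following two conditions holds: (i) $\Gamma^2=\{(0,0)\}$ and $\Gamma^3$ has exactly one southwest corner $(i,j)$ with $i,j\le 0$; (ii) $\Gamma^2$ and $\Gamma^3$ are both rectangular.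
   Context: Nilpotent pairs. $K$ is an algebraically closed field of characteristic $0$. A nilpotent pair in a semisimple Lie algebra $\mathfrak g$ over $K$ is a pair $\mathbf e=(e_1,e_2)$ of commuting nilpotent elements for which there is a pair $\mathbf h=(h_1,h_2)$ of commuting semisimple elements with rational eigenvalues in the adjoint action and $[h_i,e_j]=\delta_{i,j}e_j$; $\mathbf h$ is called an associated semisimple pair. $Z(\mathbf e)$, $Z(\mathbf h)$ denote the simultaneous centralizers in $\mathfrak g$, and $Z_{p,q}(\mathbf e)=\{x\in Z(\mathbf e):[h_1,x]=px,[h_2,x]=qx\}$. The pair $\mathbf e$ is distinguished if $Z(\mathbf e)$ contains no nonzero semisimple element and $Z(\mathbf h)$ is a Cartan subalgebra. Diagrams. A diagram is a subset $\Gamma\subset\mathbb R^2$ with $\Gamma\subset\mathbb Z^2+(x,y)$ for some $x,y\in\mathbb R$. It is connected if any two of its elements are joined by a finite sequence of elements of $\Gamma$ with consecutive elements at Euclidean distance $1$. A skew diagram is a finite connected diagram $\Gamma$ such that $(i,j),(i+1,j+1)\in\Gamma$ implies $(i+1,j),(i,j+1)\in\Gamma$; non-empty unless emptiness is explicitly allowed. It is centrally symmetric if $\Gamma=-\Gamma$; then it is integral if $\Gamma\subset\mathbb Z^2$ and non-integral if $\Gamma\subset\mathbb Z^2+(1/2,1/2)$. A southwest (resp. northeast) corner of $\Gamma$ is $(i,j)\in\Gamma$ with $(i-1,j),(i,j-1)\notin\Gamma$ (resp. $(i+1,j),(i,j+1)\notin\Gamma$). $\Gamma$ is rectangular if it has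 exactly one southwest corner and exactly one northeast corner. Associated diagrams (Elashvili–Panyushev classification). Diagram data: Type A: a skew diagram $\Gamma=\Gamma^1$ with $|\Gamma|=\mathrm{rk}\,\mathfrak g+1$ and barycentre $(0,0)$; $\Gamma^2=\Gamma^3=\emptyset$. Type B: centrally symmetric skew diagrams $\Gamma^1$ integral, $\Gamma^2$ non-integral (empty allowed), $|\Gamma^1|+|\Gamma^2|=2\,\mathrm{rk}\,\mathfrak g+1$; $\Gamma^3=\emptyset$. Type C: centrally symmetric skew diagrams $\Gamma^1\subset\mathbb Z^2+(0,1/2)$, $\Gamma^2\subset\mathbb Z^2+(1/2,0)$ (empty allowed), $|\Gamma^1|+|\Gamma^2|=2\,\mathrm{rk}\,\mathfrak g$; $\Gamma^3=\emptyset$. Type D: centrally symmetric skew diagrams $\Gamma^1,\Gamma^2,\Gamma^3$ (empty allowed) with $|\Gamma^1|+|\Gamma^2|+|\Gamma^3|=2\,\mathrm{rk}\,\mathfrak g$, $\Gamma^1$ non-integral, and either $\Gamma^2=\Gamma^3=\emptyset$, or $\Gamma^2,\Gamma^3$ both non-empty and integral with $\Gamma^2\cap\Gamma^3=\{(0,0)\}\neq\Gamma^3$. Model pair: let $V=V_1\oplus V_2\oplus V_3$, $V_k=\bigoplus_{(i,j)\in\Gamma^k}K v^k_{i,j}$, with $v^k_{i,j}=0$ if $(i,j)\notin\Gamma^k$; $h_1v^k_{i,j}=i\,v^k_{i,j}$, $h_2v^k_{i,j}=j\,v^k_{i,j}$. Type A: $\mathfrak g=\mathfrak{sl}(V)$,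 $e_1v^1_{i,j}=v^1_{i+1,j}$, $e_2v^1_{i,j}=v^1_{i,j+1}$. Types B, D: $\mathfrak g=\mathfrak{so}(V)$ for the symmetric form $(v^n_{i,j},v^m_{k,l})=\delta_{i,-k}\delta_{j,-l}\delta_{n,m}$; $e_1v^k_{i,j}=(-1)^{i+j}v^k_{i+1,j}$, $e_2v^k_{i,j}=(-1)^{i+j+1}v^k_{i,j+1}$. Type C: $\mathfrak g=\mathfrak{sp}(V)$ for the alternating form $(v^n_{i,j},v^m_{k,l})=(-1)^{i+j+1/2}\delta_{i,-k}\delta_{j,-l}\delta_{n,m}$; $e_1v^k_{i,j}=v^k_{i+1,j}$, $e_2v^k_{i,j}=v^k_{i,j+1}$. These are distinguished nilpotent pairs with associated semisimple pair $\mathbf h=(h_1,h_2)$. By the known classification of Elashvili and Panyushev, every distinguished nilpotent pair in a classical simple $\mathfrak g$ is conjugate (under $GL(V)$ in type A, $O(V)$ in types B, D, $Sp(V)$ in type C) to such a model pair; the diagrams $\Gamma^k$ of the model are the diagrams associated to $\mathbf e$. *)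

(* Defs.v *)
From mathcomp Require Import all_boot all_order all_algebra.
From mathcomp Require Export finmap.
From mathcomp Require Import boolp.

Set Implicit Arguments.
Unset Strict Implicit.
Unset Printing Implicit Defensive.

Import Order.TTheory GRing.Theory Num.Theory.
Import passmx.
Local Open Scope ring_scope.

(** * Sum of a possibly infinite family of subspaces *)

Section FamilySum.
Variables (F : fieldType) (V : vectType F) (I : Type).
Variables (P : pred I) (W : I -> {vspace V}).

Lemma vsum_exists : exists S : {vspace V},
  (forall i, P i -> (W i <= S)%VS) /\
  (forall T : {vspace V}, (forall i, P i -> (W i <= T)%VS) -> (S <= T)%VS).
Proof.
suff H k : forall S : {vspace V}, (\dim {:V} - \dim S <= k)%N ->
  (forall T : {vspace V}, (forall i, P i -> (W i <= T)%VS) -> (S <= T)%VS) ->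
  exists S : {vspace V}, (forall i, P i -> (W i <= S)%VS) /\
  (forall T : {vspace V}, (forall i, P i -> (W i <= T)%VS) -> (S <= T)%VS).
  by apply: (H _ 0%VS (leqnn _)) => T _; apply: sub0v.
elim: k => [|k IHk] S dS minS.
  exists S; split=> // i _; suff -> : S = fullv by apply: subvf.
  by apply/eqP; rewrite eqEdim subvf /= -subn_eq0 -leqn0.
have [allS|] := pselect (forall i, P i -> (W i <= S)%VS); first by exists S.
move=> /existsNP[i /not_implyP[Pi /negP WiS]].
apply: (IHk (S + W i)%VS) => [|T WT]; last by rewrite subv_add minS //= WT.
rewrite -ltnS; apply: leq_trans dS; rewrite ltn_sub2l //.
  by rewrite (leq_trans _ (dimvS (subvf (S + W i)))) // ltnNge;
    apply: contra WiS => le; have /eqP -> : S == (S + W i)%VS;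
    rewrite ?addvSr // eqEdim addvSl.
by rewrite ltnNge; apply: contra WiS => le; have /eqP -> : S == (S + W i)%VS;
  rewrite ?addvSr // eqEdim addvSl.
Qed.

Definition vsum : {vspace V} := sval (cid vsum_exists).

Lemma vsum_sup i : P i -> (W i <= vsum)%VS.
Proof. by rewrite /vsum; case: cid => S [H _] /=; apply: H. Qed.

Lemma vsum_min (T : {vspace V}) :
  (forall i, P i -> (W i <= T)%VS) -> (vsum <= T)%VS.
Proof. by rewrite /vsum; case: cid => S [_ H] /=; apply: H. Qed.

End FamilySum.

(** * Linear Lie algebras: subspaces of ['M[K]_n] under the commutator.
    Matrices act on column vectors. *)

Section LieAlgebra.
Variables (K : fieldType) (n : nat).
Implicit Types (g U W : {vspace 'M[K]_n}) (x y : 'M[K]_n) (e h : 'M[K]_n * 'M[K]_n).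

Definition ad x : 'End('M[K]_n) := linfun (mulmx x) - linfun (mulmxr x).

Lemma adE x y : ad x y = x *m y - y *m x.
Proof. by rewrite /ad add_lfunE opp_lfunE !lfunE. Qed.

Definition lie_prod U W : {vspace 'M[K]_n} :=
  <<[seq ad x y | x <- vbasis U, y <- vbasis W]>>%VS.

Definition lie_nilpotent U := exists k, iter k (lie_prod U) U = 0%VS.

(* A Cartan subalgebra: nilpotent and equal to its normalizer in [g]. *)
Definition cartan_subalgebra g U :=
  [/\ (U <= g)%VS, (lie_prod U U <= U)%VS, lie_nilpotent U &
      forall x, x \in g -> (ad x @: U <= U)%VS -> x \in U].

(* The next notions refer to the adjoint action on [g], not to the natural
   action on column vectors. *)
Definition nilpotent_in g x :=
  x \in g /\ exists k, forall y, y \in g -> iter k (ad x) y = 0.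

Definition semisimple_in g x :=
  x \in g /\ exists s : seq K, (g <= \sum_(a <- s) (g :&: leigenspace (ad x) a))%VS.

Definition rational_eigenvalues g x :=
  forall (a : K) y, y \in g -> y != 0 -> ad x y = a *: y ->
    exists q : rat, a = ratr q.

Definition centralizer g e : {vspace 'M[K]_n} :=
  (g :&: lker (ad e.1) :&: lker (ad e.2))%VS.

Definition graded_centralizer g e h (p q : rat) : {vspace 'M[K]_n} :=
  (centralizer g e :&: leigenspace (ad h.1) (ratr p)
                   :&: leigenspace (ad h.2) (ratr q))%VS.

Definition positive_centralizer g e h : {vspace 'M[K]_n} :=
  vsum [pred pq : rat * rat | (0 <= pq.1) && (0 <= pq.2)]
       (fun pq => graded_centralizer g e h pq.1 pq.2).

Definition associated_semisimple_pair g e h :=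
  [/\ semisimple_in g h.1 /\ semisimple_in g h.2,
      rational_eigenvalues g h.1 /\ rational_eigenvalues g h.2,
      ad h.1 h.2 = 0,
      ad h.1 e.1 = e.1 /\ ad h.1 e.2 = 0 &
      ad h.2 e.1 = 0 /\ ad h.2 e.2 = e.2].

(* [e] is a nilpotent pair in [g] with associated semisimple pair [h]. *)
Definition nilpotent_pair g e h :=
  [/\ nilpotent_in g e.1, nilpotent_in g e.2, ad e.1 e.2 = 0 &
      associated_semisimple_pair g e h].

Definition distinguished_pair g e h :=
  [/\ nilpotent_pair g e h,
      forall x, x \in centralizer g e -> semisimple_in g x -> x = 0 &
      cartan_subalgebra g (centralizer g h)].

End LieAlgebra.

(** * Classical simple Lie algebras *)

Variant classical_type := TypeA | TypeB | TypeC | TypeD.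

(* [D_2] is semisimple but not simple, [D_1] is a torus. *)
Definition simple_rank (t : classical_type) (r : nat) : bool :=
  match t with TypeD => (2 < r)%N | _ => (0 < r)%N end.

Definition natdim (t : classical_type) (r : nat) : nat :=
  match t with
  | TypeA => r.+1 | TypeB => (2 * r).+1%N | TypeC | TypeD => (2 * r)%N
  end.

Section Classical.
Variable (K : fieldType).

Definition sl_alg n : {vspace 'M[K]_n} := lker (linfun (@mxtrace K n : 'M[K]_n -> K^o)).

Lemma mem_sl_alg n (x : 'M[K]_n) : (x \in sl_alg n) = (\tr x == 0).
Proof. by rewrite memv_ker lfunE. Qed.

(* The endomorphisms that are skew for the form [(v, w) |-> v^T *m J *m w]. *)
Definition skew_alg n (J : 'M[K]_n) : {vspace 'M[K]_n} :=
  lker (linfun (mulmxr J \o trmx) + linfun (mulmx J)).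

Lemma mem_skew_alg n (J x : 'M[K]_n) :
  (x \in skew_alg J) = (x^T *m J + J *m x == 0).
Proof. by rewrite memv_ker add_lfunE !lfunE. Qed.

(* In type A there is no form, and [J] is ignored here and below. *)
Definition admissible_form (t : classical_type) n (J : 'M[K]_n) : Prop :=
  match t with
  | TypeA => True
  | TypeB | TypeD => J^T = J /\ J \in unitmx
  | TypeC => (forall v : 'cV[K]_n, v^T *m J *m v = 0) /\ J \in unitmx
  end.

Definition classical_algebra (t : classical_type) n (J : 'M[K]_n) : {vspace 'M[K]_n} :=
  match t with TypeA => sl_alg n | _ => skew_alg J end.

End Classical.

(** * Diagrams.  Rational coordinates lose nothing: a finite subset of a
    translate of Z^2 with barycentre 0 has rational coordinates, and the
    diagrams of the other types have half-integral ones. *)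

Notation point := (rat * rat)%type.

Implicit Types (G : {fset point}) (p q : point).

Definition in_lattice (a : point) G :=
  forall p, p \in G -> p.1 - a.1 \is a Num.int /\ p.2 - a.2 \is a Num.int.

Definition is_diagram G := exists a, in_lattice a G.

Definition adjacent p q := (p.1 - q.1) ^+ 2 + (p.2 - q.2) ^+ 2 == 1.

Definition connected G :=
  forall p q, p \in G -> q \in G ->
    exists s : seq point, [/\ path adjacent p s, {subset s <= G} & last p s = q].

(* The empty diagram is allowed; non-emptiness is required separately. *)
Definition skew_diagram G :=
  [/\ is_diagram G, connected G &
      forall i j, (i, j) \in G -> (i + 1, j + 1) \in G ->
        (i + 1, j) \in G /\ (i, j + 1) \in G].

Definition centrally_symmetric G := forall i j, (i, j) \in G -> (- i, - j) \in G.

Definition sym_skew (a : point) G :=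
  [/\ skew_diagram G, centrally_symmetric G & in_lattice a G].

Definition sw_corner G p :=
  [&& p \in G, (p.1 - 1, p.2) \notin G & (p.1, p.2 - 1) \notin G].

Definition ne_corner G p :=
  [&& p \in G, (p.1 + 1, p.2) \notin G & (p.1, p.2 + 1) \notin G].

Definition rectangular G :=
  #|` [fset p in G | sw_corner G p]%fset| = 1%N /\
  #|` [fset p in G | ne_corner G p]%fset| = 1%N.

Definition one_nonpositive_sw_corner G :=
  #|` [fset p in G | [&& sw_corner G p, p.1 <= 0 & p.2 <= 0]]%fset| = 1%N.

Definition diagram_data (t : classical_type) (r : nat) (G1 G2 G3 : {fset point}) : Prop :=
  match t with
  | TypeA =>
      [/\ skew_diagram G1, #|` G1| = r.+1,
          \sum_(p <- G1) p.1 = 0 /\ \sum_(p <- G1) p.2 = 0,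
          G2 = fset0 & G3 = fset0]
  | TypeB =>
      [/\ sym_skew (0, 0) G1 /\ G1 <> fset0, sym_skew (2^-1, 2^-1) G2,
          (#|` G1| + #|` G2| = (2 * r).+1)%N & G3 = fset0]
  | TypeC =>
      [/\ sym_skew (0, 2^-1) G1, sym_skew (2^-1, 0) G2,
          (#|` G1| + #|` G2| = 2 * r)%N & G3 = fset0]
  | TypeD =>
      [/\ sym_skew (2^-1, 2^-1) G1,
          (#|` G1| + #|` G2| + #|` G3| = 2 * r)%N &
          (G2 = fset0 /\ G3 = fset0) \/
          [/\ sym_skew (0, 0) G2 /\ G2 <> fset0, sym_skew (0, 0) G3 /\ G3 <> fset0,
              (G2 `&` G3)%fset = [fset (0, 0)]%fset & G3 <> [fset (0, 0)]%fset]]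
  end.

(** * Model pairs *)

Section Model.
Variables (K : fieldType) (n : nat).
Implicit Types (J : 'M[K]_n) (e : 'M[K]_n * 'M[K]_n).

(* (-1)^x, for x a rational integer *)
Definition sgnq (x : rat) : K := (-1) ^ numq x.

Definition model_e1_coef (t : classical_type) (p : point) : K :=
  match t with TypeB | TypeD => sgnq (p.1 + p.2) | _ => 1 end.

Definition model_e2_coef (t : classical_type) (p : point) : K :=
  match t with TypeB | TypeD => sgnq (p.1 + p.2 + 1) | _ => 1 end.

Definition model_form (t : classical_type) (k m : 'I_3) (p q : point) : K :=
  (match t with TypeC => sgnq (p.1 + p.2 + 2^-1) | _ => 1 end)
  *+ [&& p.1 == - q.1, p.2 == - q.2 & k == m].

(* [v k p] plays the role of the basis vector of the model space attached to
   the cell [p] of the [k]-th diagram, [k] counted from 0. *)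
Definition model_basis (D : 'I_3 -> {fset point}) (v : 'I_3 -> point -> 'cV[K]_n) :=
  (forall k p, p \notin D k -> v k p = 0) /\
  basis_of fullv (flatten [seq [seq v k p | p <- enum_fset (D k)] | k <- enum 'I_3]).

(* [e] is conjugate to the model pair of the diagrams: sending the basis of
   the model space to [v] is a linear isomorphism onto column vectors, an
   isometry outside type A, and carries the model pair to [e]. *)
Definition associated_diagrams (t : classical_type) J e (G1 G2 G3 : {fset point}) : Prop :=
  let D := tnth [tuple G1; G2; G3] in
  exists v : 'I_3 -> point -> 'cV[K]_n,
  [/\ model_basis D v,
      forall k p, p \in D k -> e.1 *m v k p = model_e1_coef t p *: v k (p.1 + 1, p.2),
      forall k p, p \in D k -> e.2 *m v k p = model_e2_coef t p *: v k (p.1, p.2 + 1) &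
      t <> TypeA -> forall k m p q, p \in D k -> q \in D m ->
        (v k p)^T *m J *m v m q = (model_form t k m p q)%:M].

End Model.

(* Main.v *)
(** Let [T] be the centralizer of [h], of dimension at least the rank.  Split [T]
    by the least degree at which the products of [ad e.1] and [ad e.2] vanish: on
    the layer of degree [k], the map [(ad e.1 + ad e.2)^(k-1)] is injective
    into the components of nonnegative weight of the centralizer [Z] of [e], so
    that their dimensions add up to at least [dim T].

    For equality, [Z] consists of nilpotent matrices, hence acts nilpotently on
    itself by Engel's theorem.  Two associated semisimple pairs differ by elements
    of [Z], so the dimension does not depend on [h], and it can be computed with
    the weights of the model.  In the model an entry of a commuting matrix
    propagates along overlaps of one diagram with a translate of another.  For
    matrices preserving the diagrams, each overlap has a north-west end, which
    gives at most one dimension per cell; outside type A this bounds the sum of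
    the skew and the symmetric parts, and the first argument bounds each of them
    from below, so both bounds are sharp.  The diagonal part thus contributes the
    number of positive cells, half the number of nonzero ones, which is the rank
    except in type D with [Gamma^2], [Gamma^3] nonempty, where it is one less.
    It remains to decide when the homomorphisms between distinct diagrams,
    taken up to transposition, span a space of dimension 0, respectively 1.  A
    southwest corner below a northeast corner always supports one.  A second one
    comes from a second southwest corner below the origin when the other diagram
    is a point, and from the crossing of the two diagrams at the origin when
    neither is a point and one is not rectangular. *)

Require Import Defs.
From mathcomp Require Import all_boot all_order all_algebra all_fingroup.
From mathcomp Require Import boolp ring lra zify.
From HB Require Import structures.

Set Implicit Arguments.
Unset Strict Implicit.
Unset Printing Implicit Defensive.

Import Order.TTheory GRing.Theory Num.Theory passmx.
Local Open Scope ring_scope.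

(** * Joint eigenvectors *)

(** The conjugation to the model transports [e] only, so the given [h] and the weights of the model
    are a priori unrelated. They are never conjugated into each other: sums of weight vectors with
    disjoint sets of weights for the two pairs are shown to meet trivially, and counting dimensions
    does the rest.

    Powers of [ad e.1 + ad e.2] control all products of one degree at once, because the terms of the
    binomial expansion have distinct [ad h.1]-weights and, in characteristic 0, nonzero
    coefficients; the total weight then separates the different powers.

    Both the bound of [dim T] by the rank and the nilpotency of [Z] use the Jordan decomposition
    inside the classical algebra. The semisimple part is taken as an odd polynomial in the matrix,
    since odd polynomials preserve skewness for a form.

    The defect in type D comes from the origin: the size of the matrices is twice the number of
    positive cells plus the number of diagrams containing the origin, which is 1 in type B, 0 in
    type C and 2 in type D when [Gamma^2] and [Gamma^3] are nonempty. *)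

Section RatrChar0.
Variables (K : fieldType) (charK : [pchar K] =i pred0).

Lemma intr_eq0_char0 (m : int) : (m%:~R == 0 :> K) = (m == 0).
Proof.
case: m => n; first by rewrite -pmulrn ((pcharf0P K).1 charK).
by rewrite NegzE mulrNz oppr_eq0 -pmulrn ((pcharf0P K).1 charK).
Qed.

Lemma denq_neq0_char0 (q : rat) : (denq q)%:~R != 0 :> K.
Proof. by rewrite intr_eq0_char0 denq_eq0. Qed.

(** [ratr] is defined by the reduced fraction; cross-multiplying integers shows that any other
    fraction gives the same value. Additivity over a field of characteristic 0 follows by using a
    common denominator. *)
Lemma ratr_frac (m d : int) : d != 0 -> ratr (m%:~R / d%:~R) = m%:~R / d%:~R :> K.
Proof.
move=> d0; have dK : d%:~R != 0 :> K by rewrite intr_eq0_char0.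
rewrite /ratr; apply/eqP; rewrite eqr_div ?denq_neq0_char0 //.
set q : rat := _ / _; have dQ : d%:~R != 0 :> rat by rewrite intr_eq0.
have : (numq q)%:~R * d%:~R = m%:~R * (denq q)%:~R :> rat.
  apply/eqP; rewrite -eqr_div ?intr_eq0 ?denq_eq0 //.
  by rewrite divq_num_den.
by rewrite -!intrM => /eqP; rewrite eqr_int => /eqP ->.
Qed.

Lemma ratrB_char0 (p q : rat) : ratr (p - q) = ratr p - ratr q :> K.
Proof.
have := denq_neq0_char0 p; have := denq_neq0_char0 q => dqK dpK.
have dpQ : (denq p)%:~R != 0 :> rat by rewrite intr_eq0 denq_eq0.
have dqQ : (denq q)%:~R != 0 :> rat by rewrite intr_eq0 denq_eq0.
have -> : p - q = (numq p * denq q - numq q * denq p)%:~R / (denq p * denq q)%:~R.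
  rewrite -{1}[p]divq_num_den -{1}[q]divq_num_den intrB !intrM.
  by field; rewrite dpQ dqQ.
rewrite ratr_frac ?mulf_neq0 ?denq_eq0 // intrB !intrM /ratr.
by field; rewrite dpK dqK.
Qed.

Lemma ratr_eq0_char0 (q : rat) : (ratr q == 0 :> K) = (q == 0).
Proof.
rewrite /ratr mulf_eq0 invr_eq0 (negbTE (denq_neq0_char0 q)) orbF.
by rewrite intr_eq0_char0 numq_eq0.
Qed.

Lemma ratr_inj_char0 : injective (ratr : rat -> K).
Proof.
by move=> p q /eqP; rewrite -subr_eq0 -ratrB_char0 ratr_eq0_char0 subr_eq0 => /eqP.
Qed.

Lemma ratr1_char0 : ratr 1 = 1 :> K.
Proof. exact: (ratr_nat K 1). Qed.

Lemma ratrN_char0 (q : rat) : ratr (- q) = - ratr q :> K.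
Proof. by rewrite -[- q]add0r ratrB_char0 (ratr_nat K 0) add0r. Qed.

Lemma ratrD_char0 (p q : rat) : ratr (p + q) = ratr p + ratr q :> K.
Proof. by rewrite -[q in LHS]opprK ratrB_char0 ratrN_char0 opprK. Qed.

Lemma natr_inj_char0 : injective (fun i => i%:R : K).
Proof.
move=> i j /eqP; wlog le_ij : i j / (i <= j)%N.
  by move=> H; case/orP: (leq_total i j) => le; [|rewrite eq_sym => /(H _ _ le) ->//]; apply: H.
rewrite eq_sym -subr_eq0 -natrB // ((pcharf0P K).1 charK) subn_eq0 => le_ji.
by apply/eqP; rewrite eqn_leq le_ij.
Qed.

Lemma bin_neq0_char0 m i : (i <= m)%N -> ('C(m, i))%:R != 0 :> K.
Proof. by move=> le; rewrite ((pcharf0P K).1 charK) -lt0n bin_gt0. Qed.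

End RatrChar0.

Section JointEigenvectors.
Variables (K : fieldType) (V : vectType K) (T : eqType).

Lemma mem_leigenspace (f : 'End(V)) a v : (v \in leigenspace f a) = (f v == a *: v).
Proof.
by rewrite /leigenspace memv_ker add_lfunE opp_lfunE scale_lfunE id_lfunE subr_eq0.
Qed.

(** Applying [A - a k] or [B - b k] to the sum removes the head term [k] and rescales the others. By
    induction the rescaled terms lie in [S], and each [i] differs from [k] in one of the two
    eigenvalues, so one of the two scalars can be inverted. *)
Lemma joint_split (A B : 'End(V)) (a b : T -> K) (S : {vspace V}) (s : seq T)
    (v : T -> V) :
  (forall x, x \in S -> A x \in S) -> (forall x, x \in S -> B x \in S) ->
  uniq s -> {in s &, forall i j, a i = a j -> b i = b j -> i = j} ->
  {in s, forall i, A (v i) = a i *: v i /\ B (v i) = b i *: v i} ->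
  \sum_(i <- s) v i \in S -> {in s, forall i, v i \in S}.
Proof.
move=> AS BS; elim: s v => [|k s IHs] v //= /andP[ks us] ab_inj ev.
rewrite big_cons => vS.
have tail : {in s, forall i, v i \in S}.
  move=> i si.
  have E (C : 'End(V)) (c : T -> K) : (forall x, x \in S -> C x \in S) ->
      {in k :: s, forall j, C (v j) = c j *: v j} -> (c i - c k) *: v i \in S.
    move=> CS Cv; apply: (IHs (fun j => (c j - c k) *: v j)) => //.
    - by move=> x y sx sy; apply: ab_inj; rewrite inE ?sx ?sy orbT.
    - move=> j sj; have [Aj Bj] := ev j (@mem_behead _ (k :: s) _ sj).
      by rewrite !linearZ /= Aj Bj !scalerA ![(c j - c k) * _]mulrC.
    have := memvB (CS _ vS) (memvZ (c k) vS).
    rewrite linearD /= linear_sum /= Cv ?mem_head // scalerDr scaler_sumr.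
    rewrite opprD addrACA subrr add0r -sumrB => SS.
    rewrite (eq_big_seq (fun j => C (v j) - c k *: v j)) // => j sj /=.
    by rewrite Cv ?inE ?sj ?orbT // scalerBl.
  have [eq_a|ne_a] := eqVneq (a i) (a k); last first.
    have := E A a AS (fun j sj => (ev j sj).1).
    move=> /(memvZ (a i - a k)^-1); rewrite scalerA mulVf ?scale1r //.
    by rewrite subr_eq0.
  have [eq_b|ne_b] := eqVneq (b i) (b k); last first.
    have := E B b BS (fun j sj => (ev j sj).2).
    move=> /(memvZ (b i - b k)^-1); rewrite scalerA mulVf ?scale1r //.
    by rewrite subr_eq0.
  by move: ks; rewrite -(ab_inj i k) ?si // inE ?si ?eqxx ?orbT.
move=> i; rewrite inE => /predU1P[->|/tail //].
have := memvB vS (_ : \sum_(j <- s) v j \in S); rewrite addrK; apply.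
by rewrite big_seq; apply: memv_suml.
Qed.

Lemma eigen_split (A : 'End(V)) (a : T -> K) (S : {vspace V}) (s : seq T)
    (v : T -> V) :
  (forall x, x \in S -> A x \in S) ->
  uniq s -> {in s &, injective a} -> {in s, forall i, A (v i) = a i *: v i} ->
  \sum_(i <- s) v i \in S -> {in s, forall i, v i \in S}.
Proof.
move=> AS us a_inj ev; apply: (@joint_split A A a a) => // [i j si sj ? _|i si].
  exact: a_inj.
by rewrite ev.
Qed.

Lemma memv_sum_uniq_seq (sq : seq T) (W : T -> {vspace V}) (y : V) :
  uniq sq -> y \in (\sum_(a <- sq) W a)%VS ->
  exists v : T -> V, y = \sum_(a <- sq) v a /\ {in sq, forall a, v a \in W a}.
Proof.
elim: sq y => [|a sq IHsq] y /=.
  by rewrite big_nil memv0 => _ /eqP ->; exists (fun => 0); rewrite big_nil.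
case/andP=> asq usq; rewrite big_cons => /memv_addP[u uW [w /(IHsq _ usq)[v [-> vW]] ->]].
exists (fun b => if b == a then u else v b); split.
  rewrite big_cons eqxx; congr (_ + _); apply: eq_big_seq => b bsq.
  by case: eqP => // ba; rewrite -ba bsq in asq.
by move=> b; rewrite inE; case: eqP => [->|_ /vW].
Qed.

End JointEigenvectors.

(* A triangular substitute for the limit, as [t] tends to 0, of the space of
   [exp (- (E1 + E2) / t)]-conjugates of [T]. *)
Section LowerBound.
Variables (K : fieldType) (charK : [pchar K] =i pred0) (V : vectType K).
Variables (E1 E2 H1 H2 : 'End(V)) (T Y : {vspace V}).
Hypotheses (EC : forall x, E1 (E2 x) = E2 (E1 x)).
Hypotheses (H1E1 : forall x, H1 (E1 x) = E1 (H1 x) + E1 x)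
           (H1E2 : forall x, H1 (E2 x) = E2 (H1 x))
           (H2E1 : forall x, H2 (E1 x) = E1 (H2 x))
           (H2E2 : forall x, H2 (E2 x) = E2 (H2 x) + E2 x).
Hypotheses (TH1 : forall x, x \in T -> H1 x = 0) (TH2 : forall x, x \in T -> H2 x = 0).

Let Q i j x := iter i E1 (iter j E2 x).

Let E1Q i j x : E1 (Q i j x) = Q i.+1 j x. Proof. by []. Qed.

Let E2Q i j x : E2 (Q i j x) = Q i j.+1 x.
Proof. by rewrite /Q; elim: i => //= i <-; rewrite EC. Qed.

Hypothesis nilQ : exists m, forall x i j, x \in T -> (i + j = m)%N -> Q i j x = 0.
Hypothesis Y_top : forall x i j, x \in T ->
  E1 (Q i j x) = 0 -> E2 (Q i j x) = 0 ->
  H1 (Q i j x) = i%:R *: Q i j x -> H2 (Q i j x) = j%:R *: Q i j x -> Q i j x \in Y.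

Let H1Q i j x : x \in T -> H1 (Q i j x) = i%:R *: Q i j x.
Proof.
move=> xT; elim: i => [|i IHi]; last first.
  by rewrite /Q /= H1E1 IHi linearZ /= -[E1 _ in RHS]scale1r -natr1 scalerDl
             !scale1r.
rewrite scale0r; elim: j => [|j IHj] /=; first exact: TH1.
by rewrite /Q /= in IHj *; rewrite H1E2 IHj linear0.
Qed.

Let H2Q i j x : x \in T -> H2 (Q i j x) = j%:R *: Q i j x.
Proof.
move=> xT; elim: i => [|i IHi]; last by rewrite /Q /= H2E1 IHi linearZ.
elim: j => [|j IHj] /=; first by rewrite scale0r; exact: TH2.
by rewrite /Q /= in IHj *; rewrite H2E2 IHj linearZ /= -natr1 scalerDl scale1r.
Qed.

Let N : 'End(V) := E1 + E2.
Let Npow k : 'End(V) := iter k (comp_lfun N) \1%VF.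
Let NpowE k x : Npow k x = \sum_(i < k.+1) Q i (k - i) x *+ 'C(k, i).
Proof.
elim: k => [|k IHk]; first by rewrite big_ord1 /Npow /= id_lfunE.
rewrite [Npow _]/Npow /= comp_lfunE -/(Npow k) IHk linear_sum /=.
rewrite (eq_bigr (fun i : 'I_k.+1 =>
   Q i.+1 (k.+1 - i.+1) x *+ 'C(k, i) + Q i (k.+1 - i) x *+ 'C(k, i))); last first.
  move=> i _; rewrite linearMn /= /N add_lfunE E1Q E2Q mulrnDl.
  by rewrite ?subSS (subSn (ltn_ord i : i <= k)%N).
rewrite big_split /= [RHS]big_ord_recl bin0.
rewrite [X in _ + X]big_ord_recl bin0 addrCA; congr (_ + _).
rewrite [RHS](eq_bigr (fun i : 'I_k.+1 => Q i.+1 (k.+1 - i.+1) x *+ 'C(k, i) +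
   Q i.+1 (k.+1 - i.+1) x *+ 'C(k, i.+1))); last first.
  by move=> i _; rewrite lift0 binS -mulrnDr addnC.
rewrite big_split; congr (_ + _).
rewrite [RHS]big_ord_recr bin_small // mulr0n Monoid.mulm1.
by apply: eq_bigr => i _; rewrite lift0.
Qed.

(** The terms of the expansion of [Npow k x] are eigenvectors of [H1] for the distinct values 0,
    ..., [k], so they vanish separately; the binomial coefficients are invertible. *)
Let Npow_eq0 k x : x \in T -> Npow k x = 0 -> forall i j, (i + j = k)%N -> Q i j x = 0.
Proof.
move=> xT; rewrite NpowE => s0 i j ijk.
pose v (i : 'I_k.+1) := Q i (k - i) x *+ 'C(k, i).
have lt_ik : (i < k.+1)%N by rewrite ltnS -ijk leq_addr.
have : v (Ordinal lt_ik) \in 0%VS.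
  apply: (@eigen_split _ _ _ H1 (fun i : 'I_k.+1 => i%:R) 0%VS (index_enum 'I_k.+1)).
  - by move=> y; rewrite !memv0 => /eqP ->; rewrite linear0.
  - exact: index_enum_uniq.
  - by move=> a b _ _ /(natr_inj_char0 charK) /val_inj.
  - by move=> a _; rewrite /v linearMn /= H1Q // scalerMnr.
  - by rewrite memv0 /v s0.
  - by rewrite mem_index_enum.
rewrite memv0 /v /= -ijk addKn -scaler_nat scaler_eq0.
by rewrite (negbTE (bin_neq0_char0 charK (leq_addr _ _))) => /eqP.
Qed.

Let Npow0 k x : (forall i j, (i + j = k)%N -> Q i j x = 0) -> Npow k x = 0.
Proof.
move=> Q0; rewrite NpowE big1 // => i _; rewrite Q0 ?mul0rn //.
by rewrite subnKC // -ltnS.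
Qed.

Let D := H1 + H2.
Let DQ i j x : x \in T -> D (Q i j x) = (i + j)%:R *: Q i j x.
Proof. by move=> xT; rewrite /D add_lfunE H1Q // H2Q // -scalerDl natrD. Qed.

Let DN k x : x \in T -> D (Npow k x) = k%:R *: Npow k x.
Proof.
move=> xT; rewrite NpowE linear_sum scaler_sumr; apply: eq_bigr => i _ /=.
by rewrite linearMn /= DQ // subnKC ?scalerMnr // -ltnS.
Qed.

(** [F] filters [T] by the degree from which the products vanish, and [Npow k] embeds [F k.+1]
    modulo [F k]. The sum [G k] of these images plays the role of the associated graded space. *)
Let F k : {vspace V} := (T :&: lker (Npow k))%VS.
Let G k := (\sum_(i < k) Npow i @: F i.+1)%VS.

(** [H1 + H2] has eigenvalue [k] on [Npow k x] and only eigenvalues below [k] on the summands of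
    [G k]. *)
Let G_free k x : x \in T -> Npow k x \in G k -> Npow k x = 0.
Proof.
move=> xT /memv_sumP[y yF Nx].
(* The relation becomes a vanishing sum of eigenvectors with distinct eigenvalues by appending
   [- Npow k x] as the last term. *)
pose v (i : 'I_k.+1) := if unlift ord_max i is Some j then y j else - Npow k x.
have vmax : v ord_max = - Npow k x by rewrite /v unlift_none.
have : v ord_max \in 0%VS.
  apply: (@eigen_split _ _ _ D (fun i : 'I_k.+1 => i%:R) 0%VS (index_enum 'I_k.+1)).
  - by move=> u; rewrite !memv0 => /eqP ->; rewrite linear0.
  - exact: index_enum_uniq.
  - by move=> a b _ _ /(natr_inj_char0 charK) /val_inj.
  - move=> i _; case: (unliftP ord_max i) => [j|] ->; last first.
      by rewrite vmax linearN /= DN // scalerN.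
    rewrite /v liftK; have /memv_imgP[u uF ->] := yF j isT.
    move: uF; rewrite memv_cap => /andP[uT _]; rewrite DN //=.
    by rewrite /bump leqNgt ltn_ord.
  - rewrite memv0 big_ord_recr /= vmax.
    rewrite Nx subr_eq0; apply/eqP; apply: eq_bigr => i _; rewrite /v.
    case: unliftP => [j /(congr1 val) /= |/(congr1 val) /= ].
      by rewrite /bump leqNgt ltn_ord /= => /val_inj ->.
    by move=> ik; have := ltn_ord i; rewrite -{2}ik ltnn.
  - by rewrite mem_index_enum.
by rewrite memv0 vmax oppr_eq0 => /eqP.
Qed.

Let dimFG k : (\dim (F k) <= \dim (G k))%N.
Proof.
elim: k => [|k IHk].
  suff -> : F 0 = 0%VS by rewrite dimv0.
  apply/vspaceP => x; rewrite memv_cap memv_ker /Npow /= id_lfunE memv0.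
  by case: eqP => [->|]; rewrite ?mem0v ?andbF.
rewrite /G big_ord_recr /= -/(G k) dimv_disjoint_sum; last first.
  apply/eqP; rewrite -subv0; apply/subvP => y; rewrite memv_cap memv0.
  case/andP=> yG /memv_imgP[x]; rewrite memv_cap => /andP[xT _] yx.
  by rewrite yx in yG *; apply/eqP; apply: G_free.
(* Rank-nullity for [Npow k] on [F k.+1]; the kernel part lies in [F k]. *)
rewrite -(limg_ker_dim (Npow k) (F k.+1)) leq_add2r (leq_trans _ IHk) // dimvS //.
by apply/subvP => x; rewrite !memv_cap => /andP[/andP[-> _] ->].
Qed.

(** If [Npow i.+1] kills [x], all products of degree [i.+1] kill [x], so every product of degree [i]
    applied to [x] is annihilated by both [E1] and [E2]. *)
Let subGY k : (G k <= Y)%VS.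
Proof.
apply/subv_sumP => i _; apply/subvP => _ /memv_imgP[x + ->].
rewrite memv_cap memv_ker => /andP[xT /eqP Nx].
have Q0 := Npow_eq0 xT Nx; rewrite NpowE; apply: memv_suml => j _.
by rewrite rpredMn // Y_top ?H1Q ?H2Q // ?E1Q ?E2Q Q0 // ?addSn ?addnS subnKC // -ltnS.
Qed.

(** Used with [T] the centralizer of [h] for the inequality with the rank, and again in the model
    with [T] the diagonal part of a space of matrices stable under the shifts. *)
Lemma dim_le_top_degree : (\dim T <= \dim Y)%N.
Proof.
have [m Qm] := nilQ.
suff -> : T = F m by apply: leq_trans (dimFG m) (dimvS (subGY m)).
apply/vspaceP => x; rewrite memv_cap; case xT: (x \in T) => //=.
by rewrite memv_ker Npow0 ?eqxx // => i j; apply: Qm.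
Qed.

End LowerBound.

(** * Engel's theorem for the adjoint action *)

Section AdjointAction.
Variables (K : fieldType) (n : nat).
Implicit Types (x y z : 'M[K]_n) (L M W : {vspace 'M[K]_n}).

Lemma adD x y z : ad (x + y) z = ad x z + ad y z.
Proof. by rewrite !adE mulmxDl mulmxDr opprD addrACA. Qed.

Lemma adN x z : ad (- x) z = - ad x z.
Proof. by rewrite !adE mulNmx mulmxN opprB addrC opprK. Qed.

Lemma adB x y z : ad (x - y) z = ad x z - ad y z.
Proof. by rewrite adD adN. Qed.

Lemma adZ a x z : ad (a *: x) z = a *: ad x z.
Proof. by rewrite !adE -scalemxAl -scalemxAr scalerBr. Qed.

Lemma ad_anti x y : ad x y = - ad y x.
Proof. by rewrite !adE opprB. Qed.

Lemma adxx x : ad x x = 0.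
Proof. by rewrite adE subrr. Qed.

Lemma ad_jacobi x y z : ad x (ad y z) = ad (ad x y) z + ad y (ad x z).
Proof.
rewrite !adE !(mulmxBl, mulmxBr) !mulmxA.
rewrite !opprB !addrA; apply/eqP; rewrite -subr_eq0; apply/eqP.
rewrite !opprD !opprK !addrA.
by apply/matrixP => i j; rewrite !mxE; ring.
Qed.

(** Left and right multiplication by [x] commute, so the binomial formula applies. The coefficients
    are signed binomials, but only the shape of the terms matters for nilpotency. *)
Lemma ad_iter_expand m x y : exists c : nat -> nat -> K,
  iter m (ad x) y = \sum_(i < m.+1) c m i *: (iter i (mulmx x) 1%:M *m y *m
    iter (m - i) (mulmx x) 1%:M).
Proof.
elim: m => [|m [c IHm]].
  by exists (fun _ _ => 1); rewrite big_ord1 /= scale1r mul1mx mulmx1.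
(* Pascal's rule with a sign: the new coefficient at [i] is the old one at [i - 1] minus the old one
   at [i]. *)
exists (fun k i => if k == m.+1 then
   (if i is i'.+1 then c m i' else 0) - (if (i <= m)%N then c m i else 0) else 0).
rewrite eqxx.
have xC i : iter i (mulmx x) 1%:M *m x = x *m iter i (mulmx x) 1%:M.
  by elim: i => [|i IHi] /=; rewrite ?mul1mx ?mulmx1 // -mulmxA IHi.
rewrite (eq_bigr (fun i : 'I_m.+2 => (if (i : nat) is i'.+1 then c m i' else 0) *:
  (iter i (mulmx x) 1%:M *m y *m iter (m.+1 - i) (mulmx x) 1%:M) -
  (if (i <= m)%N then c m i else 0) *:
  (iter i (mulmx x) 1%:M *m y *m iter (m.+1 - i) (mulmx x) 1%:M))); last first.
  by move=> i _; rewrite scalerBl.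
rewrite sumrB [X in X - _]big_ord_recl scale0r add0r.
rewrite [X in _ - X]big_ord_recr /= ltnn scale0r addr0.
rewrite IHm adE mulmx_sumr mulmx_suml; congr (_ - _); apply: eq_bigr => i _.
  by rewrite /bump /= !add1n -scalemxAr subSS !mulmxA.
rewrite -scalemxAl -ltnS ltn_ord (subSn (ltn_ord i : i <= m)%N) /=.
by rewrite -!mulmxA xC.
Qed.

(** In each term of the expansion of order [m + m], one of the two exponents of [x] is at least
    [m]. *)
Lemma ad_nilpotent x m :
  iter m (mulmx x) 1%:M = 0 -> forall y, iter (m + m) (ad x) y = 0.
Proof.
move=> x0 y; have x0' k : (m <= k)%N -> iter k (mulmx x) 1%:M = 0.
  by move=> /subnK <-; rewrite iterD x0; elim: (k - m)%N => //= j ->; rewrite mulmx0.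
have [c ->] := ad_iter_expand (m + m) x y; rewrite big1 // => i _.
case: (leqP m i) => le_mi; first by rewrite x0' // !mul0mx scaler0.
by rewrite [X in _ *m X]x0' ?mulmx0 ?scaler0 //; lia.
Qed.

Lemma skew_alg_ad J x y : x \in skew_alg J -> y \in skew_alg J -> ad x y \in skew_alg J.
Proof.
rewrite !mem_skew_alg !addr_eq0 adE linearB /= !trmx_mul mulmxBl mulmxBr.
have tr2 (u v : 'M[K]_n) : u^T *m J = - (J *m u) -> v^T *m J = - (J *m v) ->
    v^T *m u^T *m J = J *m (v *m u).
  by move=> uJ vJ; rewrite -mulmxA uJ mulmxN [_ *m (J *m _)]mulmxA vJ mulNmx opprK mulmxA.
by move=> /eqP xJ /eqP yJ; rewrite (tr2 x y) // (tr2 y x) // opprB.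
Qed.

Definition ad_stable L W := forall x w, x \in L -> w \in W -> ad x w \in W.

(* Engel's theorem for the adjoint action, relative to a pair of stable
   subspaces so that no quotient is needed. *)
Definition engel_property L := forall W1 W2 : {vspace 'M[K]_n},
  ad_stable L W1 -> ad_stable L W2 -> (W1 <= W2)%VS -> ~~ (W2 <= W1)%VS ->
  exists v, [/\ v \in W2, v \notin W1 & forall x, x \in L -> ad x v \in W1].

(** Start from a vector outside [W1] that [M] sends into [W1], and apply [ad x] until one step
    before the iterates fall into [W1]. Since [x] normalizes [M], the Jacobi identity keeps all
    iterates among the vectors sent into [W1] by [M]. *)
Lemma engel_step M x : ad_stable M M -> engel_property M ->
  (forall m, m \in M -> ad m x \in M) -> (exists k, forall y, iter k (ad x) y = 0) ->
  engel_property (M + <[x]>)%VS.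
Proof.
move=> MM EM Mx [k xk] W1 W2 st1 st2 W12 W21.
have MW W : ad_stable (M + <[x]>)%VS W -> ad_stable M W.
  by move=> st y w yM; apply: st; apply: subvP yM; apply: addvSl.
have xW W : ad_stable (M + <[x]>)%VS W -> forall w, w \in W -> ad x w \in W.
  by move=> st w; apply: st; apply: (subvP (addvSr M _)); apply: memv_line.
have [v [vW2 vW1 Mv]] := EM _ _ (MW _ st1) (MW _ st2) W12 W21.
pose good i := iter i (ad x) v \notin W1.
have exg : exists i, ~~ good i by exists k; rewrite /good xk mem0v.
case: (ex_minnP exg) => -[|i] bad_i min_i; first by rewrite /good /= vW1 in bad_i.
have W2i j : iter j (ad x) v \in W2 by elim: j => //= j; apply: xW.
have Mi j m : m \in M -> ad m (iter j (ad x) v) \in W1.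
  elim: j m => [|j IHj] m mM /=; first exact: Mv.
  rewrite ad_jacobi memvD //; first by apply: IHj; apply: Mx.
  by apply: (xW _ st1); apply: IHj.
exists (iter i (ad x) v); split=> // [|y].
  by apply/negP => bad; have := min_i i; rewrite /good bad ltnn => /(_ isT).
case/memv_addP => m mM [_ /vlineP[a ->] ->]; rewrite adD adZ.
apply: memvD; first exact: Mi.
by apply: memvZ; move: bad_i; rewrite /good negbK.
Qed.

(** A subalgebra [M] with the property is enlarged by one dimension at a time, starting from 0. The
    property itself, for the [M]-stable spaces [M] and [L], provides an element of [L] outside [M]
    that normalizes [M], and [engel_step] applies to it. *)
Lemma engel L : ad_stable L L ->
  (forall x, x \in L -> exists k, forall y, iter k (ad x) y = 0) ->
  engel_property L.
Proof.
move=> LL nilL; have : engel_property 0%VS.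
  move=> W1 W2 _ _ _ /subvPn[v v2 v1]; exists v; split=> // x.
  by rewrite memv0 => /eqP ->; rewrite adE mul0mx mulmx0 subrr mem0v.
have : ad_stable 0%VS 0%VS.
  by move=> x w _; rewrite !memv0 => /eqP ->; rewrite linear0.
have : (0 <= L)%VS by rewrite sub0v.
move: {2}(\dim L) (leq_subr (\dim (0%VS : {vspace 'M[K]_n})) (\dim L)) => k.
move: (0%VS : {vspace 'M[K]_n}) => M.
elim: k M => [|k IHk] M dM ML MM EM.
  suff -> : L = M by [].
  apply/eqP; rewrite eq_sym eqEdim ML /= -subn_eq0; by rewrite -leqn0.
have [LM|LM] := boolP (L <= M)%VS; first by have -> : L = M by apply: subv_anti; rewrite LM.
have [x [xL xM Mx]] := EM M L MM (fun y w yM => LL y w (subvP ML y yM)) ML LM.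
apply: (IHk (M + <[x]>)%VS).
- have lt : (\dim M < \dim (M + <[x]>))%N.
    rewrite ltn_neqAle dimvS ?addvSl // andbT; apply: contra xM => /eqP E.
    have /eqP -> : M == (M + <[x]>)%VS by rewrite eqEdim addvSl E leqnn.
    by apply: (subvP (addvSr M _)); apply: memv_line.
  have : (\dim (M + <[x]>) <= \dim L)%N.
    by apply: dimvS; rewrite subv_add ML -memvE.
  lia.
- by rewrite subv_add ML -memvE.
- move=> _ _ /memv_addP[m mM [_ /vlineP[a ->] ->]] /memv_addP[m' mM' [_ /vlineP[b ->] ->]].
  apply: (subvP (addvSl M _)).
  have -> : ad (m + a *: x) (m' + b *: x) = ad m m' + b *: ad m x - a *: ad m' x.
    rewrite adD adZ [ad m (_ + _)]linearD [ad x (_ + _)]linearD /=.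
    rewrite [ad m (_ *: _)]linearZ [ad x (_ *: _)]linearZ /= adxx scaler0 addr0.
    by rewrite [ad x m']ad_anti scalerN.
  by apply: memvB; [apply: memvD; [apply: MM|]|]; rewrite ?memvZ ?Mx.
- by apply: engel_step => //; apply: nilL.
Qed.

End AdjointAction.

Section Centralizer.
Variables (K : fieldType) (n : nat) (g : {vspace 'M[K]_n}).
Hypothesis gg : forall u y, u \in g -> y \in g -> ad u y \in g.

Lemma mem_centralizer f x :
  (x \in centralizer g f) = [&& x \in g, ad f.1 x == 0 & ad f.2 x == 0].
Proof. by rewrite !memv_cap !memv_ker -andbA. Qed.

Lemma ad0l (u : 'M[K]_n) : ad 0 u = 0.
Proof. by rewrite adE mul0mx mulmx0 subrr. Qed.

Lemma centralizer_ad_stable f : ad_stable (centralizer g f) (centralizer g f).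
Proof.
move=> x y; rewrite !mem_centralizer => /and3P[xg /eqP x1 /eqP x2] /and3P[yg /eqP y1 /eqP y2].
by rewrite gg //= !(ad_jacobi _ x y) x1 x2 y1 y2 !linear0 !ad0l addr0 eqxx.
Qed.

End Centralizer.

(** * Comparison of the weights of two semisimple pairs on a nilpotent algebra *)

Section WeightDecomposition.
Variables (K : fieldType) (charK : [pchar K] =i pred0) (n : nat).
Implicit Types (h : 'M[K]_n * 'M[K]_n) (Z S W : {vspace 'M[K]_n}).

Definition weight_vector h (w : rat * rat) x :=
  ad h.1 x = ratr w.1 *: x /\ ad h.2 x = ratr w.2 *: x.

Definition weight_sum Z h (P : pred (rat * rat)) x :=
  exists s (f : rat * rat -> 'M[K]_n), [/\ uniq s, {in s, forall w, P w},
    {in s, forall w, f w \in Z /\ weight_vector h w (f w)} & x = \sum_(w <- s) f w].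

Definition pair_stable h W := forall x, x \in W -> ad h.1 x \in W /\ ad h.2 x \in W.

Lemma weight_split h S s (f : rat * rat -> 'M[K]_n) : pair_stable h S -> uniq s ->
  {in s, forall w, weight_vector h w (f w)} -> \sum_(w <- s) f w \in S ->
  {in s, forall w, f w \in S}.
Proof.
move=> hS us fw; apply: (@joint_split _ _ _ (ad h.1) (ad h.2)
  (fun w => ratr w.1) (fun w => ratr w.2)) => //.
- by move=> x /hS[].
- by move=> x /hS[].
- move=> [p q] [p' q'] _ _ /= /(ratr_inj_char0 charK) -> .
  by move=> /(ratr_inj_char0 charK) ->.
Qed.

(** Each [h.i] multiplies each [e.j] by 0 or 1, so by the Jacobi identity it preserves the
    annihilator of [e.j]. *)
Lemma centralizer_pair_stable (g : {vspace 'M[K]_n}) e h :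
  (forall u y, u \in g -> y \in g -> ad u y \in g) -> h.1 \in g /\ h.2 \in g ->
  ad h.1 e.1 = e.1 /\ ad h.1 e.2 = 0 -> ad h.2 e.1 = 0 /\ ad h.2 e.2 = e.2 ->
  pair_stable h (centralizer g e).
Proof.
move=> gg [h1g h2g] [h11 h12] [h21 h22] y; rewrite !mem_centralizer.
case/and3P=> yg /eqP y1 /eqP y2.
have eh f k : ad k f = f \/ ad k f = 0 -> ad f y = 0 -> ad f (ad k y) == 0.
  move=> kf fy; rewrite ad_jacobi fy linear0 addr0 [ad f k]ad_anti.
  by case: kf => ->; rewrite ?oppr0 ?ad0l ?adN ?fy ?oppr0 eqxx.
by rewrite !gg //= !eh //; tauto.
Qed.

Variables (Z : {vspace 'M[K]_n}) (h h' : 'M[K]_n * 'M[K]_n).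
Hypotheses (ZZ : ad_stable Z Z) (EZ : engel_property Z).
Hypotheses (hZ : pair_stable h Z).
Hypotheses (u1 : h'.1 - h.1 \in Z) (u2 : h'.2 - h.2 \in Z).
Hypothesis (dec' : forall x, x \in Z -> weight_sum Z h' predT x).

Lemma pair_stable_sub W : ad_stable Z W -> pair_stable h W -> pair_stable h' W.
Proof.
move=> ZW hW x xW; have [x1 x2] := hW x xW.
rewrite -[h'.1](subrK h.1) -[h'.2](subrK h.2).
by rewrite [ad _ x]adD [X in _ /\ X \in _]adD; split; apply: memvD => //; apply: ZW.
Qed.

(** For an ideal [W] of [Z], this is the preimage in [Z] of the centre of [Z / W]. Testing on a
    basis of [Z] makes it a finite intersection of subspaces. *)
Let central W : {vspace 'M[K]_n} :=
  (Z :&: \bigcap_(i < \dim Z) (ad (vbasis Z)`_i @^-1: W))%VS.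

Let centralP W x : reflect (x \in Z /\ forall z, z \in Z -> ad z x \in W) (x \in central W).
Proof.
rewrite memv_cap; apply: (iffP andP) => -[xZ H]; split=> //.
  move=> z /coord_vbasis ->.
  rewrite (ad_anti _ x) linear_sum -sumrN memv_suml // => i _ /=.
  rewrite linearZ /= -scalerN -ad_anti memvZ //.
  by move: H => /subv_bigcapP /(_ i isT); rewrite -memvE -memv_preim.
by apply/subv_bigcapP => i _; rewrite -memvE -memv_preim H // vbasis_mem ?mem_nth ?size_tuple.
Qed.

(** If [x] is nonzero, take a largest ideal [W] of [Z], stable under [h], with [x] outside [W]. By
    Engel [central W] is strictly larger, so it contains [x], and with it all [h]-components of [x].
    On [central W] modulo [W] the pairs [h] and [h'] act alike, because they differ by elements of
    [Z]. Hence each component of weight [w] for [h] is congruent to a vector of weight [w] for [h'].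
    Comparing with the second expression of [x], whose weights are different, puts all its terms in
    [W], and so [x] itself. *)
Lemma weight_sums_disjoint (P Q : pred (rat * rat)) x : (forall w, P w -> ~~ Q w) ->
  weight_sum Z h P x -> weight_sum Z h' Q x -> x = 0.
Proof.
move=> PQ [s [f [us sP fw xf]]] [s' [g [us' sQ gw xg]]].
apply: contrapT => /eqP x0.
have xZ : x \in Z by rewrite xf big_seq memv_suml // => w /fw[].
pose good d := `[< exists W : {vspace 'M[K]_n}, [/\ (W <= Z)%VS, ad_stable Z W,
  pair_stable h W, x \notin W & \dim W = d] >].
have good0 : exists d, good d.
  exists 0%N; apply/asboolP; exists 0%VS; split; rewrite ?sub0v ?memv0 ?dimv0 //.
    by move=> y w _; rewrite !memv0 => /eqP ->; rewrite linear0.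
  by move=> w; rewrite !memv0 => /eqP ->; rewrite !linear0 eqxx.
have ub d : good d -> (d <= \dim Z)%N.
  by move=> /asboolP[W [WZ _ _ _ <-]]; apply: dimvS.
case: (ex_maxnP good0 ub) => d /asboolP[W [WZ ZW hW xW dW]] max_d.
have [|v [vZ vW Zv]] := EZ ZW ZZ WZ; first by apply: contra xW => /subvP /(_ _ xZ).
have WS : (W <= central W)%VS.
  apply/subvP => w wW; apply/centralP; split; first exact: (subvP WZ).
  by move=> z zZ; apply: ZW.
have ZS : ad_stable Z (central W).
  by move=> z y zZ /centralP[_ yW]; apply: (subvP WS); apply: yW.
have hS : pair_stable h (central W).
  move=> y /centralP[yZ yW]; have [y1 y2] := hZ yZ.
  split; apply/centralP; split=> // z zZ; have [z1 z2] := hZ zZ;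
    have [w1 w2] := hW _ (yW _ zZ); rewrite ad_jacobi memvD //.
    by rewrite [ad z _]ad_anti adN memvN yW.
  by rewrite [ad z _]ad_anti adN memvN yW.
have xS : x \in central W.
  apply/negPn/negP => xS.
  have lt : (\dim W < \dim (central W))%N.
    rewrite ltn_neqAle dimvS // andbT; apply: contra vW => /eqP E.
    have /eqP -> : W == central W by rewrite eqEdim WS E leqnn.
    exact/centralP.
  suff : good (\dim (central W)) by move=> /max_d; rewrite -dW leqNgt lt.
  by apply/asboolP; exists (central W); split=> //; rewrite /central capvSl.
have h'W := pair_stable_sub ZW hW; have h'S := pair_stable_sub ZS hS.
have fS : {in s, forall w, f w \in central W}.
  by apply: (weight_split hS us) => [w /fw[]//|]; rewrite -xf.
have approx w : w \in s -> exists k, [/\ f w - k \in W & weight_vector h' w k].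
  move=> sw; have [fZ [f1 f2]] := fw w sw.
  have [t [k [ut _ kw fk]]] := dec' fZ.
  (* The approximation is the [h']-component of weight [w] of [f w], or 0 when this weight does not
     occur. *)
  exists (if w \in t then k w else 0); split; last first.
    by case: ifP => [/kw[]//|_]; split; rewrite linear0 scaler0.
  (* The difference of the two semisimple elements lies in [Z], so it sends [f w] into [W].
     Expanding [f w] into [h']-weight vectors turns this into a sum that splits inside the
     [h']-stable space [W]. *)
  have E (i : 'M[K]_n * 'M[K]_n -> 'M[K]_n) (c : rat * rat -> rat) :
      i h' - i h \in Z -> ad (i h) (f w) = ratr (c w) *: f w ->
      {in t, forall w', ad (i h') (k w') = ratr (c w') *: k w'} ->
      {in t, forall w', (ratr (c w') - ratr (c w) : K) *: k w' \in W}.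
    move=> iZ iw ik; apply: (weight_split h'W ut).
      move=> w' /kw[_ [k1 k2]]; split; rewrite linearZ /= ?k1 ?k2 !scalerA mulrC //.
    have /centralP[_ /(_ _ iZ)] := fS w sw; rewrite adB iw {2}fk fk linear_sum /=.
    rewrite scaler_sumr -sumrB => H.
    rewrite (eq_big_seq (fun i0 => ad (i h') (k i0) - ratr (c w) *: k i0)) // => w' tw'.
    by rewrite /= ik // scalerBl.
  have off w' : w' \in t -> w' != w -> k w' \in W.
    move=> tw' ne; have [e1|n1] := eqVneq w'.1 w.1; last first.
      have := @E fst fst u1 f1 (fun y ty => (kw y ty).2.1) w' tw'.
      move=> /(memvZ (ratr w'.1 - ratr w.1)^-1); rewrite scalerA mulVf ?scale1r //.
      by rewrite subr_eq0 (inj_eq (ratr_inj_char0 charK)).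
    have [e2|n2] := eqVneq w'.2 w.2; last first.
      have := @E snd snd u2 f2 (fun y ty => (kw y ty).2.2) w' tw'.
      move=> /(memvZ (ratr w'.2 - ratr w.2)^-1); rewrite scalerA mulVf ?scale1r //.
      by rewrite subr_eq0 (inj_eq (ratr_inj_char0 charK)).
    by case/eqP: ne; rewrite [w']surjective_pairing e1 e2 -surjective_pairing.
  rewrite {1}fk; case: ifP => tw; last first.
    rewrite subr0 big_seq memv_suml // => w' tw'; apply: off => //.
    by apply: contraFneq tw => <-.
  rewrite (big_rem w) //= [X in X - _]addrC addrK big_seq memv_suml // => w' tw'.
  by apply: off; [apply: mem_rem tw' | move: tw'; rewrite mem_rem_uniq // inE => /andP[]].
have /all_sig[k kP] w : {k | w \in s -> f w - k \in W /\ weight_vector h' w k}.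
  apply: cid; have [/approx[k [? ?]]|] := boolP (w \in s); first by exists k.
  by exists 0.
(* The difference of the two expressions of [x] modulo [W], as a single family of [h']-weight
   vectors; the weights in [s] and [s'] are disjoint. *)
pose l w := if w \in s' then g w else - k w.
have disj w : w \in s -> w \notin s'.
  by move=> /sP /PQ; apply: contra => /sQ.
have lW : {in s' ++ s, forall w, l w \in W}.
  apply: (weight_split h'W).
  - rewrite cat_uniq us us' andbT /=; apply/hasPn => w /disj //.
  - move=> w; rewrite mem_cat /l; case: ifP => [/gw[]//|_ /= /kP[_ [k1 k2]]].
    by split; rewrite linearN /= ?k1 ?k2 scalerN.
  rewrite big_cat /= (eq_big_seq g); last by move=> w sw; rewrite /l sw.
  rewrite [X in _ + X](eq_big_seq (fun w => - k w)); last first.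
    by move=> w /disj sw; rewrite /l (negbTE sw).
  rewrite -xg xf -big_split /= big_seq memv_suml // => w sw.
  by case: (kP w sw).
case/negP: xW; rewrite xg big_seq memv_suml // => w sw.
by have := lW w; rewrite mem_cat sw /l sw; apply.
Qed.

End WeightDecomposition.

(** * Dimension bounds from coordinate functionals *)

Section DimensionCount.
Variables (K : fieldType) (V : vectType K) (I : finType).
Variables (f : I -> V -> K).
Hypothesis f_lin : forall i a x y, f i (a *: x + y) = a * f i x + f i y.

Lemma dim_le_functionals (A : {set I}) (U : {vspace V}) :
  (forall x, x \in U -> {in A, forall i, f i x = 0} -> x = 0) -> (\dim U <= #|A|)%N.
Proof.
move=> f_inj; pose F x : 'rV[K]_#|A| := \row_i f (enum_val i) x.
have linF : linear F by move=> a x y; apply/rowP => i; rewrite !mxE f_lin.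
pose Fl : {linear V -> 'rV[K]_#|A|} := HB.pack F (GRing.isLinear.Build _ _ _ _ F linF).
have <- : \dim (linfun Fl @: U) = \dim U.
  apply: limg_dim_eq; apply/vspaceP => x; rewrite memv_cap memv_ker lfunE /= memv0.
  apply/andP/eqP => [[xU /eqP F0]|->]; last first.
    by rewrite mem0v; split=> //; apply/eqP; apply: (linear0 Fl).
  apply: f_inj => // i iA; have := congr1 (fun r : 'rV__ => r 0 (enum_rank_in iA i)) F0.
  by rewrite !mxE enum_rankK_in.
by apply: leq_trans (dimvS (subvf _)) _; rewrite dimvf /dim /= mul1n.
Qed.

Lemma dim_ge_dual_family (A : {set I}) (U : {vspace V}) (v : I -> V) :
  {in A, forall i, v i \in U} ->
  {in A &, forall i j, (f i (v j) == 0) = (i != j)} -> (#|A| <= \dim U)%N.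
Proof.
move=> vU fv; pose X := [tuple v (enum_val (A := A) i) | i < #|A|].
have f0 i : f i 0 = 0.
  have := f_lin i 1 0 0; rewrite scale1r addr0 mul1r => /esym/eqP.
  by rewrite -subr_eq0 addrK => /eqP.
have fX : free X.
  apply/freeP => k; rewrite (eq_bigr (fun i => k i *: v (enum_val i))); last first.
    by move=> i _; rewrite -tnth_nth tnth_mktuple.
  move=> k0 i; have := congr1 (f (enum_val i)) k0; rewrite f0.
  have -> : f (enum_val i) (\sum_i k i *: v (enum_val i)) =
      \sum_j k j * f (enum_val i) (v (enum_val j)).
    elim/big_rec2: _ => [|j y z _ <-]; first exact: f0.
    exact: f_lin.
  rewrite (bigD1 i) //= big1 ?addr0 => [|j ji]; last first.
    apply/eqP; rewrite mulf_eq0 fv ?enum_valP // (inj_eq enum_val_inj) [i == j]eq_sym ji.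
    by rewrite orbT.
  by move/eqP; rewrite mulf_eq0 fv ?enum_valP // eqxx orbF => /eqP.
rewrite -[#|A|](size_tuple X); move: fX; rewrite /free => /eqP <-.
apply: dimvS; apply/span_subvP => _ /mapP[i _ ->].
by apply: vU; apply: enum_valP.
Qed.

End DimensionCount.

(** * Jordan decomposition *)

Section ChineseRemainder.
Variables (K : fieldType) (N : nat).

(** The Chinese remainder theorem for powers of distinct linear factors. Evaluated at a matrix whose
    minimal polynomial divides the product of these powers, such a polynomial gives the semisimple
    part. *)
Lemma poly_interpolation (rs : seq K) : uniq rs -> exists p : {poly K},
  {in rs, forall a, ('X - a%:P) ^+ N %| p - a%:P}.
Proof.
elim: rs => [|b rs IHrs] /=; first by exists 0.
case/andP=> brs /IHrs[p pP].
pose m : {poly K} := \prod_(a <- rs) ('X - a%:P) ^+ N.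
have cop : coprimep m (('X - b%:P) ^+ N).
  rewrite /m coprimep_sym big_seq; elim/big_ind: _ => [|x y cx cy|a ars].
  - exact: coprimep1.
  - by rewrite coprimepMr cx.
  - rewrite coprimep_expl // coprimep_expr // coprimep_XsubC root_XsubC.
    by apply: contraNneq brs => <-.
have [[u v] /= uv] := Bezout_eq1_coprimepP _ _ cop.
(* By the Bezout identity [u * m] is 0 modulo the old factors and 1 modulo the new one, so the
   correction changes the residue at [b] only. *)
exists (p + (b%:P - p) * (u * m)) => a; rewrite inE => /predU1P[->|ars].
  have -> : p + (b%:P - p) * (u * m) - b%:P = (p - b%:P) * (v * ('X - b%:P) ^+ N).
    by rewrite -[v * _](addKr (u * m)) uv; ring.
  by rewrite mulrA dvdp_mull.
have -> : p + (b%:P - p) * (u * m) - a%:P = (p - a%:P) + (b%:P - p) * (u * m) by ring.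
rewrite dvdp_add ?pP // mulrA dvdp_mull // /m (big_rem a) //=.
by rewrite dvdp_mulr.
Qed.

(** Antisymmetrize an interpolating [p]. As [- a] is also a node, substituting [- 'X] in the
    congruence at [- a] shows that [p] composed with [- 'X] is congruent to [- a] at [a], so half
    the difference still has residue [a]. *)
Lemma odd_poly_interpolation (rs : seq K) : 2%:R != 0 :> K -> uniq rs ->
  {in rs, forall a, - a \in rs} -> exists p : {poly K},
  p \Po (- 'X) = - p /\ {in rs, forall a, ('X - a%:P) ^+ N %| p - a%:P}.
Proof.
move=> K2 urs rsN; have [p pP] := poly_interpolation urs.
exists (2%:R^-1 *: (p - (p \Po (- 'X)))); split.
  rewrite comp_polyZ comp_polyB -comp_polyA -scalerN opprB; congr (_ *: (_ - _)).
  by rewrite -{2}[p]comp_polyXr; congr (_ \Po _);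
    rewrite -mulN1r -polyCN comp_polyM comp_polyC comp_polyX
     polyCN !mulN1r opprK.
move=> a ars; have /(dvdp_comp_poly (- 'X)) := pP _ (rsN a ars).
rewrite (rmorphXn (comp_poly (- 'X))) /= !comp_polyB comp_polyX !comp_polyC polyCN opprK.
have -> : - 'X + a%:P = - ('X - a%:P) :> {poly K} by rewrite opprB addrC.
rewrite exprNn -signr_odd -[X in _ * X]scale1r.
have -> : (-1) ^+ odd N = ((-1) ^+ odd N)%:P :> {poly K} by rewrite rmorphXn rmorphN1.
rewrite mul_polyC scalerA mulr1 dvdpZl ?signr_eq0 // => dN.
have -> : 2%:R^-1 *: (p - (p \Po (- 'X))) - a%:P =
   2%:R^-1 *: ((p - a%:P) - ((p \Po (- 'X)) + a%:P)).
  rewrite opprD addrACA -opprD [in RHS]scalerBr; congr (_ - _).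
  by rewrite -mulr2n -scaler_nat scalerA mulVf // scale1r.
by rewrite dvdpZr ?invr_eq0 // dvdp_sub // pP.
Qed.

End ChineseRemainder.

Section Jordan.
Variables (K : closedFieldType) (charK : [pchar K] =i pred0) (n' : nat).
Local Notation n := n'.+1.
Implicit Types (A B J x y s : 'M[K]_n).

(** The product of the distinct linear factors over [rs] annihilates [p] at [A], which is therefore
    diagonalizable. As [p] takes the value [a] at every [a] of [rs], the polynomial ['X - p] is
    divisible by [F], a power of which annihilates [A]. *)
Lemma jordan_odd_poly A : exists p : {poly K},
  [/\ p \Po (- 'X) = - p, diagonalizable (horner_mx A p) &
      exists k, (A - horner_mx A p) ^+ k = 0].
Proof.
have [r rP] := closed_field_poly_normal (char_poly A).
move: rP; rewrite (monicP (char_poly_monic A)) scale1r => chA.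
(* Opposites of the eigenvalues are added to make the set of nodes symmetric, as the odd
   interpolation requires. *)
pose rs := undup (r ++ map -%R r); pose F : {poly K} := \prod_(a <- rs) ('X - a%:P).
have rsN : {in rs, forall a, - a \in rs}.
  move=> a; rewrite !mem_undup !mem_cat => /orP[ar|/mapP[b br ->]].
    by rewrite map_f ?orbT.
  by rewrite opprK br.
have dF : char_poly A %| F ^+ (size r).
  rewrite chA; have : {subset r <= rs} by move=> a ar; rewrite mem_undup mem_cat ar.
  elim: (r) => [|a r' IHr] sub /=; first by rewrite big_nil dvd1p.
  rewrite big_cons exprS dvdp_mul ?IHr //; last by move=> b br; apply: sub; rewrite inE br orbT.
  by rewrite /F (big_rem a) ?sub ?mem_head //= dvdp_mulr.
(* The successor makes the exponent visibly positive, so that a factor ['X - a%:P] can be extracted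
   from its power at the end. *)
have FA : horner_mx A (F ^+ (size r).+1) = 0.
  apply/mxminpoly_minP; apply: dvdp_trans (mxminpoly_dvd_char A) _.
  by rewrite exprS dvdp_mull.
have K2 : 2%:R != 0 :> K by rewrite ((pcharf0P K).1 charK).
have [p [pN pP]] := odd_poly_interpolation (size r).+1 K2 (undup_uniq _) rsN.
exists p; split=> //.
  apply/diagonalizableP; exists rs; rewrite ?undup_uniq //.
  apply: mxminpoly_min; rewrite rmorph_prod /=.
  rewrite (eq_bigr (fun a => horner_mx A (p - a%:P))); last first.
    by move=> a _; rewrite !rmorphB /= horner_mx_X !horner_mx_C.
  rewrite -rmorph_prod; apply/mxminpoly_minP.
  apply: dvdp_trans (mxminpoly_min FA) _; rewrite /F -prodrXl big_seq [X in _ %| X]big_seq.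
  elim/big_rec2: _ => [|a y z ars dzy]; first exact: dvdpp.
  by rewrite dvdp_mul // pP.
exists (size r).+1; rewrite -[X in X - _]horner_mx_X -rmorphB -rmorphXn.
apply/mxminpoly_minP; apply: dvdp_trans (mxminpoly_min FA) _; apply: dvdp_exp2r.
rewrite /F; apply: uniq_roots_dvdp; last by rewrite uniq_rootsE undup_uniq.
apply/allP => a ars; have := pP a ars; rewrite exprS => /(dvdp_trans (dvdp_mulr _ (dvdpp _))).
rewrite dvdp_XsubCl /root !hornerE => /eqP; rewrite subr_eq0 => /eqP.
by move/eqP; rewrite -subr_eq0 => /eqP E; apply/eqP; apply/eqP; rewrite subr_eq0 eq_sym -subr_eq0 E.
Qed.

(** All eigenvalues vanish, so the characteristic polynomial is a power of ['X]; the trace is minus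
    its subleading coefficient. *)
Lemma nilpotent_trace0 A k : A ^+ k = 0 -> \tr A = 0.
Proof.
move=> Ak; have [r] := closed_field_poly_normal (char_poly A).
rewrite (monicP (char_poly_monic A)) scale1r => chA.
have r0 : {in r, forall a, a = 0}.
  move=> a ar; have : root (char_poly A) a by rewrite chA root_prod_XsubC.
  rewrite -eigenvalue_root_char => /eigenvalueP[v vA v0].
  have vAk j : v *m A ^+ j = a ^+ j *: v.
    elim: j => [|j IHj]; first by rewrite !expr0 mulmx1 scale1r.
    by rewrite exprSr mulmxA IHj -scalemxAl vA scalerA -exprSr.
  have := vAk k; rewrite Ak mulmx0 => /esym/eqP; rewrite scaler_eq0 (negbTE v0) orbF.
  by rewrite expf_eq0 => /andP[_ /eqP].
have : char_poly A = 'X^(size r).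
  rewrite chA big_seq (eq_bigr (fun => 'X)) => [|a /r0 ->]; last by rewrite subr0.
  by rewrite -big_seq big_const_seq count_predT iter_mulr_1.
move=> E; have := congr1 (fun p : {poly K} => p`_n.-1) E.
rewrite char_poly_trace // coefXn.
have := congr1 (fun p : {poly K} => size p) E; rewrite size_char_poly size_polyXn => -[<-].
by rewrite /= ltn_eqF // => /eqP; rewrite oppr_eq0 => /eqP.
Qed.

Lemma horner_mx_intertwine A B J (p : {poly K}) : A *m J = J *m B ->
  horner_mx A p *m J = J *m horner_mx B p.
Proof.
move=> AJ; elim/poly_ind: p => [|p c IHp]; first by rewrite !rmorph0 mul0mx mulmx0.
rewrite !rmorphD !rmorphM /= !horner_mx_X !horner_mx_C mulmxDl mulmxDr.
rewrite scalar_mxC; congr (_ + _).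
by rewrite -!mulmxE -mulmxA AJ mulmxA IHp mulmxA.
Qed.

Lemma horner_mx_tr A (p : {poly K}) : (horner_mx A p)^T = horner_mx A^T p.
Proof.
elim/poly_ind: p => [|p c IHp]; first by rewrite !rmorph0 trmx0.
rewrite !rmorphD !rmorphM /= !horner_mx_X !horner_mx_C linearD /= tr_scalar_mx.
congr (_ + _); rewrite -!mulmxE trmx_mul IHp.
by apply: comm_mx_horner.
Qed.

(** For a form, [x^T *m J = J *m (- x)] passes to polynomials, and oddness of [p] turns [p] at [- x]
    into minus [p] at [x]. For type A, the nilpotent part has trace 0. *)
Lemma classical_algebra_jordan t J x p : p \Po (- 'X) = - p ->
  (exists k, (x - horner_mx x p) ^+ k = 0) ->
  x \in classical_algebra t J -> horner_mx x p \in classical_algebra t J.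
Proof.
move=> pN [k xk]; have sk : x \in skew_alg J -> horner_mx x p \in skew_alg J.
  rewrite !mem_skew_alg !addr_eq0 => /eqP xJ; rewrite horner_mx_tr.
  rewrite (@horner_mx_intertwine _ (- x)) ?xJ ?mulmxN // -mulmxN.
  have -> : horner_mx (- x) p = horner_mx x (p \Po - 'X).
    elim/poly_ind: (p) => [|q c IHq]; first by rewrite comp_poly0 !rmorph0.
    rewrite comp_polyD comp_polyM comp_polyX comp_polyC !rmorphD !rmorphM /= IHq.
    by rewrite rmorphN /= !horner_mx_X !horner_mx_C.
  by rewrite pN rmorphN.
case: t => //=; rewrite !mem_sl_alg => /eqP x0.
have := nilpotent_trace0 xk; rewrite linearB /= x0 sub0r => /eqP.
by rewrite oppr_eq0.
Qed.

Lemma expmx_iter x k : iter k (mulmx x) 1%:M = x ^+ k.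
Proof. by elim: k => //= k ->; rewrite exprS. Qed.

(** In a basis diagonalizing [x] the eigenvalues of [ad x] are differences of diagonal entries, and
    the components of [y] are obtained by grouping its entries by these differences. *)
Lemma diagonal_weights x : diagonalizable x -> exists sq : seq K, uniq sq /\
  forall y, exists v : K -> 'M[K]_n, y = \sum_(a <- sq) v a /\
    forall a, ad x (v a) = a *: v a.
Proof.
case=> P Pu /(diagonalizable_forLR Pu)[d ->]; rewrite mxpoly.conjVmx //.
pose f (ij : 'I_n * 'I_n) := d 0 ij.1 - d 0 ij.2.
exists (undup (codom f)); split=> [|y]; first exact: undup_uniq.
pose Y := P *m y *m invmx P.
exists (fun a => invmx P *m (\matrix_(i, j) (Y i j *+ (f (i, j) == a))) *m P); split.
  rewrite -mulmx_suml -mulmx_sumr.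
  have -> : \sum_(a <- undup (codom f)) \matrix_(i, j) (Y i j *+ (f (i, j) == a)) = Y.
    apply/matrixP => i j; rewrite summxE.
    have ff : f (i, j) \in undup (codom f) by rewrite mem_undup codom_f.
    rewrite (big_rem _ ff) /= mxE eqxx big_seq big1 ?addr0 // => a.
    rewrite mem_rem_uniq ?undup_uniq // inE => /andP[ne _].
    by rewrite mxE eq_sym (negbTE ne).
  by rewrite /Y !mulmxA mulVmx // mul1mx mulmxKV.
move=> a; rewrite adE !mulmxA mulmxK // -!mulmxA (mulKVmx Pu) !mulmxA.
rewrite -mulmxBl -!mulmxA -mulmxBr !mulmxA scalemxAl scalemxAr; congr (_ *m _ *m _).
apply/matrixP => i j; rewrite mul_mx_diag mul_diag_mx !mxE /=.
by case: eqP => [<-|_]; rewrite /f /= ?mulr1n ?mulr0n; ring.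
Qed.

Lemma diagonalizable_semisimple_in (g : {vspace 'M[K]_n}) x : diagonalizable x ->
  x \in g -> (forall y, y \in g -> ad x y \in g) -> semisimple_in g x.
Proof.
move=> dx xg gx; split=> //; have [sq [usq sqP]] := diagonal_weights dx.
exists sq; apply/subvP => y yg; have [v [yv vP]] := sqP y.
rewrite yv big_seq; apply: memv_suml => a asq.
rewrite (big_rem a) //=; apply: (subvP (addvSl _ _)); rewrite memv_cap.
rewrite mem_leigenspace vP eqxx andbT.
by apply: (@eigen_split _ _ _ (ad x) id g sq v) => //; rewrite -yv.
Qed.

Lemma semisimple_decomposition (g : {vspace 'M[K]_n}) x y : semisimple_in g x -> y \in g ->
  exists (sq : seq K) (v : K -> 'M[K]_n), [/\ uniq sq, y = \sum_(a <- sq) v a &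
    {in sq, forall a, v a \in g /\ ad x (v a) = a *: v a}].
Proof.
case=> xg [sq sqP] yg; have {sqP} : y \in (\sum_(a <- sq) (g :&: leigenspace (ad x) a))%VS.
  exact: (subvP sqP).
have -> : (\sum_(a <- sq) (g :&: leigenspace (ad x) a) =
    \sum_(a <- undup sq) (g :&: leigenspace (ad x) a))%VS.
  elim: sq => //= a sq IH; rewrite big_cons IH; case: ifP => asq; rewrite ?big_cons //.
  by apply/addv_idPr; rewrite (big_rem a) ?mem_undup //= addvSl.
case/(memv_sum_uniq_seq (undup_uniq _)) => v [yv vP].
exists (undup sq), v; rewrite undup_uniq; split=> // a /vP.
by rewrite memv_cap mem_leigenspace => /andP[vg /eqP].
Qed.

(* The nilpotent part of [x] acts trivially on [g]. *)
Lemma ad_semisimple_part (g : {vspace 'M[K]_n}) x p :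
  (forall u y, u \in g -> y \in g -> ad u y \in g) -> horner_mx x p \in g ->
  semisimple_in g x -> diagonalizable (horner_mx x p) ->
  (exists k, (x - horner_mx x p) ^+ k = 0) ->
  forall y, y \in g -> ad x y = ad (horner_mx x p) y.
Proof.
move=> gg sg xss ds [k xk] y yg; have xg := xss.1.
set s := horner_mx x p in sg ds xk *.
have [sq [v [usq -> vP]]] := semisimple_decomposition xss yg.
rewrite !linear_sum; apply: eq_big_seq => a /vP[vg va] /=.
have [sq' [w' [usq' /(_ (v a))]]] : exists sq' (w : 'M[K]_n -> K -> 'M[K]_n), uniq sq' /\
    forall y, y = \sum_(a <- sq') w y a /\ forall a, ad s (w y a) = a *: w y a.
  have [sq' [usq' wP]] := diagonal_weights ds.
  have /choice[w {}wP] := wP.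
  by exists sq', w.
move: (w' (v a)) => w [vw wP].
have xs z : ad x (ad s z) = ad s (ad x z).
  rewrite ad_jacobi; have -> : ad x s = 0; last by rewrite adE mul0mx mulmx0 subrr add0r.
  rewrite adE; apply/eqP; rewrite subr_eq0; apply/eqP.
  exact: (comm_mx_horner p (erefl (x *m x))).
have wS : {in sq', forall b, w b \in (g :&: leigenspace (ad x) a)%VS}.
  apply: (@eigen_split _ _ _ (ad s) id) => //; last first.
    by rewrite -vw memv_cap vg mem_leigenspace va /=.
  move=> z; rewrite !memv_cap !mem_leigenspace => /andP[zg /eqP za].
  by rewrite gg //= xs za linearZ.
rewrite [in LHS]vw [in RHS]vw !linear_sum; apply: eq_big_seq => b /wS /=.
rewrite memv_cap mem_leigenspace => /andP[_ /eqP wa]; rewrite wa wP.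
have [->//|ab] := eqVneq a b.
suff -> : w b = 0 by rewrite !scaler0.
(* Each [ad s]-component of an [ad x]-eigenvector is an eigenvector of [ad (x - s)] for [a - b];
   nilpotency of [x - s] forces [a = b] or the component to vanish. *)
have it j : iter j (ad (x - s)) (w b) = (a - b) ^+ j *: w b.
  elim: j => [|j IHj] /=; first by rewrite scale1r.
  by rewrite IHj linearZ /= adB wa wP -scalerBl scalerA -exprSr.
have := ad_nilpotent (etrans (expmx_iter _ _) xk) (w b); rewrite it => /eqP.
by rewrite scaler_eq0 expf_eq0 subr_eq0 (negbTE ab) andbF => /eqP.
Qed.

Lemma classical_algebra_ad t J x y :
  x \in classical_algebra t J -> y \in classical_algebra t J ->
  ad x y \in classical_algebra t J.
Proof.
have sk := @skew_alg_ad _ _ J x y.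
case: t => //= _ _; rewrite mem_sl_alg adE linearB /= mxtrace_mulC subrr //.
Qed.

(** The semisimple part of [x] is a polynomial in [x], so it also commutes with [e]; it lies in the
    algebra, and the hypothesis on semisimple elements makes it zero. *)
Lemma centralizer_nilpotent t J e x :
  (forall y, y \in centralizer (classical_algebra t J) e ->
     semisimple_in (classical_algebra t J) y -> y = 0) ->
  x \in centralizer (classical_algebra t J) e -> exists k, x ^+ k = 0.
Proof.
move=> dist; rewrite !memv_cap !memv_ker => /andP[/andP[xg /eqP x1] /eqP x2].
have [p [pN ds xk]] := jordan_odd_poly x.
have sg := classical_algebra_jordan pN xk xg.
have [k] := xk; suff -> : horner_mx x p = 0 by rewrite subr0; exists k.
apply: dist.
  rewrite !memv_cap !memv_ker sg /=.
  have comm f : ad f x = 0 -> ad f (horner_mx x p) == 0.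
    rewrite adE => /eqP; rewrite subr_eq0 => /eqP fx.
    by rewrite adE subr_eq0; apply/eqP; apply: comm_mx_horner.
  by rewrite !comm.
apply: diagonalizable_semisimple_in => // y; exact: classical_algebra_ad.
Qed.

End Jordan.

(** * The rank and the centralizer of a semisimple pair *)

(** The sorted pair together with the bit telling whether [i] came first determines [i]; the bit
    accounts for the factor 2. *)
Lemma card_le_sorted_pairs n (S : {set 'I_n}) (g : 'I_n -> 'I_n)
    (A : {set 'I_n * 'I_n}) :
  {in S, forall i : 'I_n, (if (i <= g i)%N then (i, g i) else (g i, i)) \in A} ->
  (#|S| <= 2 * #|A|)%N.
Proof.
move=> SA; pose F (i : 'I_n) := (if (i <= g i)%N then (i, g i) else (g i, i), (i <= g i)%N).
have injF : injective F.
  by move=> i j; rewrite /F => -[+ E]; rewrite E; case: ifP => _ [] // _ ->.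
rewrite -(card_imset _ injF) mulnC -card_bool -cardsT -cardsX; apply: subset_leq_card.
by apply/subsetP => _ /imsetP[i iS ->]; rewrite inE /= SA ?inE.
Qed.

Section RankBound.
Variables (K : closedFieldType) (charK : [pchar K] =i pred0) (n' : nat).
Local Notation n := n'.+1.
Implicit Types (J x y s : 'M[K]_n) (h : 'M[K]_n * 'M[K]_n).

Lemma alternating_tr J : (forall v : 'cV[K]_n, v^T *m J *m v = 0) -> J^T = - J.
Proof.
move=> Jalt; have ent (i j : 'I_n) :
    (delta_mx i (0 : 'I_1))^T *m J *m delta_mx j (0 : 'I_1) = (J i j)%:M.
  rewrite trmx_delta -rowE -colE; apply/matrixP => a b.
  by rewrite !ord1 !mxE eqxx mulr1n.
apply/matrixP => i j; rewrite !mxE; apply/eqP; rewrite -addr_eq0; apply/eqP.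
have := Jalt (delta_mx i 0 + delta_mx j 0); rewrite [(_ + _)^T]linearD /= !mulmxDl !mulmxDr !ent.
have Jii k : J k k = 0.
  by have := Jalt (delta_mx k 0); rewrite ent => /matrixP/(_ 0 0); rewrite !mxE.
rewrite !Jii raddf0 addr0 add0r -raddfD => /matrixP/(_ 0 0).
by rewrite !mxE mulr1n addrC.
Qed.

Lemma admissible_form_sym t J : t <> TypeA -> admissible_form t J ->
  J^T = (if t is TypeC then -1 else 1) *: J /\ J \in unitmx.
Proof.
case: t => [[]|_|_|_] //= [JT Ju]; rewrite ?scale1r ?scaleN1r //.
by rewrite alternating_tr.
Qed.

(** A nonzero determinant has a nonzero term in its Leibniz expansion. The permutation will match
    each joint weight with the opposite one. *)
Lemma det_perm_support J : J \in unitmx -> exists s : 'S_n, forall i, J i (s i) != 0.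
Proof.
rewrite unitmxE unitfE => /eqP det0; apply: contrapT => H; apply: det0.
rewrite /determinant big1 // => s _.
have /forallPn[i] : ~~ [forall i, J i (s i) != 0].
  by apply/negP => /forallP sP; apply: H; exists s.
by rewrite negbK => /eqP Ji; rewrite (bigD1 i) //= Ji mul0r mulr0.
Qed.

Lemma diag_anticommute d J i j : diag_mx d *m J = - (J *m diag_mx d) -> J i j != 0 ->
  d 0 i + d 0 j = 0 :> K.
Proof.
rewrite mul_diag_mx mul_mx_diag => /matrixP/(_ i j); rewrite !mxE => E J0.
apply/eqP; rewrite -[_ == 0]orbF -(negbTE J0) -mulf_eq0 mulrDl E.
by rewrite [J i j * _]mulrC addNr.
Qed.

(** * Lower bounds for the centralizer of a simultaneously diagonalized pair *)

Section Codiagonal.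
Variables (P : 'M[K]_n) (Pu : P \in unitmx) (d1 d2 : 'rV[K]_n).
Let s1 := invmx P *m diag_mx d1 *m P.
Let s2 := invmx P *m diag_mx d2 *m P.

Let conj_comm d Y : diag_mx d *m Y = Y *m diag_mx d ->
  ad (invmx P *m diag_mx d *m P) (invmx P *m Y *m P) = 0.
Proof.
move=> dY; rewrite adE -!mulmxA !(mulKVmx Pu) !mulmxA -(mulmxA (invmx P) (diag_mx d)) dY.
by rewrite mulmxA subrr.
Qed.

Lemma diagonal_centralizer_sl : (n' <= \dim (centralizer (sl_alg K n) (s1, s2)))%N.
Proof.
pose f (i : 'I_n') x := (P *m x *m invmx P) (lift ord0 i) (lift ord0 i).
pose d (i : 'I_n') := delta_mx 0 (lift ord0 i) - delta_mx 0 ord0 : 'rV[K]_n.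
pose v i := invmx P *m diag_mx (d i) *m P.
rewrite -[n' in (n' <= _)%N]card_ord -cardsT.
apply: (@dim_ge_dual_family _ _ _ f _ _ _ v).
- by move=> i a x y; rewrite /f mulmxDr mulmxDl -scalemxAr -scalemxAl !mxE.
- move=> i _; rewrite mem_centralizer mem_sl_alg /=.
  rewrite !conj_comm ?eqxx ?andbT; try by rewrite diag_mxC.
  rewrite /v mxtrace_mulC mulmxA mulmxV // mul1mx mxtrace_diag.
  rewrite (eq_bigr (fun j => (j == lift ord0 i)%:R - (j == ord0)%:R)); last first.
    by move=> j _; rewrite !mxE !eqxx.
  rewrite sumrB (bigD1 (lift ord0 i)) //= big1 ?addr0 => [|j /negbTE -> //].
  by rewrite (bigD1 ord0) //= big1 ?addr0 ?eqxx ?subrr // => j /negbTE ->.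
- move=> i j _ _; rewrite /f /v !mulmxA mulmxV // mul1mx mulmxK // !mxE !eqxx /=.
  rewrite subr0 mulr1n (inj_eq lift_inj) [in RHS]eq_sym.
  by rewrite ((pcharf0P K).1 charK) eqb0 eq_sym.
Qed.

Variables (J : 'M[K]_n) (eta : K).
Hypotheses (JT : J^T = eta *: J) (eta2 : eta * eta = 1) (Ju : J \in unitmx).
Hypotheses (sJ1 : s1 \in skew_alg J) (sJ2 : s2 \in skew_alg J).

Let conjugate_form : exists J' : 'M[K]_n,
  [/\ J' \in unitmx, J'^T = eta *: J', J = P^T *m J' *m P &
      forall d, invmx P *m diag_mx d *m P \in skew_alg J ->
        diag_mx d *m J' = - (J' *m diag_mx d)].
Proof.
exists ((invmx P)^T *m J *m invmx P); split.
- by rewrite !unitmx_mul unitmx_tr unitmx_inv Pu Ju.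
- by rewrite !trmx_mul trmxK JT -!scalemxAl -scalemxAr mulmxA.
- by rewrite !mulmxA -trmx_mul mulVmx // trmx1 mul1mx mulmxKV.
move=> d; rewrite mem_skew_alg addr_eq0 => /eqP H.
have -> : diag_mx d *m ((invmx P)^T *m J *m invmx P) =
    (invmx P)^T *m ((invmx P *m diag_mx d *m P)^T *m J) *m invmx P.
  by rewrite !trmx_mul tr_diag_mx !mulmxA -trmx_mul mulmxV // trmx1 mul1mx.
by rewrite H mulmxN mulNmx !mulmxA mulmxK.
Qed.

(** The joint weights of the eigenvectors [i] and [j] are opposite. *)
Let rel (i j : 'I_n) := (d1 0 i + d1 0 j == 0) && (d2 0 i + d2 0 j == 0).

(** A matrix unit symmetrized so that [invmx J' *m S kl] is skew for the form [J']. With [k = l] it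
    vanishes for [eta = 1] and is twice a matrix unit for [eta = -1]. *)
Let S (kl : 'I_n * 'I_n) : 'M[K]_n := delta_mx kl.1 kl.2 - eta *: delta_mx kl.2 kl.1.

(** A pair of opposite joint weights gives an element of the centralizer, and the entries of [J']
    times the conjugated matrix are dual functionals for ordered pairs. Pairs on the diagonal are
    excluded unless [eta = -1], since they would give 0. *)
Lemma dim_skew_diagonal_centralizer (A : {set 'I_n * 'I_n}) :
  {in A, forall p : 'I_n * 'I_n, (p.1 <= p.2)%N && rel p.1 p.2} ->
  (eta != -1 -> {in A, forall p : 'I_n * 'I_n, p.1 != p.2}) ->
  (#|A| <= \dim (centralizer (skew_alg J) (s1, s2)))%N.
Proof.
move=> AP Ane; have [J' [J'u J'T JE anti]] := conjugate_form.
pose f (ij : 'I_n * 'I_n) x := (J' *m (P *m x *m invmx P)) ij.1 ij.2.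
pose v kl := invmx P *m (invmx J' *m S kl) *m P.
have comm d kl : diag_mx d *m J' = - (J' *m diag_mx d) -> d 0 kl.1 + d 0 kl.2 = 0 ->
    ad (invmx P *m diag_mx d *m P) (v kl) = 0.
  move=> dJ dkl; apply: conj_comm.
  have Jd : diag_mx d *m invmx J' = - (invmx J' *m diag_mx d).
    apply: (can_inj (mulKmx J'u)); apply: (can_inj (mulmxK J'u)).
    by rewrite /= mulmxA mulmxKV // mulmxN mulmxA mulmxV // mul1mx mulNmx dJ opprK.
  rewrite mulmxA Jd mulNmx -!mulmxA -mulmxN; congr (_ *m _).
  apply/matrixP => i j; rewrite mul_diag_mx mul_mx_diag mxE [in LHS]mxE [in RHS]mxE.
  have S0 : (d 0 i + d 0 j) * S kl i j = 0.
    rewrite !mxE mulrBr [X in _ - X]mulrCA.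
    have [/andP[/eqP -> /eqP ->]|_] := boolP ((i == kl.1) && (j == kl.2)).
      by rewrite dkl !mul0r mulr0 subr0.
    have [/andP[/eqP -> /eqP ->]|_] := boolP ((i == kl.2) && (j == kl.1)).
      by rewrite [d 0 kl.2 + _]addrC dkl !mul0r !mulr0 subr0.
    by rewrite !mulr0 subr0.
  by apply/eqP; rewrite eq_sym -addr_eq0 -[X in _ == X]S0 !mxE; apply/eqP; ring.
apply: (@dim_ge_dual_family _ _ _ f _ _ _ v).
- by move=> ij a x y; rewrite /f mulmxDr mulmxDl mulmxDr -!(scalemxAr, scalemxAl) !mxE.
- move=> kl /AP /andP[_ /andP[/eqP r1 /eqP r2]].
  rewrite mem_centralizer mem_skew_alg /= !comm ?eqxx ?andbT //; try exact: anti.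

  have VJ : (invmx J')^T *m J' = eta *: 1%:M.
    apply: (can_inj (mulKmx (_ : J'^T \in unitmx))); rewrite ?unitmx_tr // mulmxA.
    rewrite -trmx_mul mulVmx // trmx1 mul1mx -scalemxAr mulmx1 J'T scalerA.
    by rewrite eta2 scale1r.
  have -> : (v kl)^T *m J = P^T *m ((S kl)^T *m ((invmx J')^T *m J')) *m P.
    rewrite /v !trmx_mul {1}JE !mulmxA -(mulmxA _ (invmx P)^T P^T) -(trmx_mul P) mulmxV //.
    by rewrite trmx1 mulmx1.
  have -> : J *m v kl = P^T *m (S kl) *m P.
    by rewrite /v {1}JE !mulmxA (mulmxK Pu) (mulmxK J'u).
  rewrite VJ -mulmxDl -mulmxDr -scalemxAr mulmx1.
  suff -> : eta *: (S kl)^T + S kl = 0 by rewrite mulmx0 mul0mx.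
  rewrite /S linearB /= linearZ /= !trmx_delta scalerBr scalerA eta2 scale1r.
  by rewrite addrA subrK subrr.
- move=> [i j] [k l] ijA klA; rewrite /f /v /=.
  rewrite !mulmxA (mulmxK Pu) -!mulmxA (mulKVmx Pu) (mulKVmx J'u) !mxE /=.
  have /andP[/= ij rij] := AP _ ijA; have /andP[/= kl rkl] := AP _ klA.
  rewrite -pair_eqE /pair_eq /=.
  have [/andP[/eqP -> /eqP ->]|n1] := boolP ((i == k) && (j == l)).
    have [ekl|nkl] := eqVneq k l; last by rewrite ?(negbTE nkl) ?eqxx /= mulr0 subr0 oner_eq0.
    have -> : eta = -1 by apply/eqP; apply: contraT => /Ane/(_ _ klA); rewrite /= ekl eqxx.
    by rewrite ?ekl ?eqxx mulr1 opprK -[1 + 1]/(2%:R) ((pcharf0P K).1 charK).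
  case: andP => [[/eqP il /eqP jk]|_]; last by rewrite mulr0 subr0 eqxx.
  have e_kl : k = l by apply/val_inj/eqP; rewrite eqn_leq kl -il -jk.
  by rewrite il jk e_kl !eqxx in n1.
Qed.

Let pi_ex : exists s : 'S_n, forall i, rel i (s i).
Proof.
have [J' [J'u _ _ anti]] := conjugate_form; have [s sP] := det_perm_support J'u.
exists s => i; have := sP i => J0.
by rewrite /rel (diag_anticommute (anti _ sJ1) J0) (diag_anticommute (anti _ sJ2) J0) !eqxx.
Qed.

Let rel_sym i j : rel i j = rel j i.
Proof. by rewrite /rel addrC [X in _ && (X == _)]addrC. Qed.

Lemma dim_sp_diagonal_centralizer : eta = -1 ->
  (n <= 2 * \dim (centralizer (skew_alg J) (s1, s2)))%N.
Proof.
move=> etaE; have [s sP] := pi_ex.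
pose A := [set p : 'I_n * 'I_n | (p.1 <= p.2)%N && rel p.1 p.2].
have le : (#|A| <= \dim (centralizer (skew_alg J) (s1, s2)))%N.
  by apply: dim_skew_diagonal_centralizer => [p|]; rewrite ?inE // etaE eqxx.
apply: leq_trans (leq_mul (leqnn 2) le); rewrite -[X in (X <= _)%N]card_ord -cardsT.
apply: (@card_le_sorted_pairs _ _ s) => i _; rewrite inE.
by case: ifP => [i_le|/negbT]; rewrite ?i_le ?sP // -ltnNge => lt; rewrite /= rel_sym sP (ltnW lt).
Qed.

(** An index with no opposite partner besides itself has joint weight 0. Two such indices would be
    partners of each other, so at most one index is lost, whence [n'] instead of [n]. *)
Lemma dim_so_diagonal_centralizer : eta = 1 ->
  (n' <= 2 * \dim (centralizer (skew_alg J) (s1, s2)))%N.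
Proof.
move=> etaE; have [s sP] := pi_ex.
pose A := [set p : 'I_n * 'I_n | [&& (p.1 <= p.2)%N, rel p.1 p.2 & p.1 != p.2]].
have le : (#|A| <= \dim (centralizer (skew_alg J) (s1, s2)))%N.
  by apply: dim_skew_diagonal_centralizer => [p|_ p]; rewrite inE => /and3P[p_le p_rel] //;
    rewrite p_le p_rel.
apply: leq_trans (leq_mul (leqnn 2) le).
pose S0 := [set i | [exists j, rel i j && (i != j)]].
have /choice[g gP] : forall i, exists j, i \in S0 -> rel i j && (i != j).
  move=> i; have [|] := boolP (i \in S0); last by exists i.
  by rewrite inE => /existsP[j jP]; exists j.
apply: leq_trans (card_le_sorted_pairs (S := S0) (g := g) _); last first.
  move=> i /gP /andP[ri ne]; rewrite inE.
  by case: ifP => [i_le|/negbT]; rewrite /= ?i_le ?ri ?ne // -ltnNge => lt;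
    rewrite /= rel_sym ri eq_sym ne (ltnW lt).
have : (#|~: S0| <= 1)%N.
  apply/card_le1_eqP => i j; rewrite !inE => /existsPn iP /existsPn jP.
  have fixed k : (forall l, ~~ (rel k l && (k != l))) -> rel k k.
    by move=> /(_ (s k)); rewrite sP /= negbK => /eqP {2}->.
  have := iP j; rewrite negb_and => /orP[|/negbNE/eqP //].
  have half (a : K) : a + a = 0 -> a = 0.
    move/eqP; rewrite -mulr2n -mulr_natr mulf_eq0 ((pcharf0P K).1 charK) orbF.
    by move/eqP.
  have /andP[/eqP/half i1 /eqP/half i2] := fixed i iP.
  have /andP[/eqP/half j1 /eqP/half j2] := fixed j jP.
  by rewrite /rel i1 i2 j1 j2 addr0 eqxx.
move=> le1; have := leq_add (leqnn #|S0|) le1.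
by rewrite cardsC card_ord addn1 ltnS.
Qed.

End Codiagonal.

(** Semisimplicity is assumed for the adjoint action only, so [h] is first replaced by the
    semisimple parts [s1] and [s2]. They act on [g] as [h] does, commute because they are
    polynomials in [h.1] and [h.2], and can be diagonalized together. *)
Lemma rank_le_centralizer t r J h : n = natdim t r -> admissible_form t J ->
  (semisimple_in (classical_algebra t J) h.1) ->
  (semisimple_in (classical_algebra t J) h.2) -> ad h.1 h.2 = 0 ->
  (r <= \dim (centralizer (classical_algebra t J) h))%N.
Proof.
set g := classical_algebra t J => nE JP ss1 ss2 h12.
have [p1 [p1N ds1 x1]] := jordan_odd_poly charK h.1.
have [p2 [p2N ds2 x2]] := jordan_odd_poly charK h.2.
set s1 := horner_mx h.1 p1 in ds1 x1; set s2 := horner_mx h.2 p2 in ds2 x2.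
have s1g : s1 \in g := classical_algebra_jordan p1N x1 ss1.1.
have s2g : s2 \in g := classical_algebra_jordan p2N x2 ss2.1.
have gg : forall u y, u \in g -> y \in g -> ad u y \in g.
  by move=> u y; apply: classical_algebra_ad.
have -> : centralizer g h = centralizer g (s1, s2).
  apply/vspaceP => x; rewrite !mem_centralizer /=.
  case xg: (x \in g) => //=.
  by rewrite (ad_semisimple_part gg s1g) // (ad_semisimple_part gg s2g).
have /codiagonalizableP[P Pu /= /and3P[sP1 sP2 _]] :
    {in [:: s1; s2] &, forall A B, comm_mx A B} /\ {in [:: s1; s2], forall A, diagonalizable A}.
  have c12 : comm_mx s1 s2.
    apply: comm_mx_horner; apply: comm_horner_mx; apply/eqP.
    by rewrite -subr_eq0 -adE h12.
  split=> [A B|A]; rewrite !inE => /orP[] /eqP -> //.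
    by case/orP=> /eqP ->.
  by case/orP=> /eqP -> //; apply/esym.
move: sP1 sP2 => /(diagonalizable_forLR Pu)[d1 s1E] /(diagonalizable_forLR Pu)[d2 s2E].
rewrite mxpoly.conjVmx // in s1E; rewrite mxpoly.conjVmx // in s2E.
rewrite s1E s2E in s1g s2g *.
have [tA|tA] := pselect (t = TypeA).
  rewrite /g tA /= in nE *; case: nE => <-; exact: diagonal_centralizer_sl.
have [JT Ju] := admissible_form_sym tA JP.
have gE : g = skew_alg J by rewrite /g; case: (t) tA.
rewrite gE in s1g s2g *.
case: t {g gg ss1 ss2 gE} nE JP tA JT => //= nE JP tA JT.
- have /= := dim_so_diagonal_centralizer Pu JT (mulr1 _) Ju s1g s2g erefl.
  by move: (\dim _) => D; move: nE => /=; lia.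
- have /= := dim_sp_diagonal_centralizer Pu JT (etrans (mulrNN 1 1) (mulr1 1)) Ju
    s1g s2g erefl.
  by move: (\dim _) => D; move: nE => /=; lia.
- have /= := dim_so_diagonal_centralizer Pu JT (mulr1 _) Ju s1g s2g erefl.
  by move: (\dim _) => D; move: nE => /=; lia.
Qed.

End RankBound.

(** * Independence of the associated semisimple pair *)

(** A finite subfamily whose sum has maximal dimension already absorbs every other member. *)
Lemma vsum_finite (F : fieldType) (V : vectType F) (I : eqType) (P : pred I)
    (W : I -> {vspace V}) :
  exists s : seq I, [/\ uniq s, {in s, forall i, P i} & vsum P W = (\sum_(i <- s) W i)%VS].
Proof.
pose good d := `[< exists s : seq I, [/\ uniq s, {in s, forall i, P i} &
  \dim (\sum_(i <- s) W i)%VS = d] >].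
have good0 : exists d, good d.
  by exists 0%N; apply/asboolP; exists [::]; split=> //; rewrite big_nil dimv0.
have ub d : good d -> (d <= \dim {:V})%N.
  by move=> /asboolP[s [_ _ <-]]; apply: dimvS; apply: subvf.
case: (ex_maxnP good0 ub) => d /asboolP[s [us sP ds]] max_d; exists s; split=> //.
apply/eqP; rewrite eqEsubv; apply/andP; split; last first.
  rewrite big_seq; elim/big_ind: _ => [|U1 U2 ? ?|i /sP]; first exact: sub0v.
    by rewrite subv_add; apply/andP.
  exact: vsum_sup.
apply: vsum_min => i Pi; have [is_|is_] := boolP (i \in s).
  by rewrite (big_rem i) //= addvSl.
have /max_d : good (\dim (\sum_(j <- i :: s) W j)%VS).
  apply/asboolP; exists (i :: s); rewrite /= is_ us; split=> // j.
  by rewrite inE => /predU1P[->|/sP].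
rewrite -ds big_cons => le; have /eqP -> : (\sum_(j <- s) W j == W i + \sum_(j <- s) W j)%VS.
  by rewrite eqEdim addvSr.
exact: addvSl.
Qed.

(** A vector of [Z] is split for [h.1] and each piece again for [h.2]; stability keeps the pieces in
    [Z], and rationality names the weights of the nonzero ones. *)
Lemma stable_subspace_weights (K : closedFieldType) n' (g Z T : {vspace 'M[K]_n'.+1})
    (h : 'M[K]_n'.+1 * 'M[K]_n'.+1) :
  semisimple_in g h.1 -> semisimple_in g h.2 ->
  rational_eigenvalues g h.1 -> rational_eigenvalues g h.2 -> ad h.1 h.2 = 0 ->
  (Z <= g)%VS -> pair_stable h Z ->
  (forall p q x, x \in Z -> weight_vector h (p, q) x -> x \in T) -> (Z <= T)%VS.
Proof.
move=> ss1 ss2 rat1 rat2 h12 Zg hZ ZT; apply/subvP => x xZ.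
have [s1 [v1 [us1 xv1 v1P]]] := semisimple_decomposition ss1 (subvP Zg x xZ).
have v1Z : {in s1, forall a, v1 a \in Z}.
  apply: (@eigen_split _ _ _ (ad h.1) id Z s1 v1) => //; last by rewrite -xv1.
    by move=> y /hZ[].
  by move=> a /v1P[].
rewrite xv1 big_seq; apply: memv_suml => a sa.
have [s2 [v2 [us2 xv2 v2P]]] := semisimple_decomposition ss2 (v1P a sa).1.
have mem_eig y : (y \in (Z :&: leigenspace (ad h.1) a)%VS) = (y \in Z) && (ad h.1 y == a *: y).
  by rewrite memv_cap mem_leigenspace.
have v2Z : {in s2, forall b, v2 b \in (Z :&: leigenspace (ad h.1) a)%VS}.
  apply: (@eigen_split _ _ _ (ad h.2) id (Z :&: leigenspace (ad h.1) a)%VS s2 v2) => //.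
  - move=> y; rewrite !mem_eig => /andP[yZ /eqP ya].
    rewrite (hZ y yZ).2 /= ad_jacobi ya linearZ [ad h.1 h.2]h12 /=.
    by rewrite [ad 0 y]adE mul0mx mulmx0 subrr add0r.
  - by move=> b /v2P[].
  - by rewrite -xv2 mem_eig v1Z // (v1P a sa).2 eqxx.
rewrite xv2 big_seq; apply: memv_suml => b sb.
have := v2Z b sb; rewrite mem_eig => /andP[bZ /eqP b1].
have [bg b2] := v2P b sb.
have [->|nz] := eqVneq (v2 b) 0; first exact: mem0v.
have [p pE] := rat1 _ _ bg nz b1; have [q qE] := rat2 _ _ bg nz b2.
by apply: (ZT p q) => //; split; rewrite /= -?pE -?qE.
Qed.

Section NilpotentPair.
Variables (K : closedFieldType) (charK : [pchar K] =i pred0) (n' : nat).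
Local Notation n := n'.+1.
Variables (t : classical_type) (J : 'M[K]_n).
Implicit Types (x y : 'M[K]_n).
Let g := classical_algebra t J.
Variables (e h : 'M[K]_n * 'M[K]_n).
Hypothesis eP : distinguished_pair g e h.

Let gg : forall u y, u \in g -> y \in g -> ad u y \in g.
Proof. by move=> u y; apply: classical_algebra_ad. Qed.

Let mem_graded p q x : (x \in graded_centralizer g e h p q) =
  [&& x \in centralizer g e, ad h.1 x == ratr p *: x & ad h.2 x == ratr q *: x].
Proof.
rewrite -(mem_leigenspace (ad h.1) (ratr p) x) -(mem_leigenspace (ad h.2) (ratr q) x).
by rewrite andbA -(memv_cap x (centralizer g e)) -memv_cap.
Qed.

Let ad_shift (a b x : 'M[K]_n) : ad a b = b -> ad a (ad b x) = ad b (ad a x) + ad b x.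
Proof. by move=> ab; rewrite ad_jacobi ab addrC. Qed.

Let ad_commute (a b x : 'M[K]_n) : ad a b = 0 -> ad a (ad b x) = ad b (ad a x).
Proof. by move=> ab; rewrite ad_jacobi ab [ad 0 x]adE mul0mx mulmx0 subrr add0r. Qed.

Lemma rank_le_dim_positive_centralizer r : n = natdim t r -> admissible_form t J ->
  (r <= \dim (positive_centralizer g e h))%N.
Proof.
move=> nE JP; case: eP => -[ne1 ne2 e12 [[ss1 ss2] _ h12 [h1e1 h1e2] [h2e1 h2e2]]] _ _.
apply: leq_trans (rank_le_centralizer charK nE JP ss1 ss2 h12) _.
have iter_g f i x : f \in g -> x \in g -> iter i (ad f) x \in g.
  by move=> fg xg; elim: i => //= i; apply: gg.
have Tg x : x \in centralizer g h -> x \in g by rewrite mem_centralizer => /and3P[].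
have e1g : e.1 \in g := ne1.1; have e2g : e.2 \in g := ne2.1.
apply: (@dim_le_top_degree _ charK _ (ad e.1) (ad e.2) (ad h.1) (ad h.2)).
- by move=> x; apply: ad_commute.
- by move=> x; apply: ad_shift.
- by move=> x; apply: ad_commute.
- by move=> x; apply: ad_commute.
- by move=> x; apply: ad_shift.
- by move=> x; rewrite mem_centralizer => /and3P[_ /eqP].
- by move=> x; rewrite mem_centralizer => /and3P[_ _ /eqP].
- case: ne1 ne2 => _ [k1 N1] [_ [k2 N2]].
  exists (k1 + k2)%N => x i j /Tg xg ij.
  have [le1|lt1] := leqP k1 i.
    rewrite -(subnK le1) addnC iterD N1 ?iter_g //.
  have le2 : (k2 <= j)%N by lia.
  rewrite -(subnK le2) addnC (iterD k2) N2 ?iter_g //.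
  by elim: (i) => //= k ->; rewrite linear0.
move=> x i j /Tg xg E1 E2 H1 H2.
apply: (subvP (vsum_sup (i := (i%:R, j%:R)) _ _)); first by rewrite /= !ler0n.
rewrite mem_graded /= !ratr_nat H1 H2 !eqxx mem_centralizer !iter_g //.
by rewrite E1 E2 !eqxx.
Qed.

Let Z := centralizer g e.

Let ZZ : ad_stable Z Z.
Proof. exact: centralizer_ad_stable. Qed.

Let hZ : pair_stable h Z.
Proof.
case: eP => -[_ _ _ [[ss1 ss2] _ _ h1e h2e]] _ _.
by apply: centralizer_pair_stable; [|split; [apply: ss1.1|apply: ss2.1]| |].
Qed.

Let graded w := graded_centralizer g e h w.1 w.2.

Let graded_weight w x : x \in graded w -> x \in Z /\ weight_vector h w x.
Proof. by rewrite /graded mem_graded => /and3P[-> /eqP ? /eqP]. Qed.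

Let vsum_weight (P : pred (rat * rat)) x : x \in vsum P graded -> weight_sum Z h P x.
Proof.
have [s [us sP ->]] := vsum_finite P graded.
case/(memv_sum_uniq_seq us) => f [-> fW]; exists s, f; split=> // w sw.
exact/graded_weight/fW.
Qed.

Let Z_weights : (Z <= vsum predT graded)%VS.
Proof.
case: eP => -[_ _ _ [[ss1 ss2] [rat1 rat2] h12 _ _]] _ _.
have Zg : (Z <= g)%VS by apply/subvP => y; rewrite mem_centralizer => /and3P[].
apply: (stable_subspace_weights ss1 ss2 rat1 rat2 h12 Zg hZ) => p q x xZ [x1 x2].
apply: (subvP (vsum_sup (i := (p, q)) _ _)) => //.
by rewrite /graded mem_graded xZ x1 x2 !eqxx.
Qed.

Let nonneg : pred (rat * rat) := [pred w : rat * rat | (0 <= w.1) && (0 <= w.2)].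

(* Two semisimple pairs associated to [e] differ by elements of [Z], which acts
   nilpotently on itself, so that they have the same weights on [Z]. *)
Lemma dim_positive_centralizer_indep h' (Wp Wm : {vspace 'M[K]_n}) :
  h'.1 \in g /\ h'.2 \in g ->
  ad h'.1 e.1 = e.1 /\ ad h'.1 e.2 = 0 -> ad h'.2 e.1 = 0 /\ ad h'.2 e.2 = e.2 ->
  (forall x, x \in Z -> weight_sum Z h' predT x) ->
  (forall x, x \in Wp -> weight_sum Z h' nonneg x) ->
  (forall x, x \in Wm -> weight_sum Z h' (predC nonneg) x) ->
  (Z <= Wp + Wm)%VS -> \dim (positive_centralizer g e h) = \dim Wp.
Proof.
case: eP => -[ne1 ne2 e12 [[ss1 ss2] _ h12 [h1e1 h1e2] [h2e1 h2e2]]] dist _.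
move=> [h1g h2g] [h1e1' h1e2'] [h2e1' h2e2'] dec' WpP WmP ZW.
(* Elements with the same brackets with [e.1] and [e.2] differ by an element commuting with [e]. *)
have uZ k k' : k \in g -> k' \in g -> ad k e.1 = ad k' e.1 -> ad k e.2 = ad k' e.2 ->
    k - k' \in Z.
  move=> kg kg' k1 k2; rewrite mem_centralizer memvB //= !(ad_anti _ (k - k')) !adB.
  by rewrite k1 k2 !subrr oppr0 eqxx.
have u1 : h'.1 - h.1 \in Z by rewrite uZ ?ss1.1 ?h1e1' ?h1e2'.
have u2 : h'.2 - h.2 \in Z by rewrite uZ ?ss2.1 ?h2e1' ?h2e2'.
have EZ : engel_property Z.
  apply: engel => // x xZ; have [k xk] := centralizer_nilpotent charK dist xZ.
  by exists (k + k)%N; apply: ad_nilpotent; rewrite expmx_iter.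
have disj (P Q : pred (rat * rat)) x : (forall w, P w -> ~~ Q w) -> weight_sum Z h P x ->
    weight_sum Z h' Q x -> x = 0.
  by move=> PQ; apply: (weight_sums_disjoint charK ZZ EZ hZ u1 u2 dec' PQ).
pose Zm := vsum (predC nonneg) graded.
have dim_sum (A B : {vspace 'M[K]_n}) : (forall x, x \in A -> x \in B -> x = 0) ->
    (A <= Z)%VS -> (B <= Z)%VS -> (\dim A + \dim B <= \dim Z)%N.
  move=> AB AZ BZ; rewrite -dimv_disjoint_sum; first by rewrite dimvS // subv_add AZ.
  by apply/vspaceP => x; rewrite memv_cap memv0; apply/andP/eqP => [[]|->];
    [apply: AB | rewrite !mem0v].
have vsZ (P : pred (rat * rat)) : (vsum P graded <= Z)%VS.
  by apply: vsum_min => w _; apply/subvP => x /graded_weight[].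
have wsZ (W : {vspace 'M[K]_n}) (P : pred (rat * rat)) :
    (forall x, x \in W -> weight_sum Z h' P x) -> (W <= Z)%VS.
  move=> WP; apply/subvP => x /WP[s [f [_ _ fP ->]]].
  by rewrite big_seq memv_suml // => w /fP[].
(* The nonnegative part for one pair meets the remaining part for the other trivially, in both ways,
   while the two parts for each single pair span [Z]. The four inequalities force equality. *)
have le1 : (\dim (positive_centralizer g e h) + \dim Wm <= \dim Z)%N.
  apply: dim_sum; rewrite ?(wsZ _ _ WmP) ?vsZ // => x /vsum_weight xp /WmP.
  by apply: disj xp => w wp; rewrite /= negbK.
have le2 : (\dim Zm + \dim Wp <= \dim Z)%N.
  apply: dim_sum; rewrite ?(wsZ _ _ WpP) ?vsZ // => x /vsum_weight xm /WpP.
  by apply: disj xm => w.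
have ge1 : (\dim Z <= \dim Wp + \dim Wm)%N.
  by apply: leq_trans (dimvS ZW) _; rewrite -dimv_sum_cap leq_addr.
have ge2 : (\dim Z <= \dim (positive_centralizer g e h) + \dim Zm)%N.
  rewrite -dimv_sum_cap; apply: leq_trans _ (leq_addr _ _); apply: dimvS.
  apply: subv_trans Z_weights _; apply: vsum_min => w _.
  have [wp|wm] := boolP (nonneg w).
    by apply: subv_trans (addvSl _ _); apply: (@vsum_sup _ _ _ nonneg graded).
  by apply: subv_trans (addvSr _ _); apply: (@vsum_sup _ _ _ (predC nonneg) graded).
by lia.
Qed.

End NilpotentPair.

(** * Matrices with prescribed support *)

Section Masks.
Variables (K : fieldType) (n : nat).
Implicit Types (R : rel 'I_n) (X Y B : 'M[K]_n).

Definition maskmx R X : 'M[K]_n := \matrix_(i, j) (X i j *+ R i j).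

Fact maskmx_is_linear R : linear (maskmx R).
Proof.
by move=> a X Y; apply/matrixP => i j; rewrite !mxE mulrnDl mulrnAr.
Qed.

HB.instance Definition _ R := GRing.isLinear.Build K 'M[K]_n 'M[K]_n _ (maskmx R)
  (maskmx_is_linear R).

Definition supp R : {vspace 'M[K]_n} := lker (linfun (maskmx (fun i j => ~~ R i j))).

Lemma suppP R X : reflect (forall i j, X i j != 0 -> R i j) (X \in supp R).
Proof.
rewrite memv_ker lfunE /=; apply: (iffP eqP) => [/matrixP X0 i j|XR].
  by apply: contraNT => nR; have := X0 i j; rewrite !mxE nR mulr1n => ->.
apply/matrixP => i j; rewrite !mxE; case: (boolP (R i j)) => //= nR.
by apply/eqP; apply: contraNT nR => /XR.
Qed.

Lemma supp0 R X i j : X \in supp R -> ~~ R i j -> X i j = 0.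
Proof. by move=> /suppP XR nR; apply/eqP; apply: contraNT nR => /XR. Qed.

Lemma mask_supp R X : maskmx R X \in supp R.
Proof. by apply/suppP => i j; rewrite mxE; case: (R i j); rewrite ?eqxx. Qed.

Lemma maskC R X : maskmx R X + maskmx (fun i j => ~~ R i j) X = X.
Proof.
by apply/matrixP => i j; rewrite !mxE; case: (R i j); rewrite ?addr0 ?add0r.
Qed.

Lemma mask_id R X : X \in supp R -> maskmx R X = X.
Proof.
by rewrite memv_ker lfunE /= => /eqP m0; rewrite -[RHS](maskC R) m0 addr0.
Qed.

Lemma sub_supp R R' : subrel R R' -> (supp R <= supp R')%VS.
Proof. by move=> sR; apply/subvP => X /suppP XR; apply/suppP => i j /XR /sR. Qed.

Section Equivalence.
Variables (T : eqType) (c : 'I_n -> T).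
Let same : rel 'I_n := fun i j => c i == c j.

Lemma mask_mulmxl B X : B \in supp same -> maskmx same (B *m X) = B *m maskmx same X.
Proof.
move=> Bs; apply/matrixP => i j; rewrite !mxE -sumrMnl; apply: eq_bigr => k _.
rewrite !mxE; have [ik|ik] := boolP (same i k).
  by rewrite /same (eqP ik) mulrnAr.
by rewrite (supp0 Bs ik) !mul0r mul0rn.
Qed.

Lemma mask_mulmxr B X : B \in supp same -> maskmx same (X *m B) = maskmx same X *m B.
Proof.
move=> Bs; apply/matrixP => i j; rewrite !mxE -sumrMnl; apply: eq_bigr => k _.
rewrite !mxE; have [ik|ik] := boolP (same k j).
  by rewrite /same -(eqP ik) mulrnAl.
by rewrite (supp0 Bs ik) !mulr0 mul0rn.
Qed.

Lemma mask_tr X : maskmx same X^T = (maskmx same X)^T.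
Proof. by apply/matrixP => i j; rewrite !mxE /same eq_sym. Qed.

Lemma supp_ad B X : B \in supp same -> X \in supp same -> ad B X \in supp same.
Proof.
move=> Bs Xs; rewrite -(mask_id Xs) adE -mask_mulmxl // -mask_mulmxr // -linearB.
exact: mask_supp.
Qed.

End Equivalence.

End Masks.

(** * The positive centralizer computed from a diagonal pair in another basis *)

Section ConjugatedGrading.
Variables (K : closedFieldType) (charK : [pchar K] =i pred0) (n' : nat).
Local Notation n := n'.+1.
Variables (t : classical_type) (J : 'M[K]_n) (e h : 'M[K]_n * 'M[K]_n).
Let g := classical_algebra t J.
Hypothesis eP : distinguished_pair g e h.
Variables (P : 'M[K]_n) (Pu : P \in unitmx) (d : 'I_n -> point).
Let h' := (P *m diag_mx (\row_i ratr (d i).1) *m invmx P,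
           P *m diag_mx (\row_i ratr (d i).2) *m invmx P).
Hypothesis h'g : h'.1 \in g /\ h'.2 \in g.
Hypothesis h'1 : ad h'.1 e.1 = e.1 /\ ad h'.1 e.2 = 0.
Hypothesis h'2 : ad h'.2 e.1 = 0 /\ ad h'.2 e.2 = e.2.
Let Z := centralizer g e.

Definition conjP (Q : 'M[K]_n) : 'End('M[K]_n) :=
  (linfun (mulmxr Q) \o linfun (mulmx (invmx Q)))%VF.

Lemma conjPE Q X : conjP Q X = invmx Q *m X *m Q.
Proof. by rewrite comp_lfunE !lfunE. Qed.

Let conj_eq Q : P *m conjP P Q *m invmx P = Q.
Proof. by rewrite conjPE !mulmxA mulmxV // mul1mx mulmxK. Qed.

Let deg (i j : 'I_n) : point := ((d i).1 - (d j).1, (d i).2 - (d j).2).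
Let nonneg : pred (rat * rat) := [pred w : rat * rat | (0 <= w.1) && (0 <= w.2)].

Let ad_diag (f : 'I_n -> rat) (Y : 'M[K]_n) i j :
  (conjP P (ad (P *m diag_mx (\row_i ratr (f i)) *m invmx P) Y)) i j =
  ratr (f i - f j) * (conjP P Y) i j.
Proof.
set D := diag_mx _; set C := conjP P Y.
have -> : ad (P *m D *m invmx P) Y = P *m (D *m C - C *m D) *m invmx P.
  rewrite -[Y](conj_eq Y) -/C adE mulmxBr mulmxBl !mulmxA.
  by rewrite -!(mulmxA _ (invmx P) P) !(mulVmx Pu) !mulmx1.
rewrite conjPE !mulmxA (mulVmx Pu) mul1mx (mulmxKV Pu).
rewrite mul_diag_mx mul_mx_diag !mxE ratrB_char0 // mulrBl.
by congr (_ - _); rewrite mulrC.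
Qed.

Let weightP w Y : weight_vector h' w Y <-> conjP P Y \in supp K (fun i j => deg i j == w).
Proof.
have inj : injective (conjP P).
  by move=> A B AB; rewrite -(conj_eq A) AB conj_eq.
split=> [[w1 w2]|/suppP Yw].
  apply/suppP => i j Y0; rewrite [w]surjective_pairing /deg -pair_eqE /pair_eq /=.
  apply/andP; split; rewrite -subr_eq0 -(ratr_eq0_char0 charK) ratrB_char0 // subr_eq0;
  apply/eqP/(mulIf Y0).
    by rewrite -(ad_diag (fun i => (d i).1)) w1 linearZ mxE.
  by rewrite -(ad_diag (fun i => (d i).2)) w2 linearZ mxE.
split; apply: inj; apply/matrixP => i j; rewrite ad_diag linearZ mxE.
  by have [->|/Yw /eqP <-] := eqVneq (conjP P Y i j) 0; rewrite ?mulr0.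
by have [->|/Yw /eqP <-] := eqVneq (conjP P Y i j) 0; rewrite ?mulr0.
Qed.

Let h'Z : pair_stable h' Z.
Proof.
by apply: centralizer_pair_stable => // u y; apply: classical_algebra_ad.
Qed.

Let degs := undup (codom (fun ij : 'I_n * 'I_n => deg ij.1 ij.2)).
Let part (x : 'M[K]_n) w := P *m maskmx (fun i j => deg i j == w) (conjP P x) *m invmx P.

Let conj_part x w : conjP P (part x w) = maskmx (fun i j => deg i j == w) (conjP P x).
Proof. by rewrite [LHS]conjPE /part !mulmxA mulVmx // mul1mx mulmxKV. Qed.

Let parts x : x \in Z -> x = \sum_(w <- degs) part x w /\
  {in degs, forall w, part x w \in Z /\ weight_vector h' w (part x w)}.
Proof.
move=> xZ; have xE : x = \sum_(w <- degs) part x w.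
  rewrite -{1}(conj_eq x) -mulmx_suml -mulmx_sumr; congr (_ *m _ *m _).
  apply/matrixP => i j; rewrite summxE.
  have ij : deg i j \in degs by rewrite mem_undup (codom_f _ (i, j)).
  rewrite (big_rem _ ij) /= mxE eqxx big_seq big1 ?addr0 // => w.
  rewrite mem_rem_uniq ?undup_uniq // inE => /andP[ne _].
  by rewrite mxE eq_sym (negbTE ne).
have wP w : weight_vector h' w (part x w) by apply/weightP; rewrite conj_part mask_supp.
split=> // w wd; split=> //; move: w wd.
by apply: (weight_split charK h'Z (undup_uniq _)); rewrite // -xE.
Qed.

(** For the conjugated diagonal pair [h'], weight components are cut out by masking the entries with
    a given difference of weights. As [Z] is stable under [h'] it contains these components, which
    provides the two complementary spaces needed for the independence of the pair. *)
Lemma dim_positive_centralizer_diag :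
  \dim (positive_centralizer g e h) =
  \dim (Z :&: (conjP P @^-1: supp K (fun i j => nonneg (deg i j))))%VS.
Proof.
pose W (Q : pred (rat * rat)) := (Z :&: (conjP P @^-1: supp K (fun i j => Q (deg i j))))%VS.
have WP (Q : pred (rat * rat)) x : x \in W Q -> weight_sum Z h' Q x.
  rewrite memv_cap -memv_preim => /andP[xZ xQ]; have [xE xP] := parts xZ.
  exists (filter Q degs), (part x); split.
  - by rewrite filter_uniq ?undup_uniq.
  - by move=> w; rewrite mem_filter => /andP[].
  - by move=> w; rewrite mem_filter => /andP[_ /xP].
  rewrite {1}xE big_filter [RHS]big_mkcond; apply: eq_bigr => w _; case: ifP => // Qw.
  rewrite /part (_ : maskmx _ _ = 0) ?mulmx0 ?mul0mx //; apply/matrixP => i j; rewrite !mxE.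
  by case: eqP => // <- in Qw *; rewrite (supp0 xQ) ?Qw.
apply: (@dim_positive_centralizer_indep _ charK _ _ _ _ _ eP h' _ (W (predC nonneg))) => //.
- by move=> x /parts[xE xP]; exists degs, (part x); split=> //; apply: undup_uniq.
- by move=> x /WP.
- by move=> x /WP.
apply/subvP => x /parts[xE xP]; rewrite xE big_seq; apply: memv_suml => w /xP[wZ /weightP wP].
have [nw|nw] := boolP (nonneg w).
  apply: (subvP (addvSl _ _)); rewrite memv_cap wZ -memv_preim; move: wP.
  by apply: (subvP (sub_supp _ _)) => i j /eqP ->.
apply: (subvP (addvSr _ _)); rewrite memv_cap wZ -memv_preim; move: wP.
by apply: (subvP (sub_supp _ _)) => i j /eqP ->.
Qed.

End ConjugatedGrading.

(** * Skew diagrams *)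

Section PlanarPaths.

Definition locally_skew (G : int -> int -> Prop) :=
  forall i j, G i j -> G (i + 1) (j + 1) -> G (i + 1) j /\ G i (j + 1).

Definition transpose (G : int -> int -> Prop) i j := G j i.

Lemma locally_skew_transpose G : locally_skew G -> locally_skew (transpose G).
Proof. by move=> sG i j g1 g2; case: (sG j i g1 g2). Qed.

(* [right_down G i j]: a lattice path inside [G] from the origin to [(i, j)]
   using only unit steps to the right and downwards. *)
Inductive right_down (G : int -> int -> Prop) : int -> int -> Prop :=
| RightDown0 : G 0 0 -> right_down G 0 0
| RightStep i j : right_down G i j -> G (i + 1) j -> right_down G (i + 1) j
| DownStep i j : right_down G i j -> G i (j - 1) -> right_down G i (j - 1).

Definition box_above (G : int -> int -> Prop) a b :=
  [/\ 0 <= a, 0 <= b & forall i j : int, 0 <= i <= a -> 0 <= j <= b -> G i j].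

Definition box_below (G : int -> int -> Prop) a b :=
  [/\ a <= 0, b <= 0 & forall i j : int, a <= i <= 0 -> b <= j <= 0 -> G i j].

Variables (G : int -> int -> Prop) (sG : locally_skew G) (G0 : G 0 0).

Lemma right_down_bounds i j : right_down G i j -> [/\ 0 <= i, j <= 0 & G i j].
Proof. by elim=> [|{}i {}j _ [? ? ?] ?|{}i {}j _ [? ? ?] ?]; split=> //; lia. Qed.

Lemma right_down_row a b : right_down G a b -> b = 0 -> box_above G a 0.
Proof.
elim=> [_|i j rd IH Gij j0|i j rd _ _ j0].
- by split=> // i j i0 j0; have [-> ->] : i = 0 /\ j = 0 by lia.
- have [? _ IHG] := IH j0; split=> // [|k l kP l0]; first by lia.
  have -> : l = 0 by lia.
  have [->|ne] := eqVneq k (i + 1); first by rewrite -j0.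
  by apply: IHG; lia.
by have [] := right_down_bounds rd; lia.
Qed.

(** An upward step undoes a final downward step. After a final step to the right, skewness moves the
    upper cell one column to the left, and induction applies there. Only a path that never left the
    axis escapes. *)
Lemma right_down_up a b : right_down G a b -> G a (b + 1) ->
  right_down G a (b + 1) \/ b = 0 /\ box_above G a 0.
Proof.
elim=> [_ _|i j rd IH Gij Gij1|i j rd _ _ _].
- by right; split=> //; split=> // i j i0 j0; have [-> ->] : i = 0 /\ j = 0 by lia.
- have [_ _ Gi] := right_down_bounds rd; have [_ Gi1] := sG Gi Gij1.
  have [rd1|[j0 _]] := IH Gi1; first by left; apply: RightStep.
  by right; split=> //; apply: (@right_down_row _ j) => //; apply: RightStep.
by left; rewrite subrK.
Qed.

Lemma right_down_left a b : right_down G a b -> G (a - 1) b ->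
  right_down G (a - 1) b \/ a = 0 /\ box_below G 0 b.
Proof.
elim=> [_ _|i j rd _ _ _|i j rd IH Gij Gi1j].
- by right; split=> //; split=> // i j i0 j0; have [-> ->] : i = 0 /\ j = 0 by lia.
- by left; rewrite addrK.
have [_ _ Gi] := right_down_bounds rd.
have [] := sG Gi1j; first by rewrite !subrK.
rewrite !subrK => _ /IH[rd1|[i0 [_ j0 boxG]]]; first by left; apply: DownStep.
right; split=> //; split=> // [|k l k0 lP]; first by lia.
have -> : k = 0 by lia.
have [->|ne] := eqVneq l (j - 1); first by rewrite -i0.
by apply: boxG; lia.
Qed.

(** Skewness fills the new row from its right end leftwards, using the top row of the old box. *)
Lemma box_above_up (a b : int) : box_above G a b -> G a (b + 1) -> box_above G a (b + 1).
Proof.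
move=> [a0 b0 boxG] Gb; split=> // [|i j iP jP]; first by lia.
have [jb|ne] := eqVneq j (b + 1); last by apply: boxG; lia.
have row (k : nat) : k%:Z <= a -> G (a - k%:Z) (b + 1).
  elim: k => [|k IHk] ka; first by rewrite subr0.
  have := IHk ltac:(lia); have -> : a - k%:Z = (a - k.+1%:Z) + 1 by lia.
  by move=> /(sG (boxG (a - k.+1%:Z) b ltac:(lia) ltac:(lia)))[].
by rewrite jb; have := row `|a - i|%N ltac:(lia); have -> : a - `|a - i|%N%:Z = i by lia.
Qed.

Lemma box_below_down (a b : int) : box_below G a b -> G a (b - 1) -> box_below G a (b - 1).
Proof.
move=> [a0 b0 boxG] Gb; split=> // [|i j iP jP]; first by lia.
have [jb|ne] := eqVneq j (b - 1); last by apply: boxG; lia.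
have row (k : nat) : a + k%:Z <= 0 -> G (a + k%:Z) (b - 1).
  elim: k => [|k IHk] ka; first by rewrite addr0.
  have := IHk (ltac:(lia)) => Gk.
  have [] := sG Gk; first by apply: boxG; lia.
  by rewrite (_ : a + k%:Z + 1 = a + k.+1%:Z); last by lia.
by rewrite jb; have := row `|i - a|%N ltac:(lia); have -> : a + `|i - a|%N%:Z = i by lia.
Qed.

Lemma row_right_down a : box_above G a 0 -> right_down G a 0.
Proof.
move=> [a0 _ boxG].
have row (k : nat) : k%:Z <= a -> right_down G k%:Z 0.
  elim: k => [|k IHk] ka; first exact: RightDown0.
  rewrite (_ : k.+1%:Z = k%:Z + 1); last by lia.
  by apply: RightStep; [apply: IHk|apply: boxG]; lia.
by rewrite (_ : a = `|a|%N%:Z); [apply: row|]; lia.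
Qed.

Lemma column_right_down b : box_below G 0 b -> right_down G 0 b.
Proof.
move=> [_ b0 boxG].
have col (k : nat) : k%:Z <= - b -> right_down G 0 (- k%:Z).
  elim: k => [|k IHk] kb; first by rewrite oppr0; exact: RightDown0.
  rewrite (_ : - k.+1%:Z = - k%:Z - 1); last by lia.
  by apply: DownStep; [apply: IHk|apply: boxG]; lia.
by rewrite (_ : b = - `|b|%N%:Z); [apply: col|]; lia.
Qed.

End PlanarPaths.

Section Convexity.

Lemma box_above_transpose G a b : box_above G a b -> box_above (transpose G) b a.
Proof. by case=> ? ? H; split=> // i j ? ?; apply: H. Qed.

Lemma box_below_transpose G a b : box_below G a b -> box_below (transpose G) b a.
Proof. by case=> ? ? H; split=> // i j ? ?; apply: H. Qed.

(* Every cell of a connected skew set is reached from the origin by a monotone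
   path, and a cell above the origin then spans a full box with it. *)
Definition monotone_position G a b :=
  [\/ right_down G a b, right_down (transpose G) b a, box_above G a b | box_below G a b].

Lemma monotone_position_transpose G a b :
  monotone_position (transpose G) b a -> monotone_position G a b.
Proof.
case=> H; [exact: Or42|exact: Or41|apply: Or43|apply: Or44].
  exact: box_above_transpose H.
exact: box_below_transpose H.
Qed.

(** Vertical moves suffice, horizontal ones being their transposes. The kind of position changes
    only on an axis, where a path degenerates to a segment, which is also a box. *)
Lemma monotone_position_vertical G a b : locally_skew G -> G 0 0 ->
  monotone_position G a b ->
  (G a (b + 1) -> monotone_position G a (b + 1)) /\
  (G a (b - 1) -> monotone_position G a (b - 1)).
Proof.
move=> sG G0 pos; have sT := locally_skew_transpose sG.
case: pos => [rd|ul|up|down]; split=> Gb.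
- have [|[b0 box]] := right_down_up sG G0 rd Gb; first exact: Or41.
  by apply: Or43; apply: box_above_up => //; rewrite b0 in Gb *.
- by apply: Or41; apply: DownStep.
- by apply: Or42; apply: RightStep.
- have [|[b0 box]] := right_down_left sT G0 ul Gb; first exact: Or42.
  apply: Or44; rewrite b0 in Gb *; apply: box_below_down => //.
  exact: box_below_transpose box.
- by apply: Or43; apply: box_above_up.
- have [a0 b0 boxG] := up; have [bE|bN] := eqVneq b 0.
    apply: Or41; apply: DownStep => //; rewrite bE in up *.
    exact: row_right_down up.
  by apply: Or43; split=> // [|i j iP jP]; [lia|apply: boxG; lia].
- have [a0 b0 boxG] := down; have [bE|bN] := eqVneq b 0.
    apply: Or42; apply: RightStep => //; rewrite bE in down *.
    by apply: column_right_down => //; apply: box_below_transpose.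
  by apply: Or44; split=> // [|i j iP jP]; [lia|apply: boxG; lia].
- by apply: Or44; apply: box_below_down.
Qed.

Lemma monotone_position_box G a b : G 0 0 -> 0 <= a -> 0 <= b ->
  monotone_position G a b -> box_above G a b.
Proof.
move=> G0 a0 b0 [rd|ul|//|[a0' b0' _]].
- have [_ b0' _] := right_down_bounds rd.
  have bE : b = 0 by lia.
  by rewrite bE in rd *; apply: right_down_row rd _.
- have [_ a0' _] := right_down_bounds ul.
  have aE : a = 0 by lia.
  by rewrite aE in ul *; apply: box_above_transpose; apply: right_down_row ul _.
have [-> ->] : a = 0 /\ b = 0 by lia.
by split=> // i j i0 j0; have [-> ->] : i = 0 /\ j = 0 by lia.
Qed.

End Convexity.

(** * Convexity of skew diagrams for the product order *)

Section Diagrams.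
Implicit Types (G : {fset point}) (p q m : point).

Definition unit_step p q :=
  [\/ q = (p.1 + 1, p.2), q = (p.1 - 1, p.2), q = (p.1, p.2 + 1) | q = (p.1, p.2 - 1)].

Lemma diagram_int G p q : skew_diagram G -> p \in G -> q \in G ->
  q.1 - p.1 \is a Num.int /\ q.2 - p.2 \is a Num.int.
Proof.
move=> [[a la] _ _] /la[p1 p2] /la[q1 q2].
have shift (x y z : rat) : x - y = (x - z) - (y - z) by ring.
by split; [rewrite (shift _ _ a.1)|rewrite (shift _ _ a.2)]; rewrite rpredB.
Qed.

Lemma adjacent_unit_step G p q : skew_diagram G -> p \in G -> q \in G ->
  adjacent p q -> unit_step p q.
Proof.
move=> sG pG qG; have [/intrP[a aE] /intrP[b bE]] := diagram_int sG pG qG.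
rewrite /adjacent -[p.1 - q.1]opprB -[p.2 - q.2]opprB !sqrrN aE bE.
rewrite -!rmorphXn -rmorphD /= -[1]/(1%:~R) eqr_int => /eqP ab.
have : [\/ a = 1 /\ b = 0, a = -1 /\ b = 0, a = 0 /\ b = 1 | a = 0 /\ b = -1].
  have aP : a = 1 \/ a = -1 \/ a = 0 by nia.
  have bP : b = 1 \/ b = -1 \/ b = 0 by nia.
  case: aP => [aa|[aa|aa]]; case: bP => [bb|[bb|bb]]; rewrite aa bb in ab *;
    try (exfalso; lia).
  - exact: Or41.
  - exact: Or42.
  - exact: Or43.
  - exact: Or44.
rewrite [q]surjective_pairing; case=> -[aa bb]; rewrite aa bb in aE bE.
- by apply: Or41; congr pair; lra.
- by apply: Or42; congr pair; lra.
- by apply: Or43; congr pair; lra.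
- by apply: Or44; congr pair; lra.
Qed.

(** Induction along a connecting path; it turns connectedness into an invariance principle under
    unit steps. *)
Lemma skew_closure G (Q : point -> Prop) p : skew_diagram G -> p \in G -> Q p ->
  (forall q q', q \in G -> q' \in G -> Q q -> unit_step q q' -> Q q') ->
  forall q, q \in G -> Q q.
Proof.
move=> sG pG Qp Qstep q qG; have [_ /(_ p q pG qG)[s [ps sub <-]] _] := sG.
elim: s p pG Qp ps sub => //= p' s IHs p pG Qp /andP[pp' ps] sub.
have p'G : p' \in G by apply: sub; rewrite mem_head.
apply: IHs => //; last by move=> x xs; apply: sub; rewrite inE xs orbT.
by apply: Qstep Qp _ => //; apply: (adjacent_unit_step sG).
Qed.

(** With [p] as origin, being in monotone position is preserved by unit steps, so it holds for [q];
    lying to the north-east, [q] then spans a full box with [p]. *)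
Lemma skew_convex G p q m : skew_diagram G -> p \in G -> q \in G ->
  p.1 <= m.1 <= q.1 -> p.2 <= m.2 <= q.2 ->
  m.1 - p.1 \is a Num.int -> m.2 - p.2 \is a Num.int -> m \in G.
Proof.
move=> sG pG qG m1 m2 /intrP[a aE] /intrP[b bE].
pose g (i j : int) : Prop := (p.1 + i%:~R, p.2 + j%:~R) \in G.
have g0 : g 0 0 by rewrite /g !addr0 -surjective_pairing.
have sg : locally_skew g.
  move=> i j; have [_ _ H] := sG; rewrite /g !rmorphD /= !addrA => gi gj.
  by have [] := H _ _ gi gj.
have Q : forall q, q \in G ->
    exists i j : int, q = (p.1 + i%:~R, p.2 + j%:~R) /\ monotone_position g i j.
  apply: (skew_closure sG pG).
    exists 0, 0; rewrite !addr0 -surjective_pairing; split=> //.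
    by apply: Or41; apply: RightDown0.
  move=> u u' uG u'G [i [j [uE pos]]] step.
  have [U D] := monotone_position_vertical sg g0 pos.
  have posT : monotone_position (transpose g) j i by apply: monotone_position_transpose.
  have [Rt Lt] := monotone_position_vertical (locally_skew_transpose sg) g0 posT.
  case: step => u'E; rewrite u'E uE /= in u'G *; rewrite -addrA in u'G *.
  - exists (i + 1), j; rewrite rmorphD /=; split=> //.
    by apply: monotone_position_transpose; apply: Rt; rewrite /transpose /g rmorphD.
  - exists (i - 1), j; rewrite rmorphB /=; split=> //.
    by apply: monotone_position_transpose; apply: Lt; rewrite /transpose /g rmorphB.
  - by exists i, (j + 1); rewrite rmorphD /=; split=> //; apply: U; rewrite /g rmorphD.
  - by exists i, (j - 1); rewrite rmorphB /=; split=> //; apply: D; rewrite /g rmorphB.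
have [i [j [qE pos]]] := Q q qG; rewrite qE /= in m1 m2.
have m1E : m.1 = p.1 + a%:~R by rewrite -aE; ring.
have m2E : m.2 = p.2 + b%:~R by rewrite -bE; ring.
rewrite m1E -[X in X <= _]addr0 !lerD2l -[0]/(0%:~R) !ler_int in m1.
rewrite m2E -[X in X <= _]addr0 !lerD2l -[0]/(0%:~R) !ler_int in m2.
rewrite [m]surjective_pairing m1E m2E.
have [||_ _ box] := monotone_position_box g0 _ _ pos; try lia.
by apply: box.
Qed.

End Diagrams.

(** * Corners of skew diagrams and the homomorphisms they carry *)

Section Corners.
Implicit Types (G D : {fset point}) (p q c d u w : point).

Definition ex : point := (1, 0).
Definition ey : point := (0, 1).

Definition le_point p q := (p.1 <= q.1) && (p.2 <= q.2).

Lemma le_point_trans p q c : le_point p q -> le_point q c -> le_point p c.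
Proof.
by move=> /andP[? ?] /andP[? ?]; apply/andP; split;
  [apply: (@le_trans _ _ q.1)|apply: (@le_trans _ _ q.2)].
Qed.

Lemma le_pointN p q : le_point (- p) (- q) = le_point q p.
Proof. by rewrite /le_point /= !lerN2. Qed.

Lemma pointD p q : p + q = (p.1 + q.1, p.2 + q.2).
Proof. by []. Qed.

Lemma pointB p q : p - q = (p.1 - q.1, p.2 - q.2).
Proof. by []. Qed.

Lemma sw_cornerE G p : sw_corner G p = [&& p \in G, p - ex \notin G & p - ey \notin G].
Proof. by rewrite !pointB /= !subr0. Qed.

Lemma ne_cornerE G p : ne_corner G p = [&& p \in G, p + ex \notin G & p + ey \notin G].
Proof. by rewrite !pointD /= !addr0. Qed.

Lemma sw_cornerN G p : centrally_symmetric G -> sw_corner G (- p) = ne_corner G p.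
Proof.
move=> symG; have sG q : (- q \in G) = (q \in G).
  apply/idP/idP; last by case: q => i j; apply: symG.
  by move=> /[dup] qG; rewrite [- q]surjective_pairing => /symG;
    rewrite /= !opprK -surjective_pairing.
by rewrite sw_cornerE ne_cornerE !sG -!opprD !sG.
Qed.

(** Minimize the coordinate sum among the cells below [c]. *)
Lemma exists_sw_corner G c : c \in G -> exists2 p, sw_corner G p & le_point p c.
Proof.
move=> cG; pose P (x : G) := le_point (val x) c.
have Pc : P [` cG]%fset by rewrite /P /le_point /= !lexx.
case: (@Order.TotalTheory.arg_minP _ _ _ [` cG]%fset P (fun x => (val x).1 + (val x).2) Pc).
move=> x Px min_x; exists (val x) => //.
have out u : (u = ex \/ u = ey) -> val x - u \notin G.
  move=> uE; apply/negP => xuG; have := min_x [` xuG]%fset; rewrite /P /=.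
  have xuc : le_point (val x - u) c.
    move: Px; rewrite /P /le_point /= => /andP[? ?].
    by case: uE => -> /=; apply/andP; split; lra.
  by move=> /(_ xuc); case: uE => -> /=; lra.
by rewrite sw_cornerE (valP x) !out //; [right|left].
Qed.

Lemma exists_ne_corner G c : centrally_symmetric G -> c \in G ->
  exists2 p, ne_corner G p & le_point c p.
Proof.
move=> symG cG; have [|p sw le_pc] := @exists_sw_corner G (- c).
  by case: (c) cG => i j; apply: symG.
exists (- p); first by rewrite -(sw_cornerN _ symG) opprK.
by rewrite -le_pointN opprK.
Qed.

Lemma int_lt_addr1 (x y : rat) : y - x \is a Num.int -> x < y -> x + 1 <= y.
Proof.
move=> /intrP[a aE] xy; have : (0 : rat) < a%:~R by rewrite -aE subr_gt0.
have -> : y = x + a%:~R by rewrite -aE; ring.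
by rewrite ltr0z lerD2l -[1]/(1%:~R) ler_int => a0; lia.
Qed.

Lemma skew_step G p q : skew_diagram G -> p \in G -> q \in G -> le_point p q ->
  (p.1 < q.1 -> p + ex \in G /\ q - ex \in G) /\ (p.2 < q.2 -> p + ey \in G /\ q - ey \in G).
Proof.
move=> sG pG qG pq; have [d1 d2] := diagram_int sG pG qG.
have shift_int (x y : rat) : x - y \is a Num.int -> x - 1 - y \is a Num.int.
  by move=> xy; rewrite addrAC rpredB ?rpred1.
have succ_int (x : rat) : x + 1 - x \is a Num.int by rewrite addrAC subrr add0r rpred1.
have zero_int (x : rat) : x - x \is a Num.int by rewrite subrr rpred0.
move: (pq) => /andP[le1 le2]; split=> lt.
  have := int_lt_addr1 d1 lt => le.
  have bnd1 : p.1 <= p.1 + 1 <= q.1 by apply/andP; split; lra.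
  have bnd2 : p.1 <= q.1 - 1 <= q.1 by apply/andP; split; lra.
  split; apply: (skew_convex sG pG qG); rewrite /= ?addr0 ?subr0 ?lexx ?le2 //.
  exact: shift_int.
have := int_lt_addr1 d2 lt => le.
have bnd1 : p.2 <= p.2 + 1 <= q.2 by apply/andP; split; lra.
have bnd2 : p.2 <= q.2 - 1 <= q.2 by apply/andP; split; lra.
split; apply: (skew_convex sG pG qG); rewrite /= ?addr0 ?subr0 ?lexx ?le1 //.
exact: shift_int.
Qed.

Lemma sw_corner_minimal G p q : skew_diagram G -> p \in G -> sw_corner G q ->
  le_point p q -> p = q.
Proof.
move=> sG pG; rewrite sw_cornerE => /and3P[qG /negP q1 /negP q2] pq.
apply/eqP; apply: contraT => ne; have [s1 s2] := skew_step sG pG qG pq.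
move: (pq) => /andP[]; rewrite le_eqVlt => /orP[/eqP e1|/s1[_ /q1 //]].
rewrite le_eqVlt => /orP[/eqP e2|/s2[_ /q2 //]].
by case/eqP: ne; rewrite [p]surjective_pairing e1 e2 -surjective_pairing.
Qed.

Lemma ne_corner_maximal G p q : skew_diagram G -> q \in G -> ne_corner G p ->
  le_point p q -> p = q.
Proof.
move=> sG qG; rewrite ne_cornerE => /and3P[pG /negP q1 /negP q2] pq.
apply/eqP; apply: contraT => ne; have [s1 s2] := skew_step sG pG qG pq.
move: (pq) => /andP[]; rewrite le_eqVlt => /orP[/eqP e1|/s1[/q1 //]].
rewrite le_eqVlt => /orP[/eqP e2|/s2[/q2 //]].
by case/eqP: ne; rewrite [p]surjective_pairing e1 e2 -surjective_pairing.
Qed.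

Lemma symmetric_mem G p : centrally_symmetric G -> (- p \in G) = (p \in G).
Proof.
move=> symG; apply/idP/idP; last by case: p => i j; apply: symG.
by move=> pG; rewrite -[p]opprK; case: (- p) pG => i j; apply: symG.
Qed.

(** Otherwise all cells lie in the open north-west and south-east quadrants. Central symmetry
    exchanges the two, whereas no unit step leads from one to the other. *)
Lemma exists_nonpositive_cell G : skew_diagram G -> centrally_symmetric G -> G <> fset0 ->
  exists2 c, c \in G & le_point c 0.
Proof.
move=> sG symG /eqP /fset0Pn[c0 c0G]; apply: contrapT => none.
have neg c : c \in G -> ~~ le_point c 0.
  by move=> cG; apply/negP => le; apply: none; exists c.
have pos c : c \in G -> ~~ le_point 0 c.
  by move=> cG; rewrite -[c]opprK -{1}[0]oppr0 le_pointN neg // symmetric_mem.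
have [c [cG c1 c2]] : exists c, [/\ c \in G, c.1 < 0 & 0 < c.2].
  have := neg _ c0G; have := pos _ c0G; rewrite /le_point /= !negb_and -!ltNge.
  case/orP=> [c1|c2] /orP[d1|d2]; try lra; first by exists c0.
  by exists (- c0); rewrite symmetric_mem //= oppr_lt0 oppr_gt0.
pose Q c := c.1 < 0 /\ 0 < c.2.
have /(_ (- c)) : forall q, q \in G -> Q q.
  apply: (skew_closure sG cG) => // q q' qG q'G [q1 q2] step.
  have := neg _ q'G; have := pos _ q'G; rewrite /le_point /Q /= !negb_and -!ltNge.
  by case: step => -> /=; case/orP=> ? /orP[] ?; split; lra.
by rewrite symmetric_mem // => /(_ cG) [/=]; lra.
Qed.

Lemma exists_nonpositive_sw_corner G : skew_diagram G -> centrally_symmetric G ->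
  G <> fset0 -> exists2 c, sw_corner G c & le_point c 0.
Proof.
move=> sG symG G0; have [c cG c0] := exists_nonpositive_cell sG symG G0.
have [p sw pc] := exists_sw_corner cG; exists p => //.
exact: le_point_trans pc c0.
Qed.

Lemma exists_nonnegative_ne_corner G : skew_diagram G -> centrally_symmetric G ->
  G <> fset0 -> exists2 c, ne_corner G c & le_point 0 c.
Proof.
move=> sG symG /(exists_nonpositive_sw_corner sG symG)[c sw c0]; exists (- c).
  by rewrite -sw_cornerN // opprK.
by rewrite -[0]oppr0 le_pointN.
Qed.

(** A southwest corner [c] is not hit by the shifts and a northeast corner [d] is killed by them, so
    the matrix unit sending [c] to [d] commutes with the shifts; the order condition makes its
    weight nonnegative. *)
Definition corner_hom G D c d := [&& sw_corner G c, ne_corner D d & le_point c d].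

(* The cells [c], [c + u] and [d], [d + u] carry a homomorphism between the
   modules of the two diagrams, sending [c] to [d]. *)
Definition domino_hom G D c d u w :=
  [/\ [/\ c \in G, c + u \in G, d \in D & d + u \in D], le_point c d,
      [/\ c - u \notin G, c - w \notin G & c + u - w \notin G] &
      [/\ d + u + u \notin D, d + w \notin D & d + u + w \notin D]].

Definition two_homs G D := exists c d c' d',
  [/\ corner_hom G D c d, (c', d') != (c, d) &
      corner_hom G D c' d' \/ domino_hom G D c' d' ey ex \/ domino_hom G D c' d' ex ey].

End Corners.

(** * Two centrally symmetric diagrams crossing at the origin *)

Section CrossingDiagrams.

Definition unit_closed (G Q : int -> int -> Prop) := forall i j k l : int,
  G i j -> G k l -> Q i j ->
  [\/ k = i + 1 /\ l = j, k = i - 1 /\ l = j, k = i /\ l = j + 1 | k = i /\ l = j - 1] ->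
  Q k l.

(** An interface for integral symmetric skew diagrams containing the origin, in terms that are
    invariant under transposition, so that one of the two directions of crossing is enough. *)
Record centred_skew (G : int -> int -> Prop) : Prop := CentredSkew {
  centred0 : G 0 0;
  centred_box : forall i j k l m n : int,
    G i j -> G k l -> i <= m <= k -> j <= n <= l -> G m n;
  centred_sym : forall i j, G i j -> G (- i) (- j);
  centred_low : forall i j : int, G i j -> exists k l : int,
    [/\ k <= i /\ l <= j, G k l, ~ G (k - 1) l & ~ G k (l - 1)];
  centred_ind : forall Q : int -> int -> Prop, Q 0 0 -> unit_closed G Q ->
    forall i j, G i j -> Q i j }.

Lemma centred_skew_transpose G : centred_skew G -> centred_skew (transpose G).
Proof.
case=> G0 box sym low ind; split=> //.
- by move=> i j k l m n g1 g2 mP nP; apply: (box _ _ _ _ _ _ g1 g2).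
- by move=> i j; apply: sym.
- by move=> i j /low[k [l [[? ?] ? ? ?]]]; exists l, k.
move=> Q Q0 Qstep i j; apply: (ind (fun i j => Q j i)) => // a b c d gab gcd Qab step.
apply: (Qstep b a) => //.
by case: step => -[-> ->]; [apply: Or43|apply: Or44|apply: Or41|apply: Or42].
Qed.

(** The southwest corner [(- a, 0)] of [G] and the northeast corner [(0, b)] of [D] give one
    homomorphism. The second comes from another southwest corner [(x, 1)] of [G], or from the
    vertical dominoes at [(- a, 0)] in [G] and [(0, b - 1)] in [D]. *)
Definition crossing_homs (G D : int -> int -> Prop) := exists a b : int,
  [/\ [/\ 0 <= a, 1 <= b, G (- a) 0 & D 0 b], ~ G (- a - 1) 0 /\ ~ G (- a) (- 1),
      ~ D 0 (b + 1) /\ ~ D 1 b &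
      (exists x, [/\ x < - a, G x 1, ~ G (x - 1) 1 & ~ G x 0]) \/
      [/\ G (- a) 1, ~ G (- a - 1) 1, D 0 (b - 1) & ~ D 1 (b - 1)]].

(** Here [G] follows the horizontal axis near the origin and [D] the vertical one. By convexity the
    corner [(k, l)] of [G] below the origin lies on the axis, and likewise for [D]. As [G] leaves
    its axis to the left of the origin, it contains [(k, 1)]. If it also contains [(k - 1, 1)],
    there is a further southwest corner in row 1; otherwise the domino above [(k, 0)] works. *)
Lemma horizontal_crossing G D : centred_skew G -> centred_skew D ->
  ~ G 0 1 -> ~ D 1 0 -> D 0 1 ->
  (exists i j, G i j /\ j <> 0) -> crossing_homs G D.
Proof.
move=> gG gD nG01 nD10 D01 [i0 [j0 [gij j0n]]].
have nG0m : ~ G 0 (- 1) by move=> /(centred_sym gG); rewrite oppr0 opprK.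
have nDm0 : ~ D (- 1) 0 by move=> /(centred_sym gD); rewrite oppr0 opprK.
have [k [l [[k0 l0] Gkl nG1 nG2]]] := centred_low gG (centred0 gG).
have lE : l = 0.
  apply: contrapT => ln; apply: nG0m.
  by apply: (centred_box gG Gkl (centred0 gG)); lia.
rewrite {l}lE in l0 Gkl nG1 nG2.
have [k' [l' [[k0' l0'] Dkl nD1 nD2]]] := centred_low gD (centred0 gD).
have kE : k' = 0.
  apply: contrapT => kn; apply: nDm0.
  by apply: (centred_box gD Dkl (centred0 gD)); lia.
rewrite {k'}kE in k0' Dkl nD1 nD2.
have l'n : l' <> 0.
  by move=> l'0; apply: nD2; rewrite l'0; have := centred_sym gD D01; rewrite oppr0.
(* Without such an exit upwards, row 0 would be closed under unit steps in [G]; an exit downwards is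
   reflected to one upwards. *)
have [x [Gx0 Gx1]] : exists x, G x 0 /\ G x 1.
  apply: contrapT => none; apply: j0n.
  apply: (centred_ind gG (Q := fun _ j => j = 0) _ _ gij) => // i j m n Gi Gm j_0.
  case=> -[mE nE]; rewrite {m}mE {n}nE j_0 ?add0r ?sub0r in Gi Gm *; rewrite //.
    by case: none; exists i.
  case: none; exists (- i); split; first by have := centred_sym gG Gi; rewrite oppr0.
  by have := centred_sym gG Gm; rewrite opprK.
have x0 : x < 0.
  rewrite ltNge; apply/negP => x0; apply: nG01.
  by apply: (centred_box gG (centred0 gG) Gx1); lia.
have kx : k <= x.
  rewrite leNgt; apply/negP => xk; apply: nG1.
  by apply: (centred_box gG Gx0 Gkl); lia.
have Gk1 : G k 1 by apply: (centred_box gG Gkl Gx1); lia.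
have Db : D 0 (- l') by have := centred_sym gD Dkl; rewrite oppr0.
exists (- k), (- l'); rewrite opprK; split.
- by split=> //; lia.
- by split=> //; move: nG2; rewrite sub0r.
- split=> H; [apply: nD2|apply: nD1].
    by have := centred_sym gD H; rewrite oppr0 opprD opprK.
  by have := centred_sym gD H; rewrite sub0r opprK.
have [Gk|nGk] := pselect (G (k - 1) 1).
  left; have [y [z [[yk z1] Gyz nGy nGz]]] := centred_low gG Gk.
  have zE : z = 1.
    apply: contrapT => zn; apply: nG1.
    by apply: (centred_box gG Gyz Gk); lia.
  rewrite {z}zE in z1 Gyz nGy nGz.
  by exists y; split=> //; rewrite ?subrr in nGz *; lia.
right; split=> //; first by apply: (centred_box gD (centred0 gD) Db); lia.
move=> D1; apply: nD10; apply: (centred_box gD (centred0 gD) D1); lia.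
Qed.

Lemma vertical_crossing G D : centred_skew G -> centred_skew D ->
  ~ G 1 0 -> ~ D 0 1 -> D 1 0 ->
  (exists i j, G i j /\ i <> 0) -> crossing_homs (transpose G) (transpose D).
Proof.
move=> gG gD nG nD D10 [i [j [gij i0]]].
apply: horizontal_crossing => //; try exact: centred_skew_transpose.
by exists j, i.
Qed.

End CrossingDiagrams.

(** * Transfer of the crossing argument to diagrams of points *)

Section IntegralDiagrams.
Implicit Types (G D : {fset point}) (p q c d u w : point).

Definition int_cells G (i j : int) : Prop := (i%:~R, j%:~R) \in G.

Lemma integral_cell G p : in_lattice (0, 0) G -> p \in G ->
  exists i j : int, p = (i%:~R, j%:~R).
Proof.
move=> lat /lat; rewrite /= !subr0 => -[/intrP[i iE] /intrP[j jE]].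
by exists i, j; rewrite [p]surjective_pairing iE jE.
Qed.

Lemma centred_int_cells G : sym_skew (0, 0) G -> (0, 0) \in G ->
  centred_skew (int_cells G).
Proof.
move=> [sG symG lat] G0; split.
- by rewrite /int_cells.
- move=> i j k l m n gij gkl mP nP; apply: (skew_convex sG gij gkl);
    by rewrite /= ?ler_int // -rmorphB /= intr_int.
- by move=> i j; rewrite /int_cells !rmorphN; apply: symG.
- move=> i j /exists_sw_corner[p]; rewrite sw_cornerE !pointB /= !subr0.
  case/and3P=> pG; have [k [l pE]] := integral_cell lat pG; rewrite pE /= in pG *.
  move=> n1 n2; rewrite /le_point /= !ler_int => /andP[? ?].
  by exists k, l; split=> //; rewrite /int_cells rmorphB; apply/negP.
move=> Q Q0 Qstep i j gij.
suff /(_ _ gij)[k [l [[/intr_inj -> /intr_inj ->] //]]] : forall q, q \in G ->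
    exists k l : int, q = (k%:~R, l%:~R) /\ Q k l.
apply: (skew_closure sG G0); first by exists 0, 0.
move=> q q' qG q'G [k [l [qE Qkl]]] step; rewrite qE in qG step.
have [k' [l' q'E]] := integral_cell lat q'G; exists k', l'; split=> //.
rewrite q'E in q'G step; apply: (Qstep _ _ _ _ qG q'G Qkl).
have one : 1 = 1%:~R :> rat by [].
by case: step; rewrite /= one -?rmorphD -?rmorphB => -[/intr_inj ? /intr_inj ?];
  [apply: Or41|apply: Or42|apply: Or43|apply: Or44].
Qed.

(** Connectedness gives some neighbour of the origin, and central symmetry moves it to the positive
    side. *)
Lemma neighbour_of_centre G : sym_skew (0, 0) G -> (0, 0) \in G -> G <> [fset (0, 0)]%fset ->
  int_cells G 1 0 \/ int_cells G 0 1.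
Proof.
move=> sG G0 Gn; have cG := centred_int_cells sG G0.
apply: contrapT => /not_orP[n1 n2]; apply: Gn; apply/fsetP => p; rewrite in_fset1.
apply/idP/eqP => [pG|-> //]; have [_ _ lat] := sG.
have [i [j pE]] := integral_cell lat pG; rewrite pE in pG *.
suff [-> ->] : i = 0 /\ j = 0 by [].
apply: (centred_ind cG (Q := fun i j => i = 0 /\ j = 0) _ _ pG) => // a b k l Ga Gk [a0 b0].
rewrite {a}a0 {b}b0 in Ga *; case=> -[kE lE]; rewrite {k}kE {l}lE in Gk *; exfalso.
- exact: n1.
- by apply: n1; have := centred_sym cG Gk; rewrite sub0r opprK oppr0.
- exact: n2.
- by apply: n2; have := centred_sym cG Gk; rewrite sub0r opprK oppr0.
Qed.

Lemma rectangular_of_chain G : skew_diagram G -> centrally_symmetric G -> G <> fset0 ->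
  {in G &, forall p q, le_point p q \/ le_point q p} -> rectangular G.
Proof.
move=> sG symG G0 chain.
have [c sw_c _] := exists_nonpositive_sw_corner sG symG G0.
have [d ne_d _] := exists_nonnegative_ne_corner sG symG G0.
have cG : c \in G by case/and3P: sw_c.
have dG : d \in G by case/and3P: ne_d.
split; apply/eqP/cardfs1P; [exists c|exists d]; apply/fsetP => p; rewrite in_fset1 !in_fsetE /=.
  apply/andP/eqP => [[pG sw_p]|-> //].
  case: (chain p c pG cG) => le; first exact: (sw_corner_minimal sG).
  by apply/esym; apply: (sw_corner_minimal sG).
apply/andP/eqP => [[pG ne_p]|-> //].
case: (chain p d pG dG) => le; first exact: (ne_corner_maximal sG).
by apply/esym; apply: (ne_corner_maximal sG).
Qed.

Definition int_point (i j : int) : point := (i%:~R, j%:~R).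

Let Bex i j : int_point i j - ex = int_point (i - 1) j.
Proof. by rewrite pointB /int_point /= subr0 rmorphB. Qed.

Let Bey i j : int_point i j - ey = int_point i (j - 1).
Proof. by rewrite pointB /int_point /= subr0 rmorphB. Qed.

Let Dex i j : int_point i j + ex = int_point (i + 1) j.
Proof. by rewrite pointD /int_point /= addr0 rmorphD. Qed.

Let Dey i j : int_point i j + ey = int_point i (j + 1).
Proof. by rewrite pointD /int_point /= addr0 rmorphD. Qed.

Let le_int i j k l : le_point (int_point i j) (int_point k l) = (i <= k) && (j <= l).
Proof. by rewrite /le_point /= !ler_int. Qed.

Let int_point_inj i j k l : (int_point i j == int_point k l) = (i == k) && (j == l).
Proof. by rewrite -pair_eqE /pair_eq /= !eqr_int. Qed.

Lemma horizontal_two_homs G D : crossing_homs (int_cells G) (int_cells D) -> two_homs G D.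
Proof.
move=> [a [b [[a0 b1 Ga Db] [Ga1 Ga2] [Db1 Db2] H]]].
exists (int_point (- a) 0), (int_point 0 b).
have ne_d : ne_corner D (int_point 0 b).
  by rewrite ne_cornerE Dex Dey add0r; apply/and3P; split=> //; apply/negP.
have hom0 : corner_hom G D (int_point (- a) 0) (int_point 0 b).
  rewrite /corner_hom ne_d le_int sw_cornerE Bex Bey sub0r.
  by apply/and3P; split=> //; [apply/and3P; split=> //; apply/negP|lia].
case: H => [[x [xa Gx Gx1 Gx0]]|[Ga01 Ga11 Db0 Db10]].
  exists (int_point x 1), (int_point 0 b); split; first exact: hom0.
    by rewrite xpair_eqE !int_point_inj; lia.
  left; rewrite /corner_hom ne_d le_int sw_cornerE Bex Bey subrr.
  by apply/and3P; split=> //; [apply/and3P; split=> //; apply/negP|lia].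
exists (int_point (- a) 0), (int_point 0 (b - 1)); split; first exact: hom0.
  by rewrite xpair_eqE !int_point_inj; lia.
right; left; split; rewrite ?le_int ?(Bey, Dey) ?(Bex, Dex) ?(sub0r, add0r, subrK);
  try by split=> //; apply/negP.
lia.
Qed.

Lemma vertical_two_homs G D :
  crossing_homs (transpose (int_cells G)) (transpose (int_cells D)) -> two_homs G D.
Proof.
rewrite /transpose => -[a [b [[a0 b1 Ga Db] [Ga1 Ga2] [Db1 Db2] H]]].
exists (int_point 0 (- a)), (int_point b 0).
have ne_d : ne_corner D (int_point b 0).
  by rewrite ne_cornerE Dex Dey add0r; apply/and3P; split=> //; apply/negP.
have hom0 : corner_hom G D (int_point 0 (- a)) (int_point b 0).
  rewrite /corner_hom ne_d le_int sw_cornerE Bex Bey sub0r.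
  by apply/and3P; split=> //; [apply/and3P; split=> //; apply/negP|lia].
case: H => [[x [xa Gx Gx1 Gx0]]|[Ga01 Ga11 Db0 Db10]].
  exists (int_point 1 x), (int_point b 0); split; first exact: hom0.
    by rewrite xpair_eqE !int_point_inj; lia.
  left; rewrite /corner_hom ne_d le_int sw_cornerE Bex Bey subrr.
  by apply/and3P; split=> //; [apply/and3P; split=> //; apply/negP|lia].
exists (int_point 0 (- a)), (int_point (b - 1) 0); split; first exact: hom0.
  by rewrite xpair_eqE !int_point_inj; lia.
right; right; split; rewrite ?le_int ?(Bex, Dex) ?(Bey, Dey) ?(sub0r, add0r, subrK);
  try by split=> //; apply/negP.
lia.
Qed.

(** Neither diagram is a point and only the origin is shared, so one diagram has the horizontal
    neighbours of the origin and the other the vertical ones. *)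
Lemma two_homs_nonrectangular G D : sym_skew (0, 0) G -> sym_skew (0, 0) D ->
  (G `&` D = [fset (0, 0)])%fset -> D <> [fset (0, 0)]%fset -> ~ rectangular G ->
  two_homs G D.
Proof.
move=> sG sD GD Dn nrect.
have /fsetIP[G0 D0] : (0, 0) \in (G `&` D)%fset by rewrite GD in_fset1.
have cG := centred_int_cells sG G0; have cD := centred_int_cells sD D0.
have common i j : int_cells G i j -> int_cells D i j -> i = 0 /\ j = 0.
  move=> gij dij; have : (i%:~R, j%:~R) \in (G `&` D)%fset by rewrite in_fsetI; apply/andP.
  rewrite GD in_fset1 -pair_eqE /pair_eq /= !intr_eq0.
  by case/andP=> /eqP -> /eqP ->.
have [[skG symG latG] [skD symD latD]] := (sG, sD).
have Gne : G <> fset0 by move=> GE; rewrite GE in_fset0 in G0.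
(* Applied to a coordinate function: a diagram inside one axis is a chain, hence rectangular. *)
have off (f : int -> int -> int) :
    (forall i j k l : int, f i j = 0 -> f k l = 0 -> (i <= k /\ j <= l) \/ (k <= i /\ l <= j)) ->
    exists i j, int_cells G i j /\ f i j <> 0.
  move=> fP; apply: contrapT => none; apply: nrect; apply: rectangular_of_chain => //.
  have f0 i j : int_cells G i j -> f i j = 0.
    by move=> gij; apply: contrapT => fn; apply: none; exists i, j.
  move=> p q pG qG; have [i [j pE]] := integral_cell latG pG.
  have [k [l qE]] := integral_cell latG qG; rewrite pE qE in pG qG *.
  rewrite /le_point /= !ler_int.
  by case: (fP _ _ _ _ (f0 _ _ pG) (f0 _ _ qG)) => -[-> ->]; [left|right].
have Gn : G <> [fset (0, 0)]%fset.
  move=> GE; apply: nrect; apply: rectangular_of_chain => // p q.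
  by rewrite GE !in_fset1 => /eqP -> /eqP ->; left; rewrite /le_point /= !lexx.
case: (neighbour_of_centre sG G0 Gn) => [G10|G01].
  have nD10 : ~ int_cells D 1 0 by move=> /(common _ _ G10)[].
  have D01 : int_cells D 0 1 by case: (neighbour_of_centre sD D0 Dn).
  have nG01 : ~ int_cells G 0 1 by move=> /common /(_ D01)[].
  apply: horizontal_two_homs; apply: horizontal_crossing => //.
  by apply: (off (fun _ j => j)); lia.
have nD01 : ~ int_cells D 0 1 by move=> /(common _ _ G01)[].
have D10 : int_cells D 1 0 by case: (neighbour_of_centre sD D0 Dn).
have nG10 : ~ int_cells G 1 0 by move=> /common /(_ D10)[].
apply: vertical_two_homs; apply: vertical_crossing => //.
by apply: (off (fun i _ => i)); lia.
Qed.

End IntegralDiagrams.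

(** * Uniqueness of homomorphisms between two diagrams *)

Section ForcedHoms.
Implicit Types (G H : {fset point}) (p q c d u w : point).

Lemma in_fset_filter G (P : pred point) p :
  (p \in [fset x in G | P x]%fset) = (p \in G) && P p.
Proof. by rewrite !in_fsetE. Qed.

(* At most one pair of cells can support a homomorphism between the modules of
   the two diagrams on generators. *)
Definition forced_hom G H := exists p0 q0, forall p q,
  sw_corner G p -> q \in H -> le_point p q ->
  (forall u, u = ex \/ u = ey -> q + u \in H -> p + u \in G) -> p = p0 /\ q = q0.

(** Since the point has no further cell, [q] cannot be continued inside [H] either. So [q] is a
    northeast corner above the origin, and [- q] is the unique southwest corner below it. *)
Lemma forced_hom_point H : centrally_symmetric H -> one_nonpositive_sw_corner H ->
  forced_hom [fset (0, 0)]%fset H.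
Proof.
move=> symH /eqP /cardfs1P[s0 s0E]; exists 0, (- s0) => p q /and3P[+ _ _] qH pq qu.
rewrite in_fset1 => /eqP p0; rewrite p0 in pq qu; split=> //.
suff : - q \in [fset s0]%fset by rewrite in_fset1 => /eqP <-; rewrite opprK.
have out u : u = ex \/ u = ey -> q + u \notin H.
  move=> uE; apply/negP => /(qu u uE); rewrite in_fset1 pointD xpair_eqE /= !add0r.
  by case: uE => -> /=; rewrite ?oner_eq0 ?andbF.
rewrite -s0E in_fset_filter symmetric_mem // qH (sw_cornerN _ symH) ne_cornerE qH.
rewrite !out /=; [|by right|by left].
by move: pq => /andP[/= ? ?]; rewrite !oppr_le0; apply/andP.
Qed.

(** [G] has a least cell [c0] and [H] a greatest cell [d0]. If [q] is not [d0], then [q + u] lies in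
    [H] for some direction [u], hence [c0 + u] in [G]. Reflecting these cells shows that both
    diagrams extend strictly beyond the origin in direction [u], so both contain [u], against the
    intersection being the origin. *)
Lemma forced_hom_rectangular G H : sym_skew (0, 0) G -> sym_skew (0, 0) H ->
  rectangular G -> rectangular H -> (G `&` H = [fset (0, 0)])%fset -> forced_hom G H.
Proof.
move=> [skG symG _] [skH symH _] [/eqP /cardfs1P[c0 c0E] _] [_ /eqP /cardfs1P[d0 d0E]] GH.
have sw_c p : sw_corner G p -> p = c0.
  move=> sw_p; have : p \in [fset c0]%fset.
    by rewrite -c0E in_fset_filter /= sw_p andbT; case/and3P: sw_p.
  by rewrite in_fset1 => /eqP.
have ne_d p : ne_corner H p -> p = d0.
  move=> ne_p; have : p \in [fset d0]%fset.
    by rewrite -d0E in_fset_filter /= ne_p andbT; case/and3P: ne_p.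
  by rewrite in_fset1 => /eqP.
have min_c p : p \in G -> le_point c0 p by move=> /exists_sw_corner[x /sw_c ->].
have max_d p : p \in H -> le_point p d0.
  by move=> /(exists_ne_corner symH)[x /ne_d ->].
have c0G : c0 \in G by have := fset11 c0; rewrite -c0E in_fset_filter => /andP[].
have d0H : d0 \in H by have := fset11 d0; rewrite -d0E in_fset_filter => /andP[].
have /fsetIP[G0 H0] : (0, 0) \in (G `&` H)%fset by rewrite GH in_fset1.
exists c0, d0 => p q /sw_c -> qH pq qu; split=> //.
have common u : u = ex \/ u = ey -> u \in G -> u \in H -> False.
  move=> uE uG uH; have : u \in (G `&` H)%fset by rewrite in_fsetI uG.
  by rewrite GH in_fset1; case: uE => -> /eqP[] /eqP; rewrite oner_eq0.
have ncG : - c0 \in G by rewrite symmetric_mem.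
have nqH : - q \in H by rewrite symmetric_mem.
have le_c : le_point c0 (0, 0) by apply: min_c.
have le_nc : le_point (0, 0) (- c0) by rewrite -le_pointN opprK oppr0.
have le_d : le_point (0, 0) d0 by apply: max_d.
have [sG1 sG2] := skew_step skG G0 ncG le_nc.
have [sH1 sH2] := skew_step skH H0 d0H le_d.
have := max_d _ nqH; have := max_d _ qH; rewrite {1 2}/le_point /= => /andP[q1 q2] /andP[q3 q4].
have below u : u = ex \/ u = ey -> q + u \in H -> le_point c0 (- (c0 + u)).
  by move=> uE /(qu u uE) cu; apply: min_c; rewrite symmetric_mem.
have [st1 st2] := skew_step skH qH d0H (max_d _ qH).
apply/eqP; apply: contraT => ne; exfalso.
have : (q.1 < d0.1) || (q.2 < d0.2).
  move: ne; rewrite [q]surjective_pairing [d0]surjective_pairing xpair_eqE /=.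
  by rewrite !lt_neqAle q1 q2 !andbT negb_and.
case/orP=> lt.
  have [/(below _ (or_introl erefl)) /andP[/= le1 _] _] := st1 lt.
  apply: (common ex (or_introl erefl)); rewrite -[ex]add0r.
    by have [] := sG1 (ltac:(rewrite /=; lra)).
  by have [] := sH1 (ltac:(rewrite /=; lra)).
have [/(below _ (or_intror erefl)) /andP[_ /= le1] _] := st2 lt.
apply: (common ey (or_intror erefl)); rewrite -[ey]add0r.
  by have [] := sG2 (ltac:(rewrite /=; lra)).
by have [] := sH2 (ltac:(rewrite /=; lra)).
Qed.

(** One southwest corner below the origin always exists, so failure of uniqueness gives a second
    one; their opposites are two northeast corners above the point. *)
Lemma two_homs_point H : skew_diagram H -> centrally_symmetric H -> H <> fset0 ->
  ~ one_nonpositive_sw_corner H -> two_homs [fset (0, 0)]%fset H.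
Proof.
move=> sH symH H0 none.
have [s sw_s /[dup] s0 /andP[s1 s2]] := exists_nonpositive_sw_corner sH symH H0.
have [s' [sw_s' s'0 ne]] : exists s', [/\ sw_corner H s', le_point s' 0 & s' != s].
  apply: contrapT => no; apply: none; apply/eqP/cardfs1P; exists s; apply/fsetP => p.
  rewrite in_fset1 in_fset_filter /=; apply/andP/eqP => [[pH /and3P[sw_p p1 p2]]|->].
    by apply: contrapT => /eqP ps; apply: no; exists p; rewrite /le_point p1 p2.
  by rewrite sw_s s1 s2; case/and3P: sw_s.
have hom x : sw_corner H x -> le_point x 0 -> corner_hom [fset (0, 0)]%fset H 0 (- x).
  move=> sw_x x0; rewrite /corner_hom -sw_cornerN // opprK sw_x -le_pointN opprK oppr0 x0.
  rewrite !andbT sw_cornerE !in_fset1; apply/and3P.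
  by split=> //; apply/eqP => -[].
exists 0, (- s), 0, (- s'); split; [exact: hom| |left; exact: hom].
by rewrite xpair_eqE negb_and eqr_opp ne orbT.
Qed.

End ForcedHoms.

(** * Commutants of shift matrices *)

Section Model.
Variables (K : fieldType) (charK : [pchar K] =i pred0) (n : nat).
Variables (L : 'I_n -> 'I_3 * point) (D : 'I_3 -> {fset point}).
Hypothesis (L_inj : injective L).
Hypothesis (L_in : forall i, (L i).2 \in D (L i).1).
Hypothesis (L_onto : forall k p, p \in D k -> exists i, L i = (k, p)).
Hypothesis (D_skew : forall k, skew_diagram (D k)).
Variable cf : point -> point -> K.
Hypothesis cf_neq0 : forall u p, cf u p != 0.

Local Notation comp i := (L i).1.
Local Notation cell i := (L i).2.
Implicit Types (X Y : 'M[K]_n) (i j a b c d : 'I_n) (u w : point).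

Definition dir u := u = ex \/ u = ey.

Definition step u i j := L j == (comp i, cell i + u).

(** Arbitrary nonzero coefficients [cf] cover the signed shifts of types B and D together with the
    unsigned ones. *)
Definition shift_mx u : 'M[K]_n := \matrix_(i, j) (cf u (cell j) *+ step u j i).

Lemma stepP u i j : reflect (comp j = comp i /\ cell j = cell i + u) (step u i j).
Proof.
apply: (iffP eqP) => [->//|[e1 e2]].
by rewrite [LHS]surjective_pairing e1 e2.
Qed.

Lemma step_inj u i i' j : step u i j -> step u i' j -> i = i'.
Proof.
move=> /stepP[c1 p1] /stepP[c2 p2]; apply: L_inj.
rewrite [L i]surjective_pairing [L i']surjective_pairing -c1 -c2.
by congr pair; apply: (addIr u); rewrite -p1 -p2.
Qed.

Lemma step_fun u i j j' : step u i j -> step u i j' -> j = j'.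
Proof. by move=> /eqP e1 /eqP e2; apply: L_inj; rewrite e1 e2. Qed.

Lemma step_exists u i : cell i + u \in D (comp i) -> exists j, step u i j.
Proof. by move=> /L_onto[j jE]; exists j; rewrite /step jE. Qed.

Lemma step_exists_pred u j : cell j - u \in D (comp j) -> exists i, step u i j.
Proof. by move=> /L_onto[i iE]; exists i; rewrite /step iE /= subrK -surjective_pairing. Qed.

Lemma step_mem u i j : step u i j -> cell i + u \in D (comp i).
Proof. by move=> /stepP[<- <-]. Qed.

Lemma step_mem_pred u i j : step u i j -> cell j - u \in D (comp j).
Proof. by move=> /stepP[-> ->]; rewrite addrK. Qed.

Lemma shift_mull u X i j b : step u i j ->
  (shift_mx u *m X) j b = cf u (cell i) * X i b.
Proof.
move=> ij; rewrite mxE (bigD1 i) //= big1 ?addr0 => [|i' ne]; first by rewrite mxE ij.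
rewrite mxE; case: (boolP (step u i' j)) => [/(step_inj ij) e|_]; last by rewrite mul0r.
by rewrite e eqxx in ne.
Qed.

Lemma shift_mull0 u X j b : (forall i, ~~ step u i j) -> (shift_mx u *m X) j b = 0.
Proof. by move=> no; rewrite mxE big1 // => i _; rewrite mxE (negbTE (no i)) mul0r. Qed.

Lemma shift_mulr u X i j a : step u i j ->
  (X *m shift_mx u) a i = X a j * cf u (cell i).
Proof.
move=> ij; rewrite mxE (bigD1 j) //= big1 ?addr0 => [|j' ne]; first by rewrite mxE ij.
rewrite mxE; case: (boolP (step u i j')) => [/(step_fun ij) e|_]; last by rewrite mulr0.
by rewrite e eqxx in ne.
Qed.

Lemma shift_mulr0 u X i a : (forall j, ~~ step u i j) -> (X *m shift_mx u) a i = 0.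
Proof. by move=> no; rewrite mxE big1 // => j _; rewrite mxE (negbTE (no j)) mulr0. Qed.

Definition commutant : {vspace 'M[K]_n} :=
  (lker (ad (shift_mx ex)) :&: lker (ad (shift_mx ey)))%VS.

Lemma commutantP X :
  reflect (forall u, dir u -> shift_mx u *m X = X *m shift_mx u) (X \in commutant).
Proof.
rewrite memv_cap !memv_ker !adE !subr_eq0; apply: (iffP andP) => [[/eqP ? /eqP ?] u [->|->] //|H].
by rewrite !H //; [right|left].
Qed.

(** Compare the entries at [(d', c)] of the two products of [X] with the shift: the left one is
    nonzero, so the right one has a nonzero term. [commutant_bwd] reads the same identity
    backwards. *)
Lemma commutant_fwd X u d c d' : X \in commutant -> dir u -> X d c != 0 -> step u d d' ->
  exists c', step u c c' /\ X d' c' != 0.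
Proof.
move=> /commutantP CX /CX E Xdc dd'.
have nz : (shift_mx u *m X) d' c != 0 by rewrite (shift_mull _ _ dd') mulf_neq0.
have [/existsP[c' cc']|/existsPn no] := boolP [exists c', step u c c']; last first.
  by rewrite E shift_mulr0 ?eqxx in nz.
by exists c'; split=> //; move: nz; rewrite E (shift_mulr _ _ cc') mulf_eq0 negb_or => /andP[].
Qed.

Lemma commutant_bwd X u d' c c' : X \in commutant -> dir u -> X d' c' != 0 -> step u c c' ->
  exists d, step u d d' /\ X d c != 0.
Proof.
move=> /commutantP CX /CX E Xdc cc'.
have nz : (X *m shift_mx u) d' c != 0 by rewrite (shift_mulr _ _ cc') mulf_neq0.
have [/existsP[d dd']|/existsPn no] := boolP [exists d, step u d d']; last first.
  by rewrite -E shift_mull0 ?eqxx in nz.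
by exists d; split=> //; move: nz; rewrite -E (shift_mull _ _ dd') mulf_eq0 negb_or => /andP[].
Qed.

Definition pos i j := le_point (cell j) (cell i).
Definition same i j := comp i == comp j.

Definition block : {vspace 'M[K]_n} := (commutant :&: (supp K pos :&: supp K same))%VS.

(* A nonzero entry whose source has minimal content sits at the north-west end
   of a component of the overlap of the two diagrams. *)
Lemma dim_block_le : (\dim block <= n)%N.
Proof.
pose S := [set dc : 'I_n * 'I_n | [&& pos dc.1 dc.2, same dc.1 dc.2,
  [forall b, ~~ step ex b dc.2] & [forall d, ~~ step ey dc.1 d]]].
have le1 : (\dim block <= #|S|)%N.
  apply: (@dim_le_functionals _ _ _ (fun dc X => X dc.1 dc.2)).
    by move=> dc a X Y; rewrite !mxE.
  move=> X /memv_capP[CX /memv_capP[/suppP Xpos /suppP Xsame]] X0.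
  apply/eqP; apply: contraT => /matrix0Pn[d0 [c0 nz0]].
  (* A move back along [ex] and a move forward along [ey] both lower this content by 1, so neither
     is possible at the minimum. *)
  pose M (dc : 'I_n * 'I_n) := (cell dc.2).1 - (cell dc.2).2.
  case: (@Order.TotalTheory.arg_minP _ _ _ (d0, c0) (fun dc => X dc.1 dc.2 != 0) M nz0).
  case=> d c /= nz min_dc; have := X0 (d, c); rewrite inE /= (Xpos _ _ nz) (Xsame _ _ nz) /=.
  move=> H; case/eqP: (nz); apply: H; apply/andP; split; apply/forallP.
    move=> b; apply/negP => bc; have [d' [_ nz']] := commutant_bwd CX (or_introl erefl) nz bc.
    have := min_dc (d', b) nz'; have /stepP[_ cb] := bc.
    by rewrite /M /= cb /= addr0; lra.
  move=> d'; apply/negP => dd'; have [c' [cc' nz']] := commutant_fwd CX (or_intror erefl) nz dd'.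
  have := min_dc (d', c') nz'; have /stepP[_ cb] := cc'.
  by rewrite /M /= cb /= addr0; lra.
apply: leq_trans le1 _.
(* The pair is encoded by the cell in the column of [d] and the row of [c], which is in the diagram
   by convexity. It determines the pair, since [d] is the top of its column and [c] the left end of
   its row. *)
have corner d c : (d, c) \in S -> exists i, L i = (comp c, ((cell d).1, (cell c).2)).
  rewrite inE /= => /and4P[/andP[le_1 le_2] /eqP sdc _ _]; apply: L_onto.
  have cD := L_in c; have dD := L_in d; rewrite sdc in dD.
  have [i1 i2] := diagram_int (D_skew _) cD dD.
  by apply: (skew_convex (D_skew _) cD dD); rewrite /= ?lexx ?le_1 ?le_2 // subrr rpred0.
have /choice[f fP] : forall dc : 'I_n * 'I_n, exists i,
    dc \in S -> L i = (comp dc.2, ((cell dc.1).1, (cell dc.2).2)).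
  case=> d c; have [/corner[i iE]|_] := boolP ((d, c) \in S); first by exists i.
  by exists d.
have f_inj : {in S &, injective f}.
  case=> [d c] [d' c'] S1 S2 fE; have := fP _ S1; rewrite fE (fP _ S2) /= => -[ec e1 e2].
  move: S1 S2; rewrite !inE /= => /and4P[_ /eqP s1 /forallP n1 /forallP m1].
  case/and4P=> [_ /eqP s2 /forallP n2 /forallP m2].
  have row a b : comp a = comp b -> (cell a).2 = (cell b).2 ->
      (forall i, ~~ step ex i b) -> ~~ ((cell a).1 < (cell b).1).
    move=> ab_comp ab2 nb; apply/negP => lt; have aD := L_in a; rewrite ab_comp in aD.
    have le_ab : le_point (cell a) (cell b) by rewrite /le_point ab2 lexx (ltW lt).
    have [/(_ lt)[_ bD] _] := skew_step (D_skew _) aD (L_in b) le_ab.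
    by have [i ib] := step_exists_pred bD; move: (nb i); rewrite ib.
  have col a b : comp a = comp b -> (cell a).1 = (cell b).1 ->
      (forall i, ~~ step ey a i) -> ~~ ((cell a).2 < (cell b).2).
    move=> ab_comp ab1 na; apply/negP => lt; have aD := L_in a; rewrite ab_comp in aD.
    have le_ab : le_point (cell a) (cell b) by rewrite /le_point ab1 lexx (ltW lt).
    have [_ /(_ lt)[bD _]] := skew_step (D_skew _) aD (L_in b) le_ab.
    by rewrite -ab_comp in bD; have [i ib] := step_exists bD; move: (na i); rewrite ib.
  have ed : comp d = comp d' by rewrite s1 s2 ec.
  congr pair; apply: L_inj; rewrite [LHS]surjective_pairing [RHS]surjective_pairing ?ed ?ec;
    congr pair; rewrite [LHS]surjective_pairing [RHS]surjective_pairing ?e1 ?e2; congr pair.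
    by apply/eqP; rewrite eq_le !leNgt (col d d') ?(col d' d).
  by apply/eqP; rewrite eq_le !leNgt (row c c') ?(row c' c).
rewrite -(card_in_imset f_inj); apply: leq_trans (max_card _) _.
by rewrite card_ord.
Qed.

Definition diagonal : {vspace 'M[K]_n} := supp K (fun i j => i == j).

Definition weight_mx (f : 'I_n -> rat) : 'M[K]_n := diag_mx (\row_i ratr (f i)).

Lemma ad_weight_mx f X i j : ad (weight_mx f) X i j = ratr (f i - f j) * X i j.
Proof.
rewrite adE /weight_mx mul_diag_mx mul_mx_diag !mxE ratrB_char0 // mulrBl.
by congr (_ - _); rewrite mulrC.
Qed.

Lemma ad_weight_shift f u r : (forall i j, step u i j -> f j - f i = r) ->
  ad (weight_mx f) (shift_mx u) = ratr r *: shift_mx u.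
Proof.
move=> fr; apply/matrixP => j i; rewrite ad_weight_mx !mxE.
by case: (boolP (step u i j)) => [/fr ->|_]; rewrite ?mulr0n ?mulr0.
Qed.

Definition weight1 := weight_mx (fun i => (cell i).1).
Definition weight2 := weight_mx (fun i => (cell i).2).

Lemma weight1_ex : ad weight1 (shift_mx ex) = shift_mx ex.
Proof.
rewrite (ad_weight_shift (r := 1)) ?ratr1_char0 ?scale1r // => i j /stepP[_ ->] /=.
by rewrite addrAC subrr add0r.
Qed.

Lemma weight1_ey : ad weight1 (shift_mx ey) = 0.
Proof.
rewrite (ad_weight_shift (r := 0)) ?(ratr_nat K 0) ?scale0r // => i j /stepP[_ ->] /=.
by rewrite addr0 subrr.
Qed.

Lemma weight2_ex : ad weight2 (shift_mx ex) = 0.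
Proof.
rewrite (ad_weight_shift (r := 0)) ?(ratr_nat K 0) ?scale0r // => i j /stepP[_ ->] /=.
by rewrite addr0 subrr.
Qed.

Lemma weight2_ey : ad weight2 (shift_mx ey) = shift_mx ey.
Proof.
rewrite (ad_weight_shift (r := 1)) ?ratr1_char0 ?scale1r // => i j /stepP[_ ->] /=.
by rewrite addrAC subrr add0r.
Qed.

Hypothesis shift_comm : ad (shift_mx ex) (shift_mx ey) = 0.
Hypothesis shift_nil : forall u, dir u -> exists k, iter k (mulmx (shift_mx u)) 1%:M = 0.

(** Diagonal matrices have weight 0, so the degree filtration applies inside any [U] stable under
    the shifts; it will be used for the skew and for the symmetric matrices separately. *)
Lemma dim_diagonal_le (U : {vspace 'M[K]_n}) :
  (forall u X, dir u -> X \in U -> ad (shift_mx u) X \in U) ->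
  (\dim (U :&: diagonal) <= \dim (commutant :&: (supp K pos :&: U)))%N.
Proof.
move=> stU.
have dirx : dir ex by left.
have diry : dir ey by right.
have hT f X : X \in (U :&: diagonal)%VS -> ad (weight_mx f) X = 0.
  move=> /memv_capP[_ /suppP Xd]; apply/matrixP => i j; rewrite ad_weight_mx mxE.
  have [->|/Xd /eqP ->] := eqVneq (X i j) 0; first by rewrite mulr0.
  by rewrite subrr (ratr_nat K 0) mul0r.
have itU u k X : dir u -> X \in U -> iter k (ad (shift_mx u)) X \in U.
  by move=> du XU; elim: k => //= k; apply: stU.
apply: (@dim_le_top_degree _ charK _ (ad (shift_mx ex)) (ad (shift_mx ey))
  (ad weight1) (ad weight2)).
- by move=> X; rewrite ad_jacobi shift_comm ad0l add0r.
- by move=> X; rewrite ad_jacobi weight1_ex addrC.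
- by move=> X; rewrite ad_jacobi weight1_ey ad0l add0r.
- by move=> X; rewrite ad_jacobi weight2_ex ad0l add0r.
- by move=> X; rewrite ad_jacobi weight2_ey addrC.
- by move=> X; apply: hT.
- by move=> X; apply: hT.
- have [kx nx] := shift_nil dirx; have [ky ny] := shift_nil diry.
  exists (kx + kx + (ky + ky))%N => X i j XT ij.
  have [le_i|lt_i] := leqP (kx + kx) i.
    by rewrite -(subnK le_i) addnC iterD (ad_nilpotent nx).
  have le_j : (ky + ky <= j)%N by lia.
  rewrite -(subnK le_j) addnC (iterD (ky + ky)) (ad_nilpotent ny).
  by elim: (i) => //= k ->; rewrite linear0.
move=> X i j /memv_capP[XU _]; set Q := iter i _ _ => E1 E2 H1 H2.
apply/memv_capP; split; first by apply/memv_capP; rewrite !memv_ker E1 E2.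
apply/memv_capP; split; last by apply: (itU) => //; apply: itU.
(* An entry of a vector of weight [m] raises the coordinate [f] by exactly [m]. *)
have wt f m : ad (weight_mx f) Q = m%:R *: Q -> forall a b, Q a b != 0 -> f b <= f a.
  move=> HQ a b Qab; have := congr1 (fun Y : 'M_n => Y a b) HQ; rewrite ad_weight_mx mxE.
  move/(mulIf Qab); rewrite -(ratr_nat K m) => /(ratr_inj_char0 charK) fm.
  by rewrite -subr_ge0 fm ler0n.
by apply/suppP => a b Qab; rewrite /pos /le_point (wt _ _ H1) ?(wt _ _ H2).
Qed.

Lemma shift_same u : shift_mx u \in supp K same.
Proof.
apply/suppP => i j; rewrite mxE; case: (boolP (step u j i)) => [/stepP[e _] _|_].
  by rewrite /same e.
by rewrite mulr0n eqxx.
Qed.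

(** The identity belongs to [block] but has nonzero trace, so the traceless part is a proper
    subspace. *)
Lemma dim_sl_le : (forall i j, comp i = comp j) -> (0 < n)%N ->
  (\dim (commutant :&: (supp K pos :&: sl_alg K n)) < n)%N.
Proof.
move=> one n0; apply: leq_trans _ dim_block_le; rewrite ltnNge; apply/negP => le.
have sub : (commutant :&: (supp K pos :&: sl_alg K n) <= block)%VS.
  apply/subvP => X /memv_capP[XC /memv_capP[Xp _]]; apply/memv_capP; split=> //.
  by apply/memv_capP; split=> //; apply/suppP => i j _; rewrite /same (one i j).
have /eqP E : (commutant :&: (supp K pos :&: sl_alg K n) == block)%VS by rewrite eqEdim sub.
have : 1%:M \in block.
  apply/memv_capP; split; first by apply/commutantP => u _; rewrite mulmx1 mul1mx.
  have diag1 (R : rel 'I_n) : (forall i, R i i) -> 1%:M \in supp K R.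
    move=> Rii; apply/suppP => i j; rewrite mxE.
    by have [->//|_] := eqVneq i j; rewrite mulr0n eqxx.
  by apply/memv_capP; split; apply: diag1 => i; rewrite /pos /same /le_point ?lexx ?eqxx.
rewrite -E => /memv_capP[_ /memv_capP[_]]; rewrite mem_sl_alg mxtrace1.
by rewrite ((pcharf0P K).1 charK) -leqn0 leqNgt n0.
Qed.

(** * Skew and symmetric matrices for the form of the model *)

Section Form.
Variables (J : 'M[K]_n) (eta : K).
Hypotheses (JT : J^T = eta *: J) (eta2 : eta * eta = 1) (JJ : J *m J = eta%:M).
Hypothesis J_supp : forall i j, J i j != 0 -> L j = (comp i, - cell i).
Hypothesis shift_skew : forall u, dir u -> shift_mx u \in skew_alg J.

Let Ju : J \in unitmx.
Proof.
have : (eta *: J) *m J = 1%:M by rewrite -scalemxAl JJ scale_scalar_mx eta2.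
by case/mulmx1_unit.
Qed.

(** The central reflection of cells, on indices. The default value is never reached, because [J]
    pairs every index with its reflection. *)
Definition neg_index i := odflt i [pick j | L j == (comp i, - cell i)].

Lemma J_partner i : exists j, [/\ J i j != 0, J j i != 0 & L j = (comp i, - cell i)].
Proof.
have eta0 : eta != 0.
  by apply/eqP => e0; move: eta2; rewrite e0 mul0r => /esym/eqP; rewrite oner_eq0.
have : (J *m J) i i != 0 by rewrite JJ mxE eqxx mulr1n.
rewrite mxE => nz; have [/existsP[j nzj]|/existsPn no] := boolP [exists j, J i j * J j i != 0].
  by exists j; move: nzj; rewrite mulf_eq0 negb_or => /andP[n1 n2]; split=> //; apply: J_supp.
by case/eqP: nz; apply: big1 => j _; apply/eqP; rewrite -[_ == 0]negbK no.
Qed.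

Lemma neg_indexE i : L (neg_index i) = (comp i, - cell i).
Proof.
rewrite /neg_index; case: pickP => [j /eqP //|no].
by have [j [_ _ jE]] := J_partner i; have := no j; rewrite jE eqxx.
Qed.

Lemma neg_indexP i j : J i j != 0 -> j = neg_index i.
Proof. by move=> /J_supp jE; apply: L_inj; rewrite jE neg_indexE. Qed.

Lemma J_neg_neq0 i : J i (neg_index i) != 0.
Proof. by have [j [nz _ _]] := J_partner i; rewrite -(neg_indexP nz). Qed.

Lemma neg_indexK : involutive neg_index.
Proof.
by move=> i; apply: L_inj; rewrite !neg_indexE /= opprK -surjective_pairing.
Qed.

Lemma J_mull X i b : (J *m X) i b = J i (neg_index i) * X (neg_index i) b.
Proof.
rewrite mxE (bigD1 (neg_index i)) //= big1 ?addr0 // => j ne.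
by have [->|/neg_indexP e] := eqVneq (J i j) 0; [rewrite mul0r|rewrite e eqxx in ne].
Qed.

Lemma J_mulr X a j : (X *m J) a j = X a (neg_index j) * J (neg_index j) j.
Proof.
rewrite mxE (bigD1 (neg_index j)) //= big1 ?addr0 // => k ne.
have [->|/neg_indexP e] := eqVneq (J k j) 0; first by rewrite mulr0.
by rewrite e neg_indexK eqxx in ne.
Qed.

Definition sym_alg : {vspace 'M[K]_n} := lker (linfun (mulmxr J \o trmx) - linfun (mulmx J)).

Lemma mem_sym_alg X : (X \in sym_alg) = (X^T *m J == J *m X).
Proof. by rewrite memv_ker add_lfunE opp_lfunE !lfunE subr_eq0. Qed.

Lemma ad_skew_sym X Y : X \in skew_alg J -> Y \in sym_alg -> ad X Y \in sym_alg.
Proof.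
rewrite mem_skew_alg !mem_sym_alg addr_eq0 adE linearB /= !trmx_mul mulmxBl mulmxBr.
move=> /eqP XJ /eqP YJ; rewrite -!mulmxA XJ YJ !mulmxN !mulmxA XJ YJ mulNmx.
by rewrite opprK -!mulmxA addrC.
Qed.

(** Lexicographic positivity, which selects one point out of each pair of opposite nonzero
    points. *)
Definition positive (p : point) := (0 < p.1) || (p.1 == 0) && (0 < p.2).

Definition positive_cells := [set i | positive (cell i)].

Let neg_cells := [set i | positive (- cell i)].

Let card_neg : #|neg_cells| = #|positive_cells|.
Proof.
rewrite -(card_imset _ (inv_inj neg_indexK)); congr #|pred_of_set _|.
apply/setP => i; rewrite -{1}[i]neg_indexK mem_imset ?inE; last exact: inv_inj neg_indexK.
by rewrite neg_indexE /= opprK.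
Qed.

Lemma card_positive_cells : (2 * #|positive_cells| + #|[set i | cell i == 0%R]| = n)%N.
Proof.
have := card_ord n; rewrite -(cardsC positive_cells) => nE.
have : ~: positive_cells = neg_cells :|: [set i | cell i == 0].
  apply/setP => i; rewrite !inE /positive -pair_eqE /pair_eq /= oppr_gt0 oppr_eq0 oppr_gt0.
  by case: (ltgtP (cell i).1 0); case: (ltgtP (cell i).2 0).
move=> cE; have disj : [disjoint neg_cells & [set i | cell i == 0]].
  rewrite disjoints_subset; apply/subsetP => i; rewrite !inE /positive -pair_eqE /pair_eq /=.
  by rewrite oppr_gt0 oppr_eq0 oppr_gt0; case: (ltgtP (cell i).1 0); case: (ltgtP (cell i).2 0).
move: nE; rewrite cE cardsU; move: disj; rewrite -setI_eq0 => /eqP ->; rewrite cards0 card_neg.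
by lia.
Qed.

(** Diagonal entries of a skew matrix at opposite cells are opposite, and those at the origin vanish
    as 2 is invertible; the positive cells determine the rest. *)
Lemma dim_skew_diagonal : (\dim (skew_alg J :&: diagonal) <= #|positive_cells|)%N.
Proof.
apply: (@dim_le_functionals _ _ _ (fun i X => X i i)); first by move=> i a X Y; rewrite !mxE.
move=> X /memv_capP[]; rewrite mem_skew_alg addr_eq0 => /eqP XJ /[dup] Xdiag /suppP Xd X0.
have rel i : X i i = - X (neg_index i) (neg_index i).
  have := congr1 (fun Y : 'M_n => Y i (neg_index i)) XJ; rewrite J_mulr neg_indexK
    [in LHS]mxE [RHS]mxE J_mull.
  by rewrite [J _ _ * _]mulrC -mulNr => /(mulIf (J_neg_neq0 i)).
apply/matrixP => i j; rewrite mxE; apply/eqP; apply: contraT => /[dup] nz /Xd /eqP ij.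
rewrite -{j}ij in nz; case/eqP: nz.
case: (boolP (positive (cell i))) => [p|np]; first by apply: X0; rewrite inE.
case: (boolP (positive (- cell i))) => [p|np'].
  by rewrite rel X0 ?oppr0 // inE neg_indexE.
have c0 : cell i = 0.
  move: np np'; rewrite /positive /= oppr_gt0 oppr_eq0 oppr_gt0.
  case: (ltgtP (cell i).1 0) => // e1; case: (ltgtP (cell i).2 0) => // e2 _ _.
  by rewrite [cell i]surjective_pairing e1 e2.
have ni : neg_index i = i.
  by apply: L_inj; rewrite neg_indexE c0 oppr0 -c0 -surjective_pairing.
have := rel i; rewrite ni => /eqP; rewrite -addr_eq0 -mulr2n -mulr_natr mulf_eq0.
by rewrite ((pcharf0P K).1 charK) orbF => /eqP.
Qed.

Lemma dim_sym_diagonal : (\dim (sym_alg :&: diagonal) <= n - #|positive_cells|)%N.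
Proof.
rewrite -card_neg -[n in (n - _)%N]card_ord -[#|'I_n|](cardsC neg_cells) addKn.
apply: (@dim_le_functionals _ _ _ (fun i X => X i i)); first by move=> i a X Y; rewrite !mxE.
move=> X /memv_capP[]; rewrite mem_sym_alg => /eqP XJ /[dup] Xdiag /suppP Xd X0.
have rel i : X i i = X (neg_index i) (neg_index i).
  have := congr1 (fun Y : 'M_n => Y i (neg_index i)) XJ; rewrite J_mulr J_mull neg_indexK
    [in LHS]mxE.
  by rewrite [J _ _ * _]mulrC => /(mulIf (J_neg_neq0 i)).
apply/matrixP => i j; rewrite mxE; apply/eqP; apply: contraT => /[dup] nz /Xd /eqP ij.
rewrite -{j}ij in nz; case/eqP: nz.
case: (boolP (positive (- cell i))) => p; last by apply: X0; rewrite !inE.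
rewrite rel X0 // !inE neg_indexE /= opprK; move: p; rewrite /positive /=.
by rewrite oppr_gt0 oppr_eq0 oppr_gt0; case: (ltgtP (cell i).1 0); case: (ltgtP (cell i).2 0).
Qed.

Let two_neq0 : 2%:R != 0 :> K.
Proof. by rewrite ((pcharf0P K).1 charK). Qed.

Let skew_sym_cap X : X \in skew_alg J -> X \in sym_alg -> X = 0.
Proof.
rewrite mem_skew_alg mem_sym_alg addr_eq0 => /eqP -> /eqP XJ.
have : 2%:R *: (J *m X) = 0.
  by rewrite scaler_nat mulr2n -{1}XJ addNr.
move/eqP; rewrite scaler_eq0 (negbTE two_neq0) => /eqP JX0.
by rewrite -(mulKmx Ju X) JX0 mulmx0.
Qed.

Let dim_diagonal : (n <= \dim (skew_alg J :&: diagonal) + \dim (sym_alg :&: diagonal))%N.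
Proof.
have dn : (n <= \dim diagonal)%N.
  rewrite -[n in (n <= _)%N]card_ord -cardsT.
  apply: (@dim_ge_dual_family _ _ _ (fun i X => X i i) _ _ _ (fun i => delta_mx i i)).
  - by move=> i a X Y; rewrite !mxE.
  - move=> i _; apply/suppP => a b; rewrite mxE; case: andP => [[/eqP -> /eqP ->]|] //.
    by rewrite eqxx.
  - by move=> i j _ _; rewrite mxE andbb ((pcharf0P K).1 charK) eqb0.
apply: leq_trans dn _; rewrite -dimv_sum_cap; apply: leq_trans _ (leq_addr _ _).
apply: dimvS; apply/subvP => X Xd.
(* The adjoint of [X] for the form, since [eta *: J] is the inverse of [J]. *)
pose Y := eta *: (J *m X^T *m J).
have YT : Y^T *m J = J *m X.
  rewrite /Y linearZ /= !trmx_mul trmxK JT -!(scalemxAl, scalemxAr) !scalerA -!mulmxA JJ.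
  by rewrite mul_mx_scalar -scalemxAr scalerA eta2 mul1r eta2 scale1r.
have JY : J *m Y = X^T *m J.
  by rewrite /Y -scalemxAr !mulmxA JJ mul_scalar_mx -scalemxAl scalerA eta2 scale1r.
have Yd : Y \in diagonal.
  apply/suppP => i j; rewrite mxE J_mulr J_mull mxE => nz.
  have : X (neg_index j) (neg_index i) != 0.
    by apply: contraNneq nz => ->; rewrite mulr0 mul0r mulr0.
  by move/suppP: Xd => Xd /Xd /eqP /(inv_inj neg_indexK) ->.
have -> : X = 2%:R^-1 *: (X - Y) + 2%:R^-1 *: (X + Y).
  by rewrite -scalerDr addrACA addNr addr0 -mulr2n -scaler_nat scalerA mulVf ?scale1r.
apply: memv_add; apply: memvZ; apply/memv_capP;
  (split; last by [apply: memvB|apply: memvD]).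
  rewrite mem_skew_alg linearB /= mulmxBl mulmxBr YT JY.
  by rewrite addrA subrK subrr.
by rewrite mem_sym_alg linearD /= mulmxDl mulmxDr YT JY addrC.
Qed.

(** Let [a], [b] be the dimensions of the skew and symmetric blocks, [a0], [b0] those of the skew
    and symmetric diagonal matrices, and [p] the number of positive cells. Then [a0 <= a],
    [b0 <= b], [a + b <= n <= a0 + b0], [a0 <= p] and [b0 <= n - p], so that [a = p]. *)
Lemma dim_skew_block :
  \dim (commutant :&: (supp K pos :&: (supp K same :&: skew_alg J))) = #|positive_cells|.
Proof.
have st u X : dir u -> X \in supp K same -> ad (shift_mx u) X \in supp K same.
  by move=> _; apply: supp_ad; apply: shift_same.
have l1 := @dim_diagonal_le (supp K same :&: skew_alg J) _.
have l2 := @dim_diagonal_le (supp K same :&: sym_alg) _.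
have {l1} l1 : (\dim (skew_alg J :&: diagonal) <=
    \dim (commutant :&: (supp K pos :&: (supp K same :&: skew_alg J))))%N.
  apply: leq_trans (l1 _); last first.
    move=> u X du /memv_capP[Xs Xk]; apply/memv_capP; split; first exact: st.
    exact: (skew_alg_ad (shift_skew du) Xk).
  apply: dimvS; apply/subvP => X /memv_capP[Xk Xd]; apply/memv_capP; split=> //.
  apply/memv_capP; split=> //; apply: (subvP (sub_supp _ _)) Xd => i j /eqP ->.
  by rewrite /same.
have {l2} l2 : (\dim (sym_alg :&: diagonal) <=
    \dim (commutant :&: (supp K pos :&: (supp K same :&: sym_alg))))%N.
  apply: leq_trans (l2 _); last first.
    move=> u X du /memv_capP[Xs Xk]; apply/memv_capP; split; first exact: st.
    exact: (ad_skew_sym (shift_skew du) Xk).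
  apply: dimvS; apply/subvP => X /memv_capP[Xk Xd]; apply/memv_capP; split=> //.
  apply/memv_capP; split=> //; apply: (subvP (sub_supp _ _)) Xd => i j /eqP ->.
  by rewrite /same.
have le_sum : (\dim (commutant :&: (supp K pos :&: (supp K same :&: skew_alg J))) +
    \dim (commutant :&: (supp K pos :&: (supp K same :&: sym_alg))) <= n)%N.
  rewrite -dimv_disjoint_sum; last first.
    apply/eqP; rewrite -subv0; apply/subvP => X.
    move=> /memv_capP[/memv_capP[_ /memv_capP[_ /memv_capP[_ X1]]]].
    by move=> /memv_capP[_ /memv_capP[_ /memv_capP[_ X2]]]; rewrite memv0 (skew_sym_cap X1 X2).
  apply: leq_trans dim_block_le; apply: dimvS; rewrite subv_add.
  by apply/andP; split; apply/subvP => X /memv_capP[XC /memv_capP[Xp /memv_capP[Xs _]]];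
    apply/memv_capP; split=> //; apply/memv_capP.
have := dim_diagonal; have := dim_skew_diagonal; have := dim_sym_diagonal.
have : (#|positive_cells| <= n)%N by rewrite -[n in (_ <= n)%N]card_ord; apply: max_card.
lia.
Qed.

Definition off : {vspace 'M[K]_n} := (commutant :&: (supp K pos :&:
  (skew_alg J :&: supp K (fun i j => comp i != comp j))))%VS.

Lemma J_same : J \in supp K same.
Proof. by apply/suppP => i j /J_supp; rewrite /same => ->. Qed.

(** The shifts and [J] preserve the diagrams, so keeping only the entries inside diagrams respects
    both commutation and skewness. *)
Lemma dim_skew_split :
  (\dim (commutant :&: (supp K pos :&: skew_alg J)) = #|positive_cells| + \dim off)%N.
Proof.
rewrite -dim_skew_block -dimv_disjoint_sum; last first.
  apply/eqP; rewrite -subv0; apply/subvP => X.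
  case/memv_capP => /memv_capP[_ /memv_capP[_ /memv_capP[/suppP Xs _]]].
  case/memv_capP => _ /memv_capP[_ /memv_capP[_ /suppP Xo]]; rewrite memv0.
  by apply: contraT => /matrix0Pn[i [j nz]]; have := Xo _ _ nz; rewrite [comp i == _](Xs _ _ nz).
congr (\dim _); apply/vspaceP => X; apply/idP/idP; last first.
  move: X; apply/subvP; rewrite subv_add; apply/andP.
  split; apply/subvP => X /memv_capP[XC /memv_capP[Xp /memv_capP[X1 X2]]];
    by apply/memv_capP; split=> //; apply/memv_capP.
case/memv_capP => /commutantP XC /memv_capP[/suppP Xp Xk].
have XE : maskmx (fun i j => ~~ same i j) X = X - maskmx same X.
  by rewrite -{2}(maskC same X) addrAC subrr add0r.
have mC : maskmx same X \in commutant.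
  apply/commutantP => u du; rewrite -mask_mulmxl ?shift_same // -mask_mulmxr ?shift_same //.
  by rewrite XC.
have mk : maskmx same X \in skew_alg J.
  move: Xk; rewrite !mem_skew_alg -mask_tr -mask_mulmxl ?J_same // -mask_mulmxr ?J_same //.
  by rewrite -linearD /= => /eqP ->; rewrite linear0.
have mp R : maskmx R X \in supp K pos.
  by apply/suppP => i j; rewrite mxE; case: (R i j) => [/Xp //|]; rewrite mulr0n eqxx.
rewrite -(maskC same X); apply: memv_add.
  by apply/memv_capP; split=> //; apply/memv_capP; split=> //; apply/memv_capP; rewrite mask_supp.
apply/memv_capP; split; first by rewrite XE; apply: memvB => //; apply/commutantP.
apply/memv_capP; split; first exact: mp.
apply/memv_capP; split; first by rewrite XE; apply: memvB.
exact: mask_supp.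
Qed.

(** Subtract from [Y] its adjoint [S]. As [k != m], the adjoint lives in the transposed block and
    leaves the entries of [Y] untouched; reflection preserves the sign of the weight. *)
Lemma skew_extension k m Y : k != m -> Y \in commutant -> Y \in supp K pos ->
  (forall i j, Y i j != 0 -> comp i = m /\ comp j = k) ->
  exists2 X, X \in off & (forall i j, comp i = m -> comp j = k -> X i j = Y i j) /\
    (forall i j, X i j != 0 -> (comp i = m /\ comp j = k) \/ (comp i = k /\ comp j = m)).
Proof.
move=> km /commutantP YC /suppP Yp Ykm; pose S := eta *: (J *m Y^T *m J).
have SE i j : S i j = eta * (J i (neg_index i) * Y (neg_index j) (neg_index i) * J (neg_index j) j).
  by rewrite mxE J_mulr J_mull mxE.
have nzS i j : S i j != 0 -> Y (neg_index j) (neg_index i) != 0.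
  by apply: contraNneq => Y0; rewrite SE Y0 mulr0 mul0r mulr0.
have Skm i j : S i j != 0 -> comp i = k /\ comp j = m.
  by move=> /nzS /Ykm; rewrite !neg_indexE /= => -[].
have Sp : S \in supp K pos.
  apply/suppP => i j /nzS /Yp; rewrite /pos !neg_indexE /=.
  by rewrite -[le_point (cell j) _]le_pointN.
have SC : S \in commutant.
  apply/commutantP => u du; have := shift_skew du; rewrite mem_skew_alg addr_eq0 => /eqP AJ.
  set A := shift_mx u in AJ *.
  have JA : J *m A^T = - (A *m J).
    have : J *m (A^T *m J) *m J = - (J *m (J *m A) *m J) by rewrite AJ mulmxN mulNmx.
    rewrite -!mulmxA JJ !mulmxA JJ mul_scalar_mx -!mulmxA mul_mx_scalar -!scalemxAr -scalemxAl.
    rewrite -scalerN => /(congr1 (fun Z => eta *: Z)).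
    by rewrite !scalerA eta2 !scale1r.
  rewrite /S -scalemxAr -scalemxAl; congr (_ *: _).
  have AJ' : A *m J = - (J *m A^T) by rewrite JA opprK.
  have JA' : J *m A = - (A^T *m J) by rewrite AJ opprK.
  rewrite !mulmxA AJ' !mulNmx -[X in _ = X]mulmxA JA' mulmxN; congr (- _).
  rewrite !mulmxA; congr (_ *m J); rewrite -!mulmxA; congr (J *m _).
  by rewrite -!trmx_mul YC.
have JS : J *m S = Y^T *m J.
  by rewrite /S -scalemxAr !mulmxA JJ mul_scalar_mx -scalemxAl scalerA eta2 scale1r.
have SJ : S^T *m J = J *m Y.
  rewrite /S linearZ /= !trmx_mul trmxK JT -!(scalemxAl, scalemxAr) !scalerA -!mulmxA JJ.
  by rewrite mul_mx_scalar -scalemxAr scalerA eta2 mul1r eta2 scale1r.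
have XE i j : (Y - S) i j = Y i j - S i j by rewrite !mxE.
have Xnz i j : (Y - S) i j != 0 ->
    (comp i = m /\ comp j = k) \/ (comp i = k /\ comp j = m).
  have [Y0|/Ykm] := eqVneq (Y i j) 0; last by left.
  by rewrite XE Y0 sub0r oppr_eq0 => /Skm; right.
exists (Y - S).
  apply/memv_capP; split; first by apply: memvB => //; apply/commutantP.
  apply/memv_capP; split; first by apply: memvB => //; apply/suppP.
  apply/memv_capP; split.
    by rewrite mem_skew_alg linearB /= mulmxBl mulmxBr JS SJ addrA subrK subrr.
  by apply/suppP => i j /Xnz[] [-> ->]; rewrite // eq_sym.
split=> // i j im jk; rewrite XE; have [->|/Skm[ik _]] := eqVneq (S i j) 0; first by rewrite subr0.
by move: km; rewrite -ik -im eqxx.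
Qed.

Lemma shift_delta u d d' c : step u d d' ->
  shift_mx u *m delta_mx d c = cf u (cell d) *: delta_mx d' c.
Proof.
move=> dd'; apply/matrixP => a b; rewrite [RHS]mxE.
have [/existsP[i ia]|/existsPn no] := boolP [exists i, step u i a]; last first.
  rewrite shift_mull0 // mxE; case: (eqVneq a d') => [e|_]; last by rewrite mulr0.
  by have := no d; rewrite e dd'.
rewrite (shift_mull _ _ ia) !mxE.
have -> : (i == d) = (a == d').
  by apply/eqP/eqP => e; rewrite e in ia; [apply: step_fun ia dd'|apply: step_inj ia dd'].
by case: (eqVneq a d') => [e|_]; rewrite ?mulr0 //; rewrite e in ia; rewrite (step_inj ia dd').
Qed.

Lemma shift_delta0 u d c : (forall a, ~~ step u d a) -> shift_mx u *m delta_mx d c = 0.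
Proof.
move=> no; apply/matrixP => a b; rewrite [RHS]mxE.
have [/existsP[i ia]|/existsPn no'] := boolP [exists i, step u i a]; last exact: shift_mull0.
rewrite (shift_mull _ _ ia) mxE; case: (eqVneq i d) => [e|_]; last by rewrite mulr0.
by have := no a; rewrite -e ia.
Qed.

Lemma delta_shift u d b c : step u b c ->
  delta_mx d c *m shift_mx u = cf u (cell b) *: delta_mx d b.
Proof.
move=> bc; apply/matrixP => a i; rewrite [RHS]mxE.
have [/existsP[j ij]|/existsPn no] := boolP [exists j, step u i j]; last first.
  rewrite shift_mulr0 // mxE; case: (eqVneq i b) => [e|_]; last by rewrite andbF mulr0.
  by have := no c; rewrite e bc.
rewrite (shift_mulr _ _ ij) !mxE.
have -> : (j == c) = (i == b).
  by apply/eqP/eqP => e; rewrite e in ij; [apply: step_inj ij bc|apply: step_fun ij bc].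
by case: (eqVneq i b) => [->|_]; rewrite ?andbF ?mulr0 ?mul0r // mulrC.
Qed.

Lemma delta_shift0 u d c : (forall b, ~~ step u b c) -> delta_mx d c *m shift_mx u = 0.
Proof.
move=> no; apply/matrixP => a i; rewrite [RHS]mxE.
have [/existsP[j ij]|/existsPn no'] := boolP [exists j, step u i j]; last exact: shift_mulr0.
rewrite (shift_mulr _ _ ij) mxE; case: (eqVneq j c) => [e|_]; last by rewrite andbF mul0r.
by have := no i; rewrite -e ij.
Qed.

Lemma no_step u d a : cell d + u \notin D (comp d) -> ~~ step u d a.
Proof. by apply: contra => /step_mem. Qed.

Lemma no_step_pred u b c : cell c - u \notin D (comp c) -> ~~ step u b c.
Proof. by apply: contra => /step_mem_pred. Qed.

Lemma corner_hom_off k m p q : k != m -> corner_hom (D k) (D m) p q ->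
  exists X c d, [/\ X \in off, L c = (k, p) /\ L d = (m, q),
    forall i j, comp i = m -> comp j = k -> X i j = ((i == d) && (j == c))%:R &
    forall i j, X i j != 0 -> (comp i = m /\ comp j = k) \/ (comp i = k /\ comp j = m)].
Proof.
move=> km /and3P[]; rewrite sw_cornerE ne_cornerE => /and3P[pk p1 p2] /and3P[qm q1 q2] pq.
have [c cE] := L_onto pk; have [d dE] := L_onto qm.
have nd u a : dir u -> ~~ step u d a by move=> [->|->]; rewrite no_step ?dE.
have nc u b : dir u -> ~~ step u b c by move=> [->|->]; rewrite no_step_pred ?cE.
have YC : delta_mx d c \in commutant.
  apply/commutantP => u du; rewrite shift_delta0 => [|a]; last exact: nd.
  by rewrite delta_shift0 // => b; apply: nc.
have nzY (i j : 'I_n) : (delta_mx d c : 'M[K]_n) i j != 0 -> i = d /\ j = c.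
  by rewrite mxE; case: andP => [[/eqP -> /eqP ->]|_] //; rewrite eqxx.
have [||X Xo [XY Xnz]] := skew_extension km YC.
- by apply/suppP => i j /nzY[-> ->]; rewrite /pos dE cE.
- by move=> i j /nzY[-> ->]; rewrite dE cE.
by exists X, c, d; split=> // i j im jk; rewrite XY // mxE.
Qed.

Lemma domino_hom_off k m p q u w : k != m -> (forall v, dir v -> v = u \/ v = w) ->
  domino_hom (D k) (D m) p q u w ->
  exists X c d, [/\ X \in off, L c = (k, p), L d = (m, q) & X d c != 0].
Proof.
move=> km dirE [[pk puk qm qum] pq [n1 n2 n3] [n4 n5 n6]].
have [c cE] := L_onto pk; have [d dE] := L_onto qm.
have [c' c'E] := L_onto puk; have [d' d'E] := L_onto qum.
have cc' : step u c c' by rewrite /step c'E cE.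
have dd' : step u d d' by rewrite /step d'E dE.
(* The coefficients are crosswise: the shift after the first unit contributes [cf u q], the shift
   before the second one [cf u p], so both products equal [cf u p * cf u q] times the unit at
   [(d', c)]. *)
pose Y := cf u p *: delta_mx d c + cf u q *: delta_mx d' c' : 'M[K]_n.
have YC : Y \in commutant.
  have nc b : ~~ step u b c by rewrite no_step_pred ?cE.
  have nd' a : ~~ step u d' a by rewrite no_step ?d'E.
  have wc b : ~~ step w b c by rewrite no_step_pred ?cE.
  have wc' b : ~~ step w b c' by rewrite no_step_pred ?c'E.
  have wd a : ~~ step w d a by rewrite no_step ?dE.
  have wd' a : ~~ step w d' a by rewrite no_step ?d'E.
  apply/commutantP => v /dirE[] ->; rewrite mulmxDl mulmxDr -!scalemxAl -!scalemxAr.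
    rewrite (shift_delta _ dd') (delta_shift _ cc') (shift_delta0 _ nd') (delta_shift0 _ nc).
    by rewrite !scaler0 addr0 add0r cE dE !scalerA mulrC.
  rewrite (shift_delta0 _ wd) (shift_delta0 _ wd') (delta_shift0 _ wc) (delta_shift0 _ wc').
  by rewrite !scaler0.
have nzY (i j : 'I_n) : Y i j != 0 -> (i = d /\ j = c) \/ (i = d' /\ j = c').
  rewrite !mxE; case: andP => [[/eqP -> /eqP ->]|_]; first by left.
  case: andP => [[/eqP -> /eqP ->]|_]; first by right.
  by rewrite !mulr0 addr0 eqxx.
have [||X Xo [XY Xnz]] := skew_extension km YC.
- apply/suppP => i j /nzY[] [-> ->]; rewrite /pos ?dE ?cE // d'E c'E /=.
  by move: pq; rewrite /le_point /= !lerD2r.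
- by move=> i j /nzY[] [-> ->]; rewrite ?dE ?cE ?d'E ?c'E.
exists X, c, d; split=> //; rewrite XY ?dE ?cE // !mxE !eqxx mulr1.
have -> : (d == d') = false.
  apply/negbTE/eqP => e; case/negP: n4; rewrite -[q + u]/((m, q + u).2) -d'E -e dE /=.
  by rewrite -[q + u]/((m, q + u).2) -d'E -e dE.
by rewrite mulr0 addr0.
Qed.

Lemma two_le_dim_off X1 X2 i j i' j' : X1 \in off -> X2 \in off ->
  X1 i j != 0 -> X1 i' j' = 0 -> X2 i' j' != 0 -> (2 <= \dim off)%N.
Proof.
move=> o1 o2 nz1 z1 nz2; suff fX : free [:: X1; X2].
  apply: (@leq_trans (\dim <<[:: X1; X2]>>)); first by rewrite (eqP fX).
  by apply: dimvS; apply/span_subvP => X; rewrite !inE => /orP[] /eqP ->.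
rewrite free_cons seq1_free span_seq1; apply/andP; split; last first.
  by apply: contraNneq nz2 => ->; rewrite mxE.
apply/negP => /vlineP[a X1E]; move: z1; rewrite X1E mxE => /eqP.
rewrite mulf_eq0 (negbTE nz2) orbF => /eqP a0.
by move: nz1; rewrite X1E a0 scale0r mxE eqxx.
Qed.

Lemma corner_hom_dim_off k m p q : k != m -> corner_hom (D k) (D m) p q -> (0 < \dim off)%N.
Proof.
move=> km /(corner_hom_off km)[X [c [d [Xo [cE dE] XE _]]]]; rewrite lt0n dimv_eq0.
apply/eqP => off0; have := XE d c; rewrite cE dE !eqxx => /(_ erefl erefl) => /eqP.
by move: Xo; rewrite off0 memv0 => /eqP ->; rewrite mxE eq_sym oner_eq0.
Qed.

Lemma two_homs_dim_off k m : k != m -> two_homs (D k) (D m) -> (1 < \dim off)%N.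
Proof.
move=> km [p [q [p' [q' [hom1 ne hom2]]]]].
have [X1 [c [d [o1 [cE dE] X1E _]]]] := corner_hom_off km hom1.
suff [X2 [c' [d' [o2 c'E d'E nz]]]] : exists X c d,
    [/\ X \in off, L c = (k, p'), L d = (m, q') & X d c != 0].
  apply: (@two_le_dim_off _ _ d c d' c' o1 o2) => //.
    by rewrite X1E ?cE ?dE // !eqxx oner_eq0.
  rewrite X1E ?c'E ?d'E //; case: andP => [[/eqP e1 /eqP e2]|//].
  move: ne; rewrite xpair_eqE; move: c'E d'E; rewrite e1 e2 cE dE => -[->] -[->].
  by rewrite !eqxx.
case: hom2 => [hom2|[hom2|hom2]].
- have [X2 [c' [d' [o2 [c'E d'E] X2E _]]]] := corner_hom_off km hom2.
  by exists X2, c', d'; split=> //; rewrite X2E ?c'E ?d'E // !eqxx oner_eq0.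
- by apply: domino_hom_off hom2 => // v []; [right|left].
- by apply: domino_hom_off hom2.
Qed.

Lemma three_diagrams_dim_off k m m' p q p' q' : k != m -> k != m' -> m != m' ->
  corner_hom (D k) (D m) p q -> corner_hom (D k) (D m') p' q' -> (1 < \dim off)%N.
Proof.
move=> km km' mm' hom1 hom2.
have [X1 [c [d [o1 [cE dE] X1E X1nz]]]] := corner_hom_off km hom1.
have [X2 [c' [d' [o2 [c'E d'E] X2E _]]]] := corner_hom_off km' hom2.
apply: (@two_le_dim_off _ _ d c d' c' o1 o2).
- by rewrite X1E ?cE ?dE // !eqxx oner_eq0.
- apply/eqP; apply: contraT => /X1nz; rewrite c'E d'E /= => -[] [e1 e2].
    by rewrite e1 eqxx in mm'.
  by rewrite e1 eqxx in km'.
- by rewrite X2E ?c'E ?d'E // !eqxx oner_eq0.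
Qed.

(** Choose a nonzero entry from [k] to [m] whose source has least coordinate sum. Backward
    propagation makes the source a southwest corner and forward propagation gives the condition on
    continuations, so the entry is at the forced place. A matrix of [off] is thus determined by a
    single entry. *)
Lemma dim_off_le1 k m p0 q0 : k != m -> (forall i, comp i = k \/ comp i = m) ->
  (forall p q, sw_corner (D k) p -> q \in D m -> le_point p q ->
     (forall u, dir u -> q + u \in D m -> p + u \in D k) -> p = p0 /\ q = q0) ->
  (\dim off <= 1)%N.
Proof.
move=> km two forced.
have block X i0 j0 : X \in off -> comp i0 = m -> comp j0 = k -> X i0 j0 != 0 ->
    exists c d, [/\ L c = (k, p0), L d = (m, q0) & X d c != 0].
  move=> /memv_capP[XC /memv_capP[/suppP Xp _]] im jk nz0.
  pose good (dc : 'I_n * 'I_n) := [&& X dc.1 dc.2 != 0, comp dc.1 == m & comp dc.2 == k].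
  have g0 : good (i0, j0) by rewrite /good /= nz0 im jk !eqxx.
  pose M (dc : 'I_n * 'I_n) := (cell dc.2).1 + (cell dc.2).2.
  case: (@Order.TotalTheory.arg_minP _ _ _ (i0, j0) good M g0).
  case=> d c /and3P[/= nz /eqP dm /eqP ck] min_dc.
  have cD := L_in c; have dD := L_in d; rewrite ck in cD; rewrite dm in dD.
  have out u : dir u -> cell c - u \notin D k.
    move=> du; apply/negP; rewrite -ck => /step_exists_pred[b bc].
    have [d' [dd' nz']] := commutant_bwd XC du nz bc.
    have /stepP[c1 c2] := bc; have /stepP[d1 d2] := dd'.
    have := min_dc (d', b); rewrite /good /M /= nz' -d1 -c1 dm ck !eqxx c2 => /(_ isT).
    by case: du => -> /=; lra.
  have [||pE qE] := forced (cell c) (cell d) _ dD (Xp _ _ nz).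
  - by rewrite sw_cornerE cD !out //; [right|left].
  - move=> u du; rewrite -dm => /step_exists[d' dd'].
    have [c' [cc' _]] := commutant_fwd XC du nz dd'.
    by rewrite -ck; apply: step_mem cc'.
  by exists c, d; rewrite -pE -qE -{1}ck -dm -!surjective_pairing.
(* Skewness reflects an entry from [m] to [k] into one from [k] to [m]. *)
have nonzero X : X \in off -> X != 0 -> exists i j, [/\ comp i = m, comp j = k & X i j != 0].
  move=> /memv_capP[_ /memv_capP[_ /memv_capP[+ /suppP Xo]]] /matrix0Pn[i [j nz]].
  rewrite mem_skew_alg addr_eq0 => /eqP XJ; have := Xo _ _ nz.
  case: (two i) (two j) => [ik|im] [jk|jm]; rewrite ?ik ?jk ?im ?jm ?eqxx // => _; last first.
    by exists i, j.
  exists (neg_index j), (neg_index i); rewrite !neg_indexE; split=> //.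
  have := congr1 (fun Y : 'M_n => Y (neg_index i) j) XJ.
  rewrite J_mulr [RHS]mxE J_mull neg_indexK [in LHS]mxE => E.
  apply: contraNneq nz => X0; rewrite X0 mul0r in E; move/esym/eqP: E.
  have nzJ := J_neg_neq0 (neg_index i); rewrite neg_indexK in nzJ.
  by rewrite oppr_eq0 mulf_eq0 (negbTE nzJ).
pose S := [set dc : 'I_n * 'I_n | (L dc.2 == (k, p0)) && (L dc.1 == (m, q0))].
have cardS : (#|S| <= 1)%N.
  apply/card_le1_eqP => -[d c] [d' c']; rewrite !inE /= => /andP[/eqP e1 /eqP e2]
    /andP[/eqP e3 /eqP e4].
  by congr pair; apply: L_inj; rewrite ?e1 ?e2.
apply: leq_trans cardS; apply: (@dim_le_functionals _ _ _ (fun dc X => X dc.1 dc.2)).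
  by move=> dc a X Y; rewrite !mxE.
move=> X Xo X0; apply/eqP; apply: contraT => /(nonzero X Xo)[i [j [im jk nz]]].
have [c [d [cE dE /eqP[]]]] := block X i j Xo im jk nz.
by apply: (X0 (d, c)); rewrite inE /= cE dE !eqxx.
Qed.

Lemma dim_off_eq0 : (forall i j, comp i = comp j) -> \dim off = 0%N.
Proof.
move=> one; apply/eqP; rewrite dimv_eq0 -subv0; apply/subvP => X.
case/memv_capP=> _ /memv_capP[_ /memv_capP[_ /suppP Xo]]; rewrite memv0.
by apply: contraT => /matrix0Pn[i [j /Xo]]; rewrite (one i j) eqxx.
Qed.

End Form.

End Model.

(** * Model pairs *)

Section DiagramData.
Implicit Types (t : classical_type) (G : {fset point}).

Lemma skew_diagram0 : skew_diagram fset0.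
Proof.
split; first by exists 0 => p; rewrite in_fset0.
  by move=> p q; rewrite in_fset0.
by move=> i j; rewrite in_fset0.
Qed.

Lemma diagram_data_skew t r G1 G2 G3 k : diagram_data t r G1 G2 G3 ->
  skew_diagram (tnth [tuple G1; G2; G3] k).
Proof.
have s0 := skew_diagram0.
case: k => [[|[|[|//]]] k3]; rewrite (tnth_nth fset0) /=; case: t => /=.
- by case.
- by case=> -[[]].
- by case=> -[].
- by case=> -[].
- by case=> _ _ _ ->.
- by case=> _ [].
- by case=> _ [].
- by case=> _ _ [[->]|[[[]]]].
- by case=> _ _ _ _ ->.
- by case=> _ _ _ ->.
- by case=> _ _ _ ->.
- by case=> _ _ [[_ ->]|[_ [[]]]].
Qed.

Lemma diagram_data_symmetric t r G1 G2 G3 k : t <> TypeA -> diagram_data t r G1 G2 G3 ->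
  centrally_symmetric (tnth [tuple G1; G2; G3] k).
Proof.
have s0 : centrally_symmetric fset0 by move=> i j; rewrite in_fset0.
case: k => [[|[|[|//]]] k3]; rewrite (tnth_nth fset0) /=; case: t => //= _.
- by case=> -[[]].
- by case=> -[].
- by case=> -[].
- by case=> _ [].
- by case=> _ [].
- by case=> _ _ [[->]|[[[]]]].
- by case=> _ _ _ ->.
- by case=> _ _ _ ->.
- by case=> _ _ [[_ ->]|[_ [[]]]].
Qed.

Lemma half_notin_int : (0 - 2^-1 : rat) \isn't a Num.int.
Proof.
apply/negP => /intrP[m mE]; have : (- 1 : rat) = (m * 2)%:~R.
  by rewrite rmorphM /= -mE; field.
by rewrite -[- 1]/((-1)%:~R) => /intr_inj; lia.
Qed.

Lemma zero_notin_shifted a G : sym_skew a G -> a.1 = 2^-1 \/ a.2 = 2^-1 -> 0 \notin G.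
Proof.
move=> [_ _ lat] aE; apply/negP => /lat /= [i1 i2].
by case: aE => aE; [move: i1|move: i2]; rewrite aE; apply/negP; apply: half_notin_int.
Qed.

End DiagramData.

(** The pairs of a diagram and one of its cells are listed without repetition; the list has length
    [n] because [v] is a basis, so positions in it serve as matrix indices. The sum formula is
    needed for traces in type A. *)
Lemma model_labels (K : fieldType) n (D : 'I_3 -> {fset point}) (v : 'I_3 -> point -> 'cV[K]_n) :
  model_basis D v -> exists L : 'I_n -> 'I_3 * point,
  [/\ injective L, forall i, (L i).2 \in D (L i).1,
      forall k p, p \in D k -> exists i, L i = (k, p),
      forall f : 'I_3 * point -> rat, \sum_i f (L i) = \sum_k \sum_(p <- D k) f (k, p) &
      \matrix_(i, j) v (L j).1 (L j).2 i 0 \in unitmx].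
Proof.
case=> v0; pose lab := [seq (k, p) | k <- enum 'I_3, p <- enum_fset (D k)].
have <- : [seq v l.1 l.2 | l <- lab] =
    flatten [seq [seq v k p | p <- enum_fset (D k)] | k <- enum 'I_3].
  by rewrite /lab map_allpairs.
move=> bas; have slab : size lab = n.
  have := size_basis (X := in_tuple _) bas; rewrite size_map dimvf /dim /= muln1.
  by move=> ->.
have ulab : uniq lab.
  apply: allpairs_uniq_dep; first exact: enum_uniq.
    by move=> k _; apply: fset_uniq.
  by move=> [k p] [k' p'] _ _ /= [-> ->].
have lab_mem k p : ((k, p) \in lab) = (p \in D k).
  apply/allpairsPdep/idP => [[k' [p' [_ pD [-> ->]]]]|pD] //.
  by exists k, p; rewrite mem_enum.
pose L (i : 'I_n) := nth (ord0, 0) lab i.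
have Llab i : L i \in lab by rewrite mem_nth // slab.
exists L; split.
- by move=> i j /eqP; rewrite nth_uniq ?slab // => /eqP /val_inj.
- by move=> i; rewrite -lab_mem -surjective_pairing.
- move=> k p; rewrite -lab_mem => kp; have lt : (index (k, p) lab < n)%N.
    by rewrite -slab index_mem.
  by exists (Ordinal lt); rewrite /L /= nth_index.
- move=> f; transitivity (\sum_(l <- lab) f l).
    by rewrite (big_nth (ord0, 0)) slab big_mkord.
  by rewrite /lab big_allpairs_dep big_enum.
rewrite -unitmx_tr -row_free_unit; apply: inj_row_free => u u0.
have fr := basis_free bas; have sX : size [seq v l.1 l.2 | l <- lab] == n by rewrite size_map slab.
move: fr; rewrite -[map _ _]/(tval (Tuple sX)) => /freeP fr.
apply/rowP => j; rewrite mxE; apply: fr => //.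
apply/matrixP => i z; rewrite ord1 summxE [RHS]mxE.
transitivity ((u *m (\matrix_(i, j) v (L j).1 (L j).2 i 0)^T) 0 i); last by rewrite u0 mxE.
rewrite mxE; apply: eq_bigr => j' _; rewrite !mxE (nth_map (ord0, 0)) ?slab //.
Qed.

Section ModelPair.
Variables (K : closedFieldType) (charK : [pchar K] =i pred0) (n' : nat).
Local Notation n := n'.+1.
Variables (t : classical_type) (J : 'M[K]_n) (JP : admissible_form t J).
Variables (e h : 'M[K]_n * 'M[K]_n).
Let g := classical_algebra t J.
Hypothesis eP : distinguished_pair g e h.
Variables (D : 'I_3 -> {fset point}) (D_skew : forall k, skew_diagram (D k)).
Variables (v : 'I_3 -> point -> 'cV[K]_n).
Hypothesis v0 : forall k p, p \notin D k -> v k p = 0.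
Hypothesis ve1 : forall k p, p \in D k ->
  e.1 *m v k p = model_e1_coef K t p *: v k (p.1 + 1, p.2).
Hypothesis ve2 : forall k p, p \in D k ->
  e.2 *m v k p = model_e2_coef K t p *: v k (p.1, p.2 + 1).
Hypothesis vform : t <> TypeA -> forall k m p q, p \in D k -> q \in D m ->
  (v k p)^T *m J *m v m q = (model_form K t k m p q)%:M.
Variable L : 'I_n -> 'I_3 * point.
Hypothesis (L_inj : injective L).
Hypothesis (L_in : forall i, (L i).2 \in D (L i).1).
Hypothesis (L_onto : forall k p, p \in D k -> exists i, L i = (k, p)).
Hypothesis (L_sum : forall f : 'I_3 * point -> rat,
  \sum_i f (L i) = \sum_k \sum_(p <- D k) f (k, p)).
Let P := \matrix_(i, j) v (L j).1 (L j).2 i 0.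
Hypothesis (Pu : P \in unitmx).

Definition shift_coef u p : K := if u == ex then model_e1_coef K t p else model_e2_coef K t p.

Lemma sgnq_sqr q : sgnq K q * sgnq K q = 1.
Proof. by rewrite /sgnq -exprzMl ?unitrN ?unitr1 // mulrNN mulr1 exp1rz. Qed.

Lemma sgnq_neq0 q : sgnq K q != 0.
Proof. by apply/eqP => q0; have := sgnq_sqr q; rewrite q0 mul0r => /esym/eqP; rewrite oner_eq0. Qed.

Let cf0 u p : shift_coef u p != 0.
Proof.
rewrite /shift_coef; case: ifP => _; case: t => /=; rewrite ?oner_eq0 ?sgnq_neq0 //.
Qed.

Let A := shift_mx L shift_coef.

Let shiftE u f : dir u ->
  (forall k p, p \in D k -> f *m v k p = shift_coef u p *: v k (p + u)) -> f *m P = P *m A u.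
Proof.
move=> du fv; apply/matrixP => a j.
have -> : (f *m P) a j = (shift_coef u (L j).2 *: v (L j).1 ((L j).2 + u)) a 0.
  by rewrite -fv // !mxE; apply: eq_bigr => i _; rewrite mxE.
have [/existsP[i ji]|/existsPn no] := boolP [exists i, step L u j i].
  by rewrite (shift_mulr L_inj _ _ _ ji) !mxE; have /stepP[-> ->] := ji; rewrite mulrC.
rewrite shift_mulr0 // v0 ?scaler0 ?mxE //; apply/negP => /(step_exists L_onto)[i ji].
by have := no i; rewrite ji.
Qed.

Let A1E : A ex = conjP P e.1.
Proof.
rewrite conjPE -mulmxA (shiftE (u := ex)) ?mulKmx //; first by left.
by move=> k p pD; rewrite ve1 // /shift_coef eqxx pointD /= addr0.
Qed.

Let A2E : A ey = conjP P e.2.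
Proof.
rewrite conjPE -mulmxA (shiftE (u := ey)) ?mulKmx //; first by right.
by move=> k p pD; rewrite ve2 // /shift_coef pointD /= addr0.
Qed.

Let conjK X : conjP P (P *m X *m invmx P) = X.
Proof. by rewrite conjPE !mulmxA (mulVmx Pu) mul1mx (mulmxKV Pu). Qed.

Let conjK' X : P *m conjP P X *m invmx P = X.
Proof. by rewrite conjPE !mulmxA (mulmxV Pu) mul1mx (mulmxK Pu). Qed.

Let conj_mul X Y : conjP P (X *m Y) = conjP P X *m conjP P Y.
Proof. by rewrite !conjPE !mulmxA (mulmxK Pu). Qed.

Let conj_ad X Y : conjP P (ad X Y) = ad (conjP P X) (conjP P Y).
Proof. by rewrite !adE linearB /= !conj_mul. Qed.

Let conj_inj : injective (conjP P).
Proof. by move=> X Y XY; rewrite -(conjK' X) XY conjK'. Qed.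

Let conj1 : conjP P 1%:M = 1%:M.
Proof. by rewrite conjPE mulmx1 mulVmx. Qed.

Let e_comm : ad e.1 e.2 = 0.
Proof. by case: eP => -[]. Qed.

Let eg : e.1 \in g /\ e.2 \in g.
Proof. by case: eP => -[[e1g _] [e2g _] _ _] _ _. Qed.

Let A_comm : ad (A ex) (A ey) = 0.
Proof. by rewrite A1E A2E -conj_ad e_comm linear0. Qed.

Let conj_nil x : x \in centralizer g e -> exists k, iter k (mulmx (conjP P x)) 1%:M = 0.
Proof.
move=> xZ; have [_ dist _] := eP; have [k xk] := centralizer_nilpotent charK dist xZ.
exists k; have -> : iter k (mulmx (conjP P x)) 1%:M = conjP P (x ^+ k).
  elim: (k) => [|j IHj] /=; first by rewrite expr0 conj1.
  by rewrite IHj exprS -mulmxE conj_mul.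
by rewrite xk linear0.
Qed.

Let A_nil u : dir u -> exists k, iter k (mulmx (A u)) 1%:M = 0.
Proof.
have [e1g e2g] := eg.
case=> ->; rewrite ?A1E ?A2E; apply: conj_nil; rewrite mem_centralizer ?e1g ?e2g /=.
  by rewrite adxx [ad e.2 e.1]ad_anti e_comm oppr0 eqxx.
by rewrite adxx e_comm eqxx.
Qed.

Let J' := P^T *m J *m P.
Let g' := if t is TypeA then sl_alg K n else skew_alg J'.

Let conj_g x : (conjP P x \in g') = (x \in g).
Proof.
have sk : (conjP P x \in skew_alg J') = (x \in skew_alg J).
  rewrite !mem_skew_alg conjPE /J'.
  have -> : (invmx P *m x *m P)^T *m (P^T *m J *m P) + P^T *m J *m P *m (invmx P *m x *m P) =
      P^T *m (x^T *m J + J *m x) *m P.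
    rewrite mulmxDr mulmxDl; congr (_ + _); last by rewrite !mulmxA (mulmxK Pu).
    rewrite !trmx_mul !mulmxA -[_ *m (invmx P)^T *m P^T]mulmxA -(trmx_mul P) (mulmxV Pu).
    by rewrite trmx1 mulmx1.
  apply/eqP/eqP => [H|->]; last by rewrite mulmx0 mul0mx.
  have PTu : P^T \in unitmx by rewrite unitmx_tr.
  by rewrite -[LHS](mulKmx PTu) -[X in _ *m X](mulmxK Pu) H mul0mx mulmx0.
rewrite /g' /g; case: t sk => //= _; rewrite !mem_sl_alg conjPE mxtrace_mulC mulmxA.
by rewrite (mulmxV Pu) mul1mx.
Qed.

Let c1 i := (L i).2.1.
Let c2 i := (L i).2.2.
Let h' := (P *m diag_mx (\row_i ratr (c1 i)) *m invmx P,
           P *m diag_mx (\row_i ratr (c2 i)) *m invmx P).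

Hypothesis D_sym : t <> TypeA -> forall k, centrally_symmetric (D k).
Hypothesis barycentre : t = TypeA ->
  \sum_k \sum_(p <- D k) p.1 = 0 /\ \sum_k \sum_(p <- D k) p.2 = 0.

Definition form_sign : K := if t is TypeC then -1 else 1.

Let eta2 : form_sign * form_sign = 1.
Proof. by rewrite /form_sign; case: t; rewrite ?mulr1 // mulrNN mulr1. Qed.

Let J'E i j : t <> TypeA -> J' i j = model_form K t (L i).1 (L j).1 (L i).2 (L j).2.
Proof.
move=> tA; have colE a : v (L a).1 (L a).2 = col a P.
  by apply/matrixP => b z; rewrite ord1 !mxE.
have := vform tA (L_in i) (L_in j); rewrite !colE => /matrixP/(_ 0 0).
rewrite [RHS]mxE eqxx mulr1n => <-.
by rewrite tr_col -row_mul !mxE; apply: eq_bigr => a _; rewrite !mxE.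
Qed.

Let J'_supp : t <> TypeA -> forall i j, J' i j != 0 -> L j = ((L i).1, - (L i).2).
Proof.
move=> tA i j; rewrite J'E // /model_form; case: and3P => [[/eqP e1 /eqP e2 /eqP e3] _|_].
  rewrite [LHS]surjective_pairing e3; congr pair.
  by rewrite [LHS]surjective_pairing [RHS]surjective_pairing /= e1 e2 !opprK.
by rewrite mulr0n eqxx.
Qed.

Let J'T : t <> TypeA -> J'^T = form_sign *: J'.
Proof.
move=> tA; have [JT _] := admissible_form_sym tA JP.
by rewrite /J' !trmx_mul trmxK JT -!(scalemxAl, scalemxAr) mulmxA.
Qed.

(** Every row of [J'] has a single nonzero entry, of square 1, at the reflected index; the entry at
    the transposed place differs from it by the sign of the form. *)
Let J'J' : t <> TypeA -> J' *m J' = form_sign%:M.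
Proof.
move=> tA; have partner i : exists j, L j = ((L i).1, - (L i).2).
  by apply: L_onto; rewrite symmetric_mem ?L_in //; apply: D_sym.
have sqr i j : L j = ((L i).1, - (L i).2) -> J' i j * J' i j = 1.
  move=> jE; rewrite J'E // /model_form jE /= !opprK !eqxx /=.
  by case: t => /=; rewrite ?mulr1 // sgnq_sqr.
apply/matrixP => i k; have [j jE] := partner i; rewrite mxE (bigD1 j) //= big1 ?addr0.
  rewrite [RHS]mxE; have [ik|ik] := eqVneq i k.
    have E := congr1 (fun X : 'M_n => X i j) (J'T tA).
    rewrite [LHS]mxE [RHS]mxE in E.
    by rewrite -ik E mulrCA sqr // mulr1.
  have [->|/(J'_supp tA) kE] := eqVneq (J' j k) 0; first by rewrite mulr0.
  case/eqP: ik; apply: L_inj; rewrite kE jE /= opprK -surjective_pairing //.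
move=> j' ne; have [->|/(J'_supp tA) j'E] := eqVneq (J' i j') 0; first by rewrite mul0r.
by case/eqP: ne; apply: L_inj; rewrite jE j'E.
Qed.

Let g'E : t <> TypeA -> g' = skew_alg J'.
Proof. by rewrite /g'; case: t. Qed.

Let A_skew : t <> TypeA -> forall u, dir u -> A u \in skew_alg J'.
Proof.
move=> tA u; have [e1g e2g] := eg.
by case=> ->; rewrite ?A1E ?A2E -g'E // conj_g.
Qed.

(** In type A the trace is the sum of the coordinates, zero by the barycentre condition. In the
    other types [J'] pairs opposite cells, on which [c] takes opposite values. *)
Let weight_g (c : 'I_3 * point -> rat) :
  (forall k p, c (k, - p) = - c (k, p)) ->
  (t = TypeA -> \sum_k \sum_(p <- D k) c (k, p) = 0) -> weight_mx K (fun i => c (L i)) \in g'.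
Proof.
move=> c_odd c_sum; have [tA|tA] := pselect (t = TypeA).
  rewrite /g' tA mem_sl_alg mxtrace_diag; apply/eqP.
  rewrite (eq_bigr (fun i => ratr (c (L i)))) => [|i _]; last by rewrite mxE.
  have -> : \sum_i ratr (c (L i)) = ratr (\sum_i c (L i)) :> K.
    elim/big_rec2: _ => [|i x y _ ->]; first exact/esym/(ratr_nat K 0).
    by rewrite ratrD_char0.
  by rewrite L_sum c_sum //; apply: (ratr_nat K 0).
rewrite g'E // mem_skew_alg /weight_mx tr_diag_mx mul_diag_mx mul_mx_diag; apply/eqP.
have := J'_supp tA; move: (J') => B Bs.
apply/matrixP => i j; rewrite !mxE; have [->|/Bs jE] := eqVneq (B i j) 0.
  by rewrite mulr0 mul0r addr0.
rewrite jE c_odd -surjective_pairing ratrN_char0 //.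
by rewrite [B i j * _]mulrC mulNr subrr.
Qed.

Let weights_g : weight1 K L \in g' /\ weight2 K L \in g'.
Proof.
split; [apply: (weight_g (c := fun l => l.2.1))|apply: (weight_g (c := fun l => l.2.2))];
  by [|move=> /barycentre[]].
Qed.

(** Conjugation by [P] turns [e] into the shifts, [h'] into the coordinate weights and [g] into
    [g'], so [h'] can replace the given pair [h]. *)
Lemma dim_positive_centralizer_model :
  \dim (positive_centralizer g e h) =
  \dim (commutant L shift_coef :&: (supp K (pos L) :&: g'))%VS.
Proof.
have h'1 : conjP P h'.1 = weight1 K L by apply: conjK.
have h'2 : conjP P h'.2 = weight2 K L by apply: conjK.
have hg : h'.1 \in g /\ h'.2 \in g.
  by rewrite -!conj_g h'1 h'2; exact: weights_g.
rewrite (@dim_positive_centralizer_diag _ charK _ t J e h eP P Pu (fun i => (L i).2)) //.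
- pose R i j := (0 <= (L i).2.1 - (L j).2.1) && (0 <= (L i).2.2 - (L j).2.2).
  rewrite -/R; set W := (_ :&: (conjP P @^-1: supp K R))%VS.
  have inj0 : lker (conjP P) == 0%VS by apply/lker0P.
  rewrite -(limg_dim_eq (f := conjP P)); last by rewrite (eqP inj0) capv0.
  congr (\dim _); apply/vspaceP => Y; rewrite -[Y]conjK; set x := P *m Y *m invmx P.
  have -> : (conjP P x \in (conjP P @: W)%VS) = (x \in W).
    by apply/idP/idP => [/memv_imgP[y yU /conj_inj ->] //|]; exact: memv_img.
  have posE : conjP P x \in supp K (pos L) <-> conjP P x \in supp K R.
    by split; apply: (subvP (sub_supp _ _)) => a b; rewrite /R !subr_ge0.
  have comE : conjP P x \in commutant L shift_coef <-> (ad e.1 x == 0) && (ad e.2 x == 0).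
    split=> [/memv_capP[]|/andP[/eqP x1 /eqP x2]].
      rewrite !memv_ker -/(A ex) -/(A ey) A1E A2E -!conj_ad => /eqP x1 /eqP x2.
      by apply/andP; split; apply/eqP; apply: conj_inj; rewrite linear0.
    by apply/memv_capP; rewrite !memv_ker -/(A ex) -/(A ey) A1E A2E -!conj_ad x1 x2 linear0.
  apply/memv_capP/memv_capP => [[]|[xC /memv_capP[xp xg]]].
    rewrite mem_centralizer -memv_preim => /andP[xg /comE xC] /posE xp; split=> //.
    by apply/memv_capP; rewrite conj_g.
  rewrite mem_centralizer -memv_preim -conj_g xg; split; last exact/posE.
  exact/comE.
- by split; apply: conj_inj; rewrite conj_ad h'1 -?A1E -?A2E ?linear0;
    [apply: weight1_ex|apply: weight1_ey].
by split; apply: conj_inj; rewrite conj_ad h'2 -?A1E -?A2E ?linear0;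
  [apply: weight2_ex|apply: weight2_ey].
Qed.

Lemma dim_positive_centralizer_skew : t <> TypeA ->
  (\dim (positive_centralizer g e h) = #|positive_cells L| + \dim (off L shift_coef J'))%N.
Proof.
move=> tA; rewrite dim_positive_centralizer_model g'E //.
apply: (dim_skew_split charK L_inj L_in L_onto D_skew cf0 A_comm A_nil (J'T tA) eta2
  (J'J' tA) (J'_supp tA) (A_skew tA)).
Qed.

Lemma card_positive_cells_model : t <> TypeA ->
  (2 * #|positive_cells L| + #|[set i | (L i).2 == 0%R]| = n)%N.
Proof. by move=> tA; apply: (card_positive_cells L_inj eta2 (J'J' tA) (J'_supp tA)). Qed.

Lemma dim_positive_centralizer_sl : t = TypeA -> (forall i j, (L i).1 = (L j).1) ->
  (\dim (positive_centralizer g e h) <= n')%N.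
Proof.
move=> tA one; rewrite dim_positive_centralizer_model /g' tA -ltnS.
exact: (dim_sl_le charK L_inj L_in L_onto D_skew cf0 one).
Qed.

Lemma dim_off_model_eq0 : (forall i j, (L i).1 = (L j).1) -> \dim (off L shift_coef J') = 0%N.
Proof. exact: dim_off_eq0. Qed.

Lemma dim_off_model_gt0 k m p q : t <> TypeA -> k != m -> corner_hom (D k) (D m) p q ->
  (0 < \dim (off L shift_coef J'))%N.
Proof.
move=> tA; exact: (corner_hom_dim_off L_inj L_in L_onto (J'T tA) eta2 (J'J' tA)
  (J'_supp tA) (A_skew tA)).
Qed.

Lemma dim_off_model_two_homs k m : t <> TypeA -> k != m -> two_homs (D k) (D m) ->
  (1 < \dim (off L shift_coef J'))%N.
Proof.
move=> tA; exact: (two_homs_dim_off L_inj L_in L_onto cf0 (J'T tA) eta2 (J'J' tA)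
  (J'_supp tA) (A_skew tA)).
Qed.

Lemma dim_off_model_three k m m' p q p' q' : t <> TypeA -> k != m -> k != m' -> m != m' ->
  corner_hom (D k) (D m) p q -> corner_hom (D k) (D m') p' q' ->
  (1 < \dim (off L shift_coef J'))%N.
Proof.
move=> tA; exact: (three_diagrams_dim_off L_inj L_in L_onto (J'T tA) eta2 (J'J' tA)
  (J'_supp tA) (A_skew tA)).
Qed.

Lemma dim_off_model_le1 k m : t <> TypeA -> k != m -> (forall i, (L i).1 = k \/ (L i).1 = m) ->
  forced_hom (D k) (D m) -> (\dim (off L shift_coef J') <= 1)%N.
Proof.
move=> tA km two [p0 [q0 forced]].
exact: (dim_off_le1 L_inj L_in L_onto cf0 eta2 (J'J' tA) (J'_supp tA) km two forced).
Qed.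

End ModelPair.

Lemma symmetric_corner_hom G H : skew_diagram G -> skew_diagram H ->
  centrally_symmetric G -> centrally_symmetric H -> G <> fset0 -> H <> fset0 ->
  exists p q, corner_hom G H p q.
Proof.
move=> sG sH symG symH G0 H0.
have [p sw_p p0] := exists_nonpositive_sw_corner sG symG G0.
have [q ne_q q0] := exists_nonnegative_ne_corner sH symH H0.
by exists p, q; rewrite /corner_hom sw_p ne_q; apply: le_point_trans p0 q0.
Qed.

Lemma card_origin n (L : 'I_n -> 'I_3 * point) (D : 'I_3 -> {fset point}) :
  injective L -> (forall i, (L i).2 \in D (L i).1) ->
  (forall k p, p \in D k -> exists i, L i = (k, p)) ->
  #|[set i | (L i).2 == 0]| = #|[set k | (0 : point) \in D k]|.
Proof.
move=> L_inj L_in L_onto; have f_inj : {in [set i | (L i).2 == 0] &, injective (fun i => (L i).1)}.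
  move=> i j; rewrite !inE => /eqP i0 /eqP j0 ij; apply: L_inj.
  by rewrite [LHS]surjective_pairing [RHS]surjective_pairing ij i0 j0.
rewrite -(card_in_imset f_inj); congr #|pred_of_set _|; apply/setP => k; rewrite inE.
apply/imsetP/idP => [[i]|/L_onto[i iE]].
  by rewrite inE => /eqP i0 ->; rewrite -i0.
by exists i; rewrite ?inE iE.
Qed.

Lemma card_ord3 (P : pred 'I_3) : #|[set k | P k]| =
  (P (@Ordinal 3 0 isT) + P (@Ordinal 3 1 isT) + P (@Ordinal 3 2 isT))%N.
Proof.
rewrite -sum1_card big_mkcond /= !big_ord_recl big_ord0 /= !inE addn0 addnA.
congr (nat_of_bool (P _) + nat_of_bool (P _) + nat_of_bool (P _))%N; exact: val_inj.
Qed.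

(** The ring structure on square matrices requires a size in successor form, so [natdim t r] enters
    through an equation. *)
Lemma theorem5p1_succ (K : closedFieldType) (charK : [pchar K] =i pred0)
    (t : classical_type) (r n' : nat) (nE : n'.+1 = natdim t r)
    (J : 'M[K]_n'.+1) (JP : admissible_form t J) (e h : 'M[K]_n'.+1 * 'M[K]_n'.+1)
    (eP : distinguished_pair (classical_algebra t J) e h) :
  let Zplus := positive_centralizer (classical_algebra t J) e h in
  (r <= \dim Zplus)%N /\
  forall G1 G2 G3 : {fset point},
    diagram_data t r G1 G2 G3 -> associated_diagrams t J e G1 G2 G3 ->
    (\dim Zplus = r <->
     [\/ t = TypeA,
         t = TypeB /\ G2 = fset0,
         t = TypeC /\ (G1 = fset0 \/ G2 = fset0) |
         t = TypeD /\
         ((G2 = fset0 /\ G3 = fset0) \/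
          (G1 = fset0 /\
           ((G2 = [fset (0, 0)]%fset /\ one_nonpositive_sw_corner G3) \/
            (rectangular G2 /\ rectangular G3))))]).
Proof.
move=> Zplus; have r_le : (r <= \dim Zplus)%N.
  exact: (rank_le_dim_positive_centralizer charK eP nE JP).
split=> // G1 G2 G3 dd [v [bas ve1 ve2 vform]].
pose D := tnth [tuple G1; G2; G3].
have D_skew k : skew_diagram (D k) := diagram_data_skew k dd.
have D_sym : t <> TypeA -> forall k, centrally_symmetric (D k).
  by move=> tA k; exact: (@diagram_data_symmetric _ _ _ _ _ k tA dd).
have [L [L_inj L_in L_onto L_sum Pu]] := @model_labels _ _ D v bas.
have v0 : forall k p, p \notin D k -> v k p = 0 := bas.1.
pose k0 := @Ordinal 3 0 isT; pose k1 := @Ordinal 3 1 isT; pose k2 := @Ordinal 3 2 isT.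
have D0 : D k0 = G1 by [].
have D1 : D k1 = G2 by [].
have D2 : D k2 = G3 by [].
have kP k : [\/ k = k0, k = k1 | k = k2].
  by case: k => [[|[|[|//]]] k3]; [apply: Or31|apply: Or32|apply: Or33]; apply: val_inj.
have comp_in i k : (L i).1 = k -> D k = fset0 -> False.
  by move=> ik Dk; have := L_in i; rewrite ik Dk in_fset0.
have bary : t = TypeA ->
    \sum_k \sum_(p <- D k) p.1 = 0 /\ \sum_k \sum_(p <- D k) p.2 = 0.
  move=> tA; move: dd; rewrite tA => -[_ _ [b1 b2] E2 E3].
  have sum3 (f : point -> rat) : \sum_k \sum_(p <- D k) f p = \sum_(p <- G1) f p.
    rewrite !big_ord_recl big_ord0 -/k0.
    have -> : D (lift ord0 ord0) = fset0 by rewrite -E2 -D1; congr (D _); apply: val_inj.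
    have -> : D (lift ord0 (lift ord0 ord0)) = fset0
      by rewrite -E3 -D2; congr (D _); apply: val_inj.
    by rewrite !big_nil !addr0.
  by rewrite !sum3.
have [tA|tA] := pselect (t = TypeA).
  split=> _; first exact: Or41.
  apply/eqP; rewrite eqn_leq r_le andbT.
  have one i j : (L i).1 = (L j).1.
    have E2 : G2 = fset0 by move: dd; rewrite tA => -[].
    have E3 : G3 = fset0 by move: dd; rewrite tA => -[].
    have all0 a : (L a).1 = k0.
      by case: (kP (L a).1) => // ak; case: (comp_in a _ ak); rewrite ?D1 ?D2.
    by rewrite !all0.
  have := dim_positive_centralizer_sl charK eP D_skew v0 ve1 ve2 vform L_inj L_in
    L_onto L_sum Pu bary tA one.
  by move: nE; rewrite /Zplus tA => -[<-].
have := dim_positive_centralizer_skew charK JP eP D_skew v0 ve1 ve2 vform L_inj L_in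
    L_onto L_sum Pu D_sym bary tA.
have := card_positive_cells_model JP vform L_inj L_in L_onto D_sym tA.
have := @dim_off_model_gt0 _ _ _ _ JP _ _ eP _ _ v0 ve1 ve2 vform _ L_inj L_in L_onto Pu D_sym.
have := @dim_off_model_two_homs _ _ _ _ JP _ _ eP _ _ v0 ve1 ve2 vform _ L_inj L_in L_onto
  Pu D_sym.
have := @dim_off_model_three _ _ _ _ JP _ _ eP _ _ v0 ve1 ve2 vform _ L_inj L_in L_onto Pu D_sym.
have := @dim_off_model_le1 _ _ _ _ JP _ _ vform _ L_inj L_in L_onto D_sym.
have := @dim_off_model_eq0 _ _ t J v L.
rewrite (card_origin L_inj L_in L_onto) card_ord3 -/k0 -/k1 -/k2 -/Zplus.
move: (\dim (off _ _ _)) #|positive_cells L| => O p off0 off_le1 off_three off_two off_gt0.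
move=> cardE dimE.
have one_comp k : (forall k', k' != k -> D k' = fset0) -> O = 0%N.
  move=> only; apply: off0 => i j.
  have all_k a : (L a).1 = k.
    by apply/eqP; apply: contraT => ne; case: (comp_in a _ erefl (only _ ne)).
  by rewrite !all_k.
have hom k m : k != m -> D k <> fset0 -> D m <> fset0 -> exists p q, corner_hom (D k) (D m) p q.
  by move=> _ Dk Dm; apply: symmetric_corner_hom => //; apply: D_sym.
have gt0 k m : k != m -> D k <> fset0 -> D m <> fset0 -> (0 < O)%N.
  by move=> km Dk Dm; have [x [y xy]] := hom k m km Dk Dm; apply: off_gt0 xy.
have : [\/ t = TypeB, t = TypeC | t = TypeD].
  by case: (t) tA => // _; [apply: Or31|apply: Or32|apply: Or33].
have z2 : D k2 = fset0 -> (0 : point) \in D k2 = false by move=> ->; rewrite in_fset0.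
case=> tE; rewrite tE /= in dd nE.
- case: dd => [[_ G1n] sG2 _ G3E].
  rewrite (z2 G3E) D1 (negbTE (zero_notin_shifted sG2 (or_introl erefl))) in cardE.
  (* The size is odd, so by parity the origin is a cell of the first diagram. *)
  have pr : p = r by move: cardE nE; case: (_ \in _); lia.
  rewrite dimE pr; split=> [O0|].
    apply: Or42; split=> //; apply: contrapT => G2n.
    by have := gt0 k0 k1 erefl G1n G2n; lia.
  rewrite tE; case=> [//|[_ G2E]|[]//|[]//]; rewrite (one_comp k0) ?addn0 // => k.
  by case: (kP k) => ->.
- case: dd => [sG1 sG2 _ G3E].
  rewrite (z2 G3E) D1 D0 (negbTE (zero_notin_shifted sG2 (or_introl erefl)))
    (negbTE (zero_notin_shifted sG1 (or_intror erefl))) in cardE.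
  have pr : p = r by move: cardE nE; lia.
  rewrite dimE pr; split=> [O0|].
    apply: Or43; split=> //; apply: contrapT => /not_orP[G1n G2n].
    by have := gt0 k0 k1 erefl G1n G2n; lia.
  rewrite tE; case=> [//|[]//|[_ [G1E|G2E]]|[]//].
    by rewrite (one_comp k1) ?addn0 // => k; case: (kP k) => ->.
  by rewrite (one_comp k0) ?addn0 // => k; case: (kP k) => ->.
case: dd => [sG1 _ G23].
rewrite D0 (negbTE (zero_notin_shifted sG1 (or_introl erefl))) in cardE.
case: G23 => [[G2E G3E]|[[sG2 G2n] [sG3 G3n] GG G3o]].
  rewrite (z2 G3E) D1 G2E in_fset0 in cardE.
  have pr : p = r by move: cardE nE; lia.
  rewrite dimE pr (one_comp k0) ?addn0 => [|k]; last by case: (kP k) => ->.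
  by split=> // _; apply: Or44; split=> //; left.
have /fsetIP[G20 G30] : (0, 0) \in (G2 `&` G3)%fset by rewrite GG in_fset1.
(* The origin lies in both integral diagrams, so two of the [2 * r] cells are at the origin;
   equality with the rank now means [O = 1]. *)
have pr : (p.+1 = r)%N.
  by move: cardE nE; rewrite D1 D2 (G20 : (0 : point) \in G2) (G30 : (0 : point) \in G3); lia.
have [skG2 symG2 _] := sG2; have [skG3 symG3 _] := sG3.
have -> : \dim Zplus = r <-> O = 1%N by rewrite dimE; lia.
have O1 : (0 < O)%N by apply: (gt0 k1 k2).
have le1 : G1 = fset0 -> forced_hom G2 G3 -> O = 1%N.
  move=> G1E fh; apply/eqP; rewrite eqn_leq O1 andbT; apply: (off_le1 k1 k2) => // i.
  by case: (kP (L i).1) => ik; [case: (comp_in i _ ik G1E)|left|right].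
split=> [OE|].
  apply: Or44; split=> //; right.
  (* A nonempty first diagram would have homomorphisms to each of the other two, in different blocks
     and hence independent. *)
  have G1E : G1 = fset0.
    apply: contrapT => G1n.
    have [x [y xy]] := hom k0 k1 erefl G1n G2n; have [x' [y' xy']] := hom k0 k2 erefl G1n G3n.
    by have := off_three k0 k1 k2 _ _ _ _ tA erefl erefl erefl xy xy'; lia.
  split=> //; have [G2o|G2o] := pselect (G2 = [fset (0, 0)]%fset).
    left; split=> //; apply: contrapT => none.
    have := off_two k1 k2 tA erefl; rewrite D1 D2 G2o => /(_ (two_homs_point skG3 symG3 G3n none)).
    lia.
  (* Neither diagram is a point here, so each of them may take the part of the nonrectangular
     one. *)
  right; split; apply: contrapT => nrect.
    have := off_two k1 k2 tA erefl; rewrite D1 D2.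
    by move=> /(_ (two_homs_nonrectangular sG2 sG3 GG G3o nrect)); lia.
  have := off_two k2 k1 tA erefl; rewrite D1 D2.
  by rewrite fsetIC in GG; move=> /(_ (two_homs_nonrectangular sG3 sG2 GG G2o nrect)); lia.
rewrite tE; case=> [//|[]//|[]//|[_ [[G2E _]|[G1E]]]]; first by [].
case=> [[G2E one]|[r2 r3]]; apply: le1 => //.
  by rewrite G2E; apply: forced_hom_point.
exact: forced_hom_rectangular.
Qed.

Theorem theorem5p1 (K : closedFieldType) (charK : [pchar K] =i pred0)
    (t : classical_type) (r : nat) (rP : simple_rank t r)
    (J : 'M[K]_(natdim t r)) (JP : admissible_form t J)
    (e h : 'M[K]_(natdim t r) * 'M[K]_(natdim t r))
    (eP : distinguished_pair (classical_algebra t J) e h) :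
  let Zplus := positive_centralizer (classical_algebra t J) e h in
  (r <= \dim Zplus)%N /\
  forall G1 G2 G3 : {fset point},
    diagram_data t r G1 G2 G3 -> associated_diagrams t J e G1 G2 G3 ->
    (\dim Zplus = r <->
     [\/ t = TypeA,
         t = TypeB /\ G2 = fset0,
         t = TypeC /\ (G1 = fset0 \/ G2 = fset0) |
         t = TypeD /\
         ((G2 = fset0 /\ G3 = fset0) \/
          (G1 = fset0 /\
           ((G2 = [fset (0, 0)]%fset /\ one_nonpositive_sw_corner G3) \/
            (rectangular G2 /\ rectangular G3))))]).
Proof.
have : (0 < natdim t r)%N by move: rP; case: (t) => /=; lia.
move nE: (natdim t r) J JP e h eP => [|n'] J JP e h eP //= _.
exact: theorem5p1_succ (esym nE) _ JP _ _ eP.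
Qed.
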